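(* Let $k$ be an algebraically closed field (of arbitrary characteristic), let $r,s\ge 0$ and $m\ge1$ be integers, and let $\lambda$ be a partition of $t\le r$ with $l(\lambda)\le s$ and $\lambda_1\le m$. Then (i) the elements $u_T$, with $T$ a row semi-standard tableau of shape $\lambda$ with entries $\le m$, form a basis of $k[\mathrm{Mat}_{rs}^m]^{U_r\times U_s}_{(-(1^t)^{\rm rev},\lambda)}$; (ii) the elements $v_T$, with $T$ a row semi-standard tableau of shape $\lambda$ with entries $\le m$, form a basis of $k[\mathrm{Mat}_{sr}^m]^{U_s\times U_r}_{(-\lambda^{\rm rev},1^t)}$; and both vector spaces are, with the $\mathrm{GL}_m$-action described in the context, isomorphic to the Weyl module of $\mathrm{GL}_m$ of highest weight $\lambda'$ (the transpose of $\lambda$).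
   Context: $\mathrm{Mat}_{rs}^m$ is the space of $m$-tuples of $r\times s$ matrices over $k$. $T_n\le\mathrm{GL}_n$ is the subgroup of diagonal matrices and $U_n$ the subgroup of upper uni-triangular matrices; characters of $T_n$ are identified with $\mathbb Z^n$ via $D\mapsto\prod_iD_{ii}^{\chi_i}$. $\mathrm{GL}_r\times\mathrm{GL}_s$ acts on $\mathrm{Mat}_{rs}^m$ by $((R,S)\cdot\underline A)_i=RA_iS^{-1}$ and on $k[\mathrm{Mat}_{rs}^m]$ by $((R,S)\cdot f)(\underline A)=f((R^{-1},S^{-1})\cdot\underline A)$ (similarly with $r$ and $s$ interchanged). $M^{U_r\times U_s}_\chi$ denotes the space of $U_r\times U_s$-invariants of $T_r\times T_s$-weight $\chi$. $l(\lambda)$ is the length of $\lambda$. Partitions are extended by zeros to tuples of the appropriate length: in (i) $1^t$ is viewed as an $r$-tuple and $\lambda$ as an $s$-tuple, so $-(1^t)^{\rm rev}=(0,\ldots,0,-1,\ldots,-1)\in\mathbb Z^r$ (with $t$ entries $-1$); in (ii) $\lambda$ is viewed as an $s$-tuple, $-\lambda^{\rm rev}=(-\lambda_s,\ldots,-\lambda_1)$, and $1^t$ as an $r$-tuple. $\mathrm{GL}_m$-action: $\mathrm{GL}_m$ acts on $\mathrm{Mat}_{rs}^m=\mathrm{Mat}_{rs}\otimes k^m$ through the action $g\cdot v=vg^{-1}$ on $k^m$ (row vectors), i.e. $(g\cdot\underline A)_j=\sum_iA_i(g^{-1})_{ij}$, and on functions by $(g\cdot f)(\underline A)=f(g^{-1}\cdot\underline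 A)$; similarly for $\mathrm{Mat}_{sr}^m$. This commutes with the action of $\mathrm{GL}_r\times\mathrm{GL}_s$. A partition $\lambda$ is identified with its Young diagram $\{(i,j)\mid 1\le i\le l(\lambda),1\le j\le\lambda_i\}$ ($i$ the row index). A tableau of shape $\lambda$ is a map $T:\lambda\to\{1,2,\ldots\}$, with $T_{ij}=T(i,j)$; it is row semi-standard if its entries are strictly increasing along rows (left to right) and weakly increasing down columns. The column stabiliser $C_\lambda\le\mathrm{Sym}(\lambda)$ is the group of permutations of the boxes of $\lambda$ that preserve each column; it acts on tableaux of shape $\lambda$ by permuting the positions of the entries. For $T$ a tableau of shape $\lambda$ with entries $\le m$, $u_T\in k[\mathrm{Mat}_{rs}^m]$ is the function $$(A_1,\ldots,A_m)\mapsto\sum_S\det\big(A_{S_{11}}e_1|\cdots|A_{S_{1\lambda_1}}e_1|\cdots|A_{S_{l(\lambda)1}}e_{l(\lambda)}|\cdots|A_{S_{l(\lambda)\lambda_{l(\lambda)}}}e_{l(\lambda)}\big)_{t\rfloor}$$ and $v_T\in k[\mathrm{Mat}_{sr}^m]$ is the function $$(A_1,\ldots,A_m)\mapsto\sum_S\det\big(A_{S_{11}}'e_s|\cdots|A_{S_{1\lambda_1}}'e_s|\cdots|A_{S_{l(\lambda)1}}'e_{s-l(\lambda)+1}|\cdots|A_{S_{l(\lambda)\lambda_{l(\lambda)}}}'e_{s-l(\lambda)+1}\big)_{\lfloor t},$$ where both sums are over all (distinct) tableaux $S$ in the orbit of $T$ under $C_\lambda$, the matrix inside has one column for each box of $\lambda$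 (read row by row), the subscripts $t\rfloor$ and $\lfloor t$ mean that one takes the last, respectively the first, $t$ rows of the $r\times t$ matrix, $e_1,\ldots,e_s$ is the standard basis of $k^s$, and $A_i'$ is the transpose of $A_i$. The Weyl module of highest weight $\lambda'$ is the standard module $\Delta_{\mathrm{GL}_m}(\lambda')$ relative to the Borel subgroup $T_mU_m$. *)

(* Defs.v *)
From HB Require Import structures.
From mathcomp Require Import all_boot all_order all_fingroup all_algebra.
From mathcomp Require Import boolp functions.
From mathcomp Require mpoly.
Import -(notations) mpoly.
Set Implicit Arguments.
Unset Strict Implicit.
Unset Printing Implicit Defensive.

Import GRing.Theory.
Local Open Scope ring_scope.

Record GL (k : fieldType) (n : nat) := GLof {
  GL_mx :> 'M[k]_n;
  GL_unit : GL_mx \in unitmx }.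

HB.instance Definition _ k n := [isSub for @GL_mx k n].
HB.instance Definition _ k n := [Choice of GL k n by <:].

Section GLgroup.
Variables (k : fieldType) (n : nat).
Implicit Types g h : GL k n.

Lemma GL_mul_subproof g h : GL_mx g *m GL_mx h \in unitmx.
Proof. by rewrite unitmx_mul (GL_unit g) (GL_unit h). Qed.

Lemma GL_inv_subproof g : invmx (GL_mx g) \in unitmx.
Proof. by rewrite unitmx_inv (GL_unit g). Qed.

Definition GL_one : GL k n := GLof (unitmx1 k n).
Definition GL_mul g h : GL k n := GLof (GL_mul_subproof g h).
Definition GL_inv g : GL k n := GLof (GL_inv_subproof g).

Lemma GL_mulA : associative GL_mul.
Proof. by move=> f g h; apply: val_inj; rewrite /= mulmxA. Qed.

Lemma GL_mul1 : left_id GL_one GL_mul.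
Proof. by move=> g; apply: val_inj; rewrite /= mul1mx. Qed.

Lemma GL_mulr1 : right_id GL_one GL_mul.
Proof. by move=> g; apply: val_inj; rewrite /= mulmx1. Qed.

Lemma GL_mulV : left_inverse GL_one GL_inv GL_mul.
Proof. by move=> g; apply: val_inj; rewrite /= mulVmx ?(GL_unit g). Qed.

Lemma GL_mulrV : right_inverse GL_one GL_inv GL_mul.
Proof. by move=> g; apply: val_inj; rewrite /= mulmxV ?(GL_unit g). Qed.

HB.instance Definition _ := isGroup.Build (GL k n)
  GL_mulA GL_mul1 GL_mulr1 GL_mulV GL_mulrV.

End GLgroup.

Definition diag_torus k n : {pred GL k n} := fun g => is_diag_mx (GL_mx g).

Definition upper_unitri k n : {pred GL k n} :=
  fun g => is_trig_mx (GL_mx g)^T && [forall i, GL_mx g i i == 1].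

Definition lower_borel k n : {pred GL k n} := fun g => is_trig_mx (GL_mx g).

Definition weight_char k n (chi : 'I_n -> int) (g : GL k n) : k :=
  \prod_i GL_mx g i i ^ chi i.

Record gmodule (k : fieldType) (G : groupType) := GModule {
  gmod_sort :> lmodType k;
  gact : G -> gmod_sort -> gmod_sort;
  gact_linear : forall g, linear (gact g);
  gact1 : forall v, gact 1%g v = v;
  gactM : forall g h v, gact (g * h)%g v = gact g (gact h v) }.

Definition gmod_iso k G (M N : gmodule k G) : Prop :=
  exists phi : {linear M -> N},
    bijective phi /\ forall g v, phi (gact g v) = gact g (phi v).

Section Submodule.
Variables (k : fieldType) (G : groupType) (M : gmodule k G) (S : {pred M}).
Hypotheses (submodS : submod_closed S).
Hypotheses (stableS : forall g v, v \in S -> gact g v \in S).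

Definition sub_carrier of submod_closed S := {v : M | v \in S}.
Local Notation W := (sub_carrier submodS).

HB.instance Definition _ := SubChoice.on W.
HB.instance Definition _ :=
  GRing.SubChoice_isSubLmodule.Build k M S W submodS.

Definition sub_gact (g : G) (w : W) : W :=
  exist (fun v => v \in S) (gact g (val w)) (stableS g (valP w)).

Lemma sub_gact_linear g : linear (sub_gact g).
Proof. by move=> a u v; apply: val_inj; rewrite /= gact_linear. Qed.

Lemma sub_gact1 w : sub_gact 1%g w = w.
Proof. by apply: val_inj; rewrite /= gact1. Qed.

Lemma sub_gactM g h w : sub_gact (g * h)%g w = sub_gact g (sub_gact h w).
Proof. by apply: val_inj; rewrite /= gactM. Qed.

Definition sub_gmodule : gmodule k G :=
  GModule sub_gact_linear sub_gact1 sub_gactM.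

End Submodule.

Section FunctionModule.
Variables (k : fieldType) (G : groupType) (X : Type) (op : G -> X -> X).
Hypothesis (op1 : forall x, op 1%g x = x).
Hypothesis (opM : forall g h x, op (g * h)%g x = op g (op h x)).

Definition fun_gact (g : G) (f : X -> k^o) : X -> k^o := fun x => f (op g^-1%g x).

Lemma fun_gact_linear g : linear (fun_gact g).
Proof. by []. Qed.

Lemma fun_gact1 f : fun_gact 1%g f = f.
Proof. by apply/funext => x; rewrite /fun_gact invg1 op1. Qed.

Lemma fun_gactM g h f : fun_gact (g * h)%g f = fun_gact g (fun_gact h f).
Proof. by apply/funext => x; rewrite /fun_gact invgM opM. Qed.

Definition fun_gmodule : gmodule k G :=
  GModule fun_gact_linear fun_gact1 fun_gactM.

End FunctionModule.

Section Dual.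
Variables (k : fieldType) (G : groupType) (M : gmodule k G).

Definition linear_form : {pred fun_gmodule k (@gact1 _ _ M) (@gactM _ _ M)} :=
  fun l : M -> k^o => `[< linear l >].

Lemma linear_form_submod : submod_closed linear_form.
Proof.
split=> [|a l1 l2 /asboolP l1P /asboolP l2P]; apply/asboolP => b u v.
  by rewrite scaler0 addr0.
have E (f g : M -> k^o) x : (a *: f + g) x = a *: f x + g x by [].
by rewrite !E l1P l2P !scalerDr !scalerA mulrC addrACA.
Qed.

Lemma linear_form_stable g l : l \in linear_form -> gact g l \in linear_form.
Proof.
move=> /asboolP lP; apply/asboolP => b u v /=.
by rewrite /fun_gact gact_linear lP.
Qed.

Definition dual_gmodule : gmodule k G :=
  sub_gmodule linear_form_submod linear_form_stable.

End Dual.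

(* Since k will be infinite, the coordinate ring of a variety X is identified
   with a ring of functions X -> k: the polynomial expressions in finitely many
   coordinate functions c. *)
Section Regular.
Variables (k : fieldType) (X : Type) (I : finType) (c : I -> X -> k^o).

Definition regular_fun : {pred X -> k^o} := fun f =>
  `[< exists p : mpoly #|I| k,
        forall x, f x = meval (fun i => c (enum_val i) x) p >].

Lemma regular_coord i : c i \in regular_fun.
Proof.
apply/asboolP; exists (mpolyX k (mnm1 (enum_rank i))) => x.
by rewrite mevalXU enum_rankK.
Qed.

Lemma regular_submod : submod_closed regular_fun.
Proof.
split=> [|a f g /asboolP[p pE] /asboolP[q qE]]; apply/asboolP.
  by exists 0 => x; rewrite meval0.
exists (a *: p + q) => x; rewrite mevalD mevalZ -pE -qE.
by [].
Qed.

Lemma regular_sum (J : finType) (a : J -> k) (v : J -> X -> k^o) :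
  (forall j, v j \in regular_fun) -> (fun x => \sum_j a j * v j x) \in regular_fun.
Proof.
move=> vR; apply/asboolP.
have /choice[q qE] : forall j, exists q : mpoly #|I| k,
    forall x, v j x = meval (fun i => c (enum_val i) x) q.
  by move=> j; apply/asboolP/vR.
exists (\sum_j a j *: q j) => x; rewrite raddf_sum /=.
by apply: eq_bigr => j _; rewrite mevalZ qE.
Qed.

Lemma regular_comp (h : X -> X) f :
  (forall i, (fun x => c i (h x)) \in regular_fun) ->
  f \in regular_fun -> (fun x => f (h x)) \in regular_fun.
Proof.
move=> hP /asboolP[p pE]; apply/asboolP.
have /choice[q qE] : forall i, exists q : mpoly #|I| k,
    forall x, c i (h x) = meval (fun j => c (enum_val j) x) q.
  by move=> i; apply/asboolP/hP.
exists (comp_mpoly [tuple q (enum_val i) | i < #|I|] p) => x.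
rewrite comp_mpoly_meval pE; apply: meval_eq => i.
by rewrite tnth_mktuple qE.
Qed.

End Regular.

Section Weyl.
Variables (k : fieldType) (n : nat).

Definition GL_coord (x : option ('I_n * 'I_n)) (g : GL k n) : k^o :=
  if x is Some (i, j) then GL_mx g i j else (\det (GL_mx g))^-1.

Lemma GL_lmul1 (x : GL k n) : (1 * x = x)%g. Proof. exact: mul1g. Qed.

Lemma GL_lmulM (g h x : GL k n) : (g * h * x = g * (h * x))%g.
Proof. by rewrite mulgA. Qed.

Definition GL_functions := fun_gmodule k GL_lmul1 GL_lmulM.

Definition induced (chi : 'I_n -> int) : {pred GL_functions} :=
  fun f : GL k n -> k^o => `[< f \in regular_fun GL_coord /\
    forall g b, b \in @lower_borel k n ->
      f (g * b)%g = (weight_char chi b)^-1 * f g >].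

Lemma induced_submod chi : submod_closed (induced chi).
Proof.
have [R0 RD] := regular_submod GL_coord.
split=> [|a f g /asboolP[fR fB] /asboolP[gR gB]]; apply/asboolP; split.
- exact: R0.
- by move=> g b _; rewrite mulr0.
- exact: RD.
move=> x b bB; have E (u v : GL k n -> k^o) y : (a *: u + v) y = a * u y + v y.
  by [].
by rewrite !E fB // gB // mulrDr mulrCA.
Qed.

Lemma induced_stable chi g f : f \in induced chi -> gact g f \in induced chi.
Proof.
move=> /asboolP[fR fB]; apply/asboolP; split; last first.
  by move=> x b bB /=; rewrite /fun_gact mulgA fB.
apply: (@regular_comp _ _ _ _ (fun x => (g^-1 * x)%g)) => // -[[i j]|] /=.
  have -> : (fun x : GL k n => (invmx (GL_mx g) *m GL_mx x) i j) =
            fun x => \sum_l invmx (GL_mx g) i l * GL_coord (Some (l, j)) x.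
    by apply/funext => x; rewrite mxE.
  by apply: regular_sum => l; apply: regular_coord.
have -> : (fun x : GL k n => (\det (invmx (GL_mx g) *m GL_mx x))^-1) =
          (\det (invmx (GL_mx g)))^-1 *: GL_coord None + 0.
  by apply/funext => x; rewrite addr0 det_mulmx invfM.
have [R0 RD] := regular_submod GL_coord.
by apply: RD => //; apply: regular_coord.
Qed.

(* Induction from the Borel subgroup opposite to the upper triangular one, so
   that for dominant chi this module has highest weight chi with respect to
   the upper triangular Borel subgroup. *)
Definition costandard (chi : 'I_n -> int) : gmodule k (GL k n) :=
  sub_gmodule (induced_submod chi) (@induced_stable chi).

(* chi |-> - w_0 chi, where w_0 is the longest element of the Weyl group. *)
Definition neg_rev (chi : 'I_n -> int) : 'I_n -> int := fun i => - chi (rev_ord i).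

Definition weyl (chi : 'I_n -> int) : gmodule k (GL k n) :=
  dual_gmodule (costandard (neg_rev chi)).

End Weyl.

Arguments weyl k {n} chi.

Section MatTuples.
Variables (k : fieldType) (r s m : nat).

Definition mats := {ffun 'I_m -> 'M[k]_(r, s)}.

Definition mats_coord (x : 'I_m * 'I_r * 'I_s) (A : mats) : k^o :=
  A x.1.1 x.1.2 x.2.

Definition mats_act_rs (R : GL k r) (S : GL k s) (A : mats) : mats :=
  [ffun i => GL_mx R *m A i *m GL_mx (S^-1)%g].

Definition fun_act_rs (R : GL k r) (S : GL k s) (f : mats -> k^o) : mats -> k^o :=
  fun A => f (mats_act_rs R^-1%g S^-1%g A).

Definition mats_act_m (g : GL k m) (A : mats) : mats :=
  [ffun j => \sum_i GL_mx (g^-1)%g i j *: A i].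

Lemma mats_act_m1 A : mats_act_m 1%g A = A.
Proof.
apply/ffunP => j; rewrite ffunE invg1 (bigD1 j) //= mxE eqxx scale1r.
by rewrite big1 ?addr0 // => i /negPf ij; rewrite mxE ij scale0r.
Qed.

Lemma mats_act_mM g h A : mats_act_m (g * h)%g A = mats_act_m g (mats_act_m h A).
Proof.
apply/ffunP => j; rewrite !ffunE invgM.
under [RHS]eq_bigr do rewrite ffunE scaler_sumr.
rewrite exchange_big /=; apply: eq_bigr => i _.
rewrite mxE scaler_suml; apply: eq_bigr => l _.
by rewrite scalerA mulrC.
Qed.

Definition mats_functions := fun_gmodule k mats_act_m1 mats_act_mM.

Definition hwv (chi : 'I_r -> int) (psi : 'I_s -> int) : {pred mats_functions} :=
  fun f : mats -> k^o => `[< [/\ f \in regular_fun mats_coord,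
    forall R S, R \in @upper_unitri k r -> S \in @upper_unitri k s ->
      fun_act_rs R S f = f
  & forall D E, D \in @diag_torus k r -> E \in @diag_torus k s ->
      fun_act_rs D E f = (weight_char chi D * weight_char psi E) *: f] >].

Lemma hwv_submod chi psi : submod_closed (hwv chi psi).
Proof.
have [R0 RD] := regular_submod mats_coord.
split=> [|a f g /asboolP[fR fU fT] /asboolP[gR gU gT]]; apply/asboolP; split.
- exact: R0.
- by [].
- by move=> D E _ _; rewrite scaler0.
- exact: RD.
- by move=> R S RU SU; rewrite -{2}(fU R S) // -{2}(gU R S).
- move=> D E DT ET; have -> : fun_act_rs D E (a *: f + g) =
      a *: fun_act_rs D E f + fun_act_rs D E g by [].
  by rewrite fT // gT // scalerDr !scalerA mulrC.
Qed.

Lemma mats_act_comm R S g A :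
  mats_act_rs R S (mats_act_m g A) = mats_act_m g (mats_act_rs R S A).
Proof.
apply/ffunP => j; rewrite !ffunE mulmx_sumr mulmx_suml.
by apply: eq_bigr => i _; rewrite ffunE -scalemxAr -scalemxAl.
Qed.

Lemma hwv_stable chi psi g f : f \in hwv chi psi -> gact g f \in hwv chi psi.
Proof.
have comm R S (h : mats -> k^o) :
    fun_act_rs R S (fun A => h (mats_act_m g^-1%g A)) =
    (fun A => fun_act_rs R S h (mats_act_m g^-1%g A)).
  by apply/funext => A; rewrite /fun_act_rs mats_act_comm.
move=> /asboolP[fR fU fT]; apply/asboolP; split.
- apply: regular_comp => // -[[i a] b] /=.
  have -> : (fun A : mats => mats_coord (i, a, b) (mats_act_m g^-1%g A)) =
            fun A => \sum_l GL_mx g l i * mats_coord (l, a, b) A.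
    apply/funext => A; rewrite /mats_coord ffunE invgK summxE /=.
    by apply: eq_bigr => l _; rewrite mxE.
  by apply: regular_sum => l; apply: regular_coord.
- by move=> R S RU SU; rewrite /= /fun_gact comm fU.
- by move=> D E DT ET; rewrite /= /fun_gact comm fT.
Qed.

Definition hwv_module chi psi : gmodule k (GL k m) :=
  sub_gmodule (@hwv_submod chi psi) (@hwv_stable chi psi).

End MatTuples.

Arguments hwv k {r s} m chi psi.
Arguments hwv_module k {r s} m chi psi.

Definition is_partition (la : seq nat) : bool :=
  sorted geq la && (0%N \notin la).

Definition part_size (la : seq nat) : nat := (\sum_(i < size la) nth 0 la i)%N.

Definition transpose_part (la : seq nat) : seq nat :=
  mkseq (fun j => count (fun p => j < p)%N la) (head 0%N la).

Definition part_weight n (la : seq nat) : 'I_n -> int :=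
  fun i => (nth 0%N la i)%:Z.
Arguments part_weight n la i : clear implicits.

(* Rows, columns and entries are all numbered from 0. *)
Definition box (la : seq nat) := {i : 'I_(size la) & 'I_(nth 0%N la i)}.
HB.instance Definition _ la := Finite.on (box la).

Definition box_row la (b : box la) : nat := tag b.
Definition box_col la (b : box la) : nat := tagged b.

Definition tableau (la : seq nat) (m : nat) := {ffun box la -> 'I_m}.
HB.instance Definition _ la m := Finite.on (tableau la m).

Definition row_semistandard la m (T : tableau la m) : bool :=
  [forall b, forall c,
    ((box_row b == box_row c) && (box_col b < box_col c)%N ==> (T b < T c)%N) &&
    ((box_col b == box_col c) && (box_row b < box_row c)%N ==> (T b <= T c)%N)].

Definition col_stab (la : seq nat) : {set {perm box la}} :=
  [set p : {perm box la} | [forall b, box_col (p b) == box_col b]].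

Definition col_orbit la m (T : tableau la m) : {set tableau la m} :=
  [set [ffun b => T ((p : {perm box la})^-1%g b)] | p in col_stab la].

Definition last_ord n r (le_n_r : (n <= r)%N) (i : 'I_n) : 'I_r :=
  rev_ord (widen_ord le_n_r (rev_ord i)).

Section UV.
Variables (k : fieldType) (r s m : nat) (la : seq nat).
Hypotheses (la_r : (part_size la <= r)%N) (la_s : (size la <= s)%N).

(* e_(i+1) and e_(s-i) in 1-based numbering. *)
Definition row_vec (i : 'I_(size la)) : 'cV[k]_s :=
  delta_mx (widen_ord la_s i) 0.
Definition row_vec_rev (i : 'I_(size la)) : 'cV[k]_s :=
  delta_mx (rev_ord (widen_ord la_s i)) 0.

(* The columns B b, b a box, of an r x t matrix, in row reading order. *)
Definition cols_of_boxes (B : box la -> 'cV[k]_r) : 'M[k]_(r, part_size la) :=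
  \mxrow_(i < size la)
    \matrix_(a < r, j < nth 0%N la i) B (existT _ i j) a 0.

Definition uT (T : tableau la m) : mats k r s m -> k^o := fun A =>
  \sum_(S in col_orbit T)
    \det (rowsub (last_ord la_r)
           (cols_of_boxes (fun b => A (S b) *m row_vec (tag b)))).

Definition vT (T : tableau la m) : mats k s r m -> k^o := fun A =>
  \sum_(S in col_orbit T)
    \det (rowsub (widen_ord la_r)
           (cols_of_boxes (fun b => (A (S b))^T *m row_vec_rev (tag b)))).

End UV.

Arguments uT k {r s m la} la_r la_s T A.
Arguments vT k {r s m la} la_r la_s T A.

Definition is_basis (k : fieldType) (V : lmodType k) (W : {pred V})
    (I : finType) (e : I -> V) : Prop :=
  [/\ forall i, e i \in W,
      forall c : I -> k, \sum_i c i *: e i = 0 -> forall i, c i = 0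
    & forall w, w \in W -> exists c : I -> k, w = \sum_i c i *: e i].

(* Main.v *)
Require Import Defs.
From HB Require Import structures.
From mathcomp Require Import all_boot all_order all_fingroup all_algebra.
From mathcomp Require Import boolp functions.
From mathcomp Require mpoly.
From mathcomp Require Import zify ring.
Import -(notations) mpoly.
Set Implicit Arguments.
Unset Strict Implicit.
Unset Printing Implicit Defensive.
Import GRing.Theory.
Local Open Scope ring_scope.

(** A function [f] of weight [-(1^t)^rev] for [T_r] is linear in each of the last
    [t] rows and independent of the others; invariance under [U_r] makes it
    alternating in these rows. It is thus determined by its values on tuples of
    basis vectors indexed by the boxes of [la], and the weight for [T_s] and the
    invariance under [U_s] yield Garnir relations, by which [f] is determined by
    its values at the row semi-standard tableaux. The matrix of the values of
    the [u_T] at these tableaux is unitriangular, so the [u_T] form a basis.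

    For the Weyl module, let [v] be the lowest weight vector among the [u_T].
    By multilinearity [g v] is the sum of the [u_T], over representatives of the
    column orbits, with distinct monomials in [g] as coefficients, so the
    functions [g |-> l (g v)] form a space of dimension the number of row
    semi-standard tableaux inside the costandard module whose dual is the Weyl
    module. Conversely, if [f] lies in the costandard module, then [f det^N] is
    for large [N] a polynomial [P] on matrices which does not change when a
    multiple of a column is added to an earlier one. As [P (x + y, y + z)] is
    [P (x + y, z - x)] in the columns concerned, its degree in [y] is bounded,
    which is a Garnir relation for the coefficients of [P]; they are determined
    by those at semi-standard exponents, and these are at most as many as the
    tableaux.

    The second statement follows from the first by [A |-> J A^T J] with the
    permutation matrices [J] reversing the order of the basis. *)

(** * Polynomial functions *)

(** Everything has to work in arbitrary characteristic: no division by factorials, no averaging over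
    a column group, and skew symmetry does not replace alternation. Hence alternation is derived
    from row additions, and coefficients are extracted by interpolation instead of differentiation.
    Since regular functions are plain functions, torus elements give identities only at nonzero
    scalars, and invertible matrices only on a dense set; that [k] is infinite extends them.

    The dimension of the costandard module is found without a character formula, from two
    inequalities: matrix coefficients of the lowest weight vector are independent, and good
    exponents inject into tableaux. Clearing the denominator by [det ^ N] raises every column degree
    by [N]; the count stays independent of [N] because every good exponent is at least [N] along the
    antidiagonal.

    Both Garnir arguments compare moments box by box or row by row. The weight fixes the content, so
    a constant multiple of a fixed sum may be subtracted from the moment first, and this makes every
    single contribution have the same sign. *)

Section InfiniteField.
Variable k : closedFieldType.

Lemma closed_field_uniq_seq n : exists s : seq k, uniq s /\ size s = n.
Proof.
elim: n => [|n [s [sU sS]]]; first by exists [::].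
(* A root of [q] avoids [s], where [q] takes the value 1; the factor ['X] makes [q] nonconstant even
   for empty [s]. *)
set q : {poly k} := 'X * \prod_(a <- s) ('X - a%:P) + 1.
have sq : (size q != 1)%N.
  have p0 : \prod_(a <- s) ('X - a%:P) != 0 by rewrite monic_neq0 ?monic_prod_XsubC.
  by rewrite /q mulrC size_polyDl size_mulX // ?size_poly1 size_prod_XsubC.
have [x /eqP qx] := closed_rootP q sq.
exists (x :: s); rewrite /= sU sS andbT; split=> //.
apply/negP => /(nthP 0)[i i_s xE]; move/eqP: qx.
rewrite /q hornerD hornerM hornerX hornerC horner_prod (big_nth 0) big_mkord.
rewrite (bigD1 (Ordinal i_s)) //= hornerXsubC xE subrr mul0r mulr0 add0r.
by rewrite oner_eq0.
Qed.

Lemma poly_fun_eq0 (p : {poly k}) : (forall x, p.[x] = 0) -> p = 0.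
Proof.
move=> p0; have [s [sU sS]] := closed_field_uniq_seq (size p).
apply: contraTeq isT => pn0.
have := max_poly_roots pn0 _ sU; rewrite sS ltnn; apply.
by apply/allP => x _; apply/eqP/p0.
Qed.

(** Invertibility conditions leave identities known only off the zeros of a nonzero polynomial,
    typically at nonzero scalars; this extends them to all arguments. *)
Lemma poly_fun_neq0_eq0 (p q : {poly k}) :
  q != 0 -> (forall x, q.[x] != 0 -> p.[x] = 0) -> p = 0.
Proof.
move=> q0 pq; have /eqP : p * q = 0.
  apply: poly_fun_eq0 => x; rewrite hornerM.
  by have [->|/pq->] := eqVneq q.[x] 0; rewrite ?mulr0 ?mul0r.
by rewrite mulf_eq0 (negPf q0) orbF => /eqP.
Qed.

Lemma expr_fun_inj (a b : nat) :
  (forall c : k, c != 0 -> c ^+ a = c ^+ b) -> a = b.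
Proof.
move=> ab; have : ('X^a - 'X^b : {poly k}) = 0.
  apply: (@poly_fun_neq0_eq0 _ 'X); first by rewrite polyX_eq0.
  by move=> x; rewrite !hornerE => /ab->; rewrite subrr.
move/subr0_eq/(congr1 (fun p : {poly k} => (size p).-1)).
by rewrite !size_polyXn.
Qed.

Lemma interpolation_weights D :
  exists (tau : 'I_D -> k) (W : nat -> 'I_D -> k),
    forall (q : {poly k}) n, (size q <= D)%N -> \sum_t W n t * q.[tau t] = q`_n.
Proof.
have [s [sU sS]] := closed_field_uniq_seq D.
pose tau (i : 'I_D) := s`_i.
pose V := Vandermonde D (\row_j tau j).
have VU : V \in unitmx.
  rewrite unitmxE det_Vandermonde unitfE; apply/prodf_neq0 => i _.
  apply/prodf_neq0 => j ij; rewrite !mxE subr_eq0 /tau nth_uniq ?sS //.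
  by rewrite neq_ltn ij orbT.
(* For [n >= D] the weights are zero, in agreement with the vanishing coefficient. *)
exists tau; exists (fun n t => if insub n is Some i then (invmx V) t i else 0).
move=> q n sq; case: insubP => [i _ iE|]; last first.
  rewrite -leqNgt => Dn; rewrite [RHS]nth_default ?(leq_trans sq) //.
  by rewrite big1 // => t _; rewrite mul0r.
have : (\row_j q`_j *m (V *m invmx V)) 0 i = q`_n.
  by rewrite mulmxV // mulmx1 mxE iE.
rewrite mulmxA mxE => <-; apply: eq_bigr => t _; rewrite mulrC; congr (_ * _).
rewrite mxE (horner_coef_wide _ sq); apply: eq_bigr => j _.
by rewrite !mxE.
Qed.

End InfiniteField.

Section RegularFunctions.
Variables (k : fieldType) (X : Type) (I : finType) (c : I -> X -> k^o).
Local Notation regular := (regular_fun c).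

Lemma regular_ext (f g : X -> k^o) : f =1 g -> f \in regular -> g \in regular.
Proof. by move=> /funext->. Qed.

Lemma regular_mul (f g : X -> k^o) :
  f \in regular -> g \in regular -> (fun x => f x * g x : k^o) \in regular.
Proof.
move=> /asboolP[p pE] /asboolP[q qE]; apply/asboolP.
by exists (p * q) => x; rewrite mevalM -pE -qE.
Qed.

Lemma regular_cst (a : k) : (fun=> a : k^o) \in regular.
Proof. by apply/asboolP; exists (mpolyC #|I| a) => x; rewrite mevalC. Qed.

Lemma regular_add (f g : X -> k^o) :
  f \in regular -> g \in regular -> (fun x => f x + g x : k^o) \in regular.
Proof.
move=> /asboolP[p pE] /asboolP[q qE]; apply/asboolP.
by exists (p + q) => x; rewrite mevalD -pE -qE.
Qed.

Lemma regular_bigprod (J : Type) (r : seq J) (P : pred J) (f : J -> X -> k^o) :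
  (forall j, P j -> f j \in regular) ->
  (fun x => \prod_(j <- r | P j) f j x : k^o) \in regular.
Proof.
move=> fR; elim: r => [|j r IH].
  by apply: (regular_ext _ (regular_cst 1)) => x; rewrite big_nil.
case Pj: (P j); last by apply: (regular_ext _ IH) => x; rewrite big_cons Pj.
apply: (regular_ext _ (regular_mul (fR j Pj) IH)) => x.
by rewrite big_cons Pj.
Qed.

Lemma regular_bigsum (J : Type) (r : seq J) (P : pred J) (f : J -> X -> k^o) :
  (forall j, P j -> f j \in regular) ->
  (fun x => \sum_(j <- r | P j) f j x : k^o) \in regular.
Proof.
move=> fR; elim: r => [|j r IH].
  by apply: (regular_ext _ (regular_cst 0)) => x; rewrite big_nil.
case Pj: (P j); last by apply: (regular_ext _ IH) => x; rewrite big_cons Pj.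
apply: (regular_ext _ (regular_add (fR j Pj) IH)) => x.
by rewrite big_cons Pj.
Qed.

Lemma regular_exp (f : X -> k^o) n :
  f \in regular -> (fun x => f x ^+ n : k^o) \in regular.
Proof.
move=> fR; have fnR := @regular_bigprod _ (iota 0 n) xpredT (fun=> f) (fun _ _ => fR).
apply: (regular_ext _ fnR) => x.
by rewrite big_const_seq count_predT size_iota -Monoid.iteropE.
Qed.

Lemma regular_det n (M : X -> 'M[k]_n) :
  (forall i j, (fun x => M x i j : k^o) \in regular) ->
  (fun x => \det (M x) : k^o) \in regular.
Proof.
move=> MR; apply: regular_bigsum => p _; apply: regular_mul.
  exact: regular_cst.
by apply: regular_bigprod => i _.
Qed.

(** Exponents range over functions into ['I_D], so that the coefficients of several functions can
    share one finite index type. *)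
Definition monomial_form D (f : X -> k) (C : {ffun I -> 'I_D} -> k) :=
  forall x, f x = \sum_alpha C alpha * \prod_i c i x ^+ alpha i.

(** Every larger bound also works, which gives finitely many functions a common one. *)
Lemma regular_monomial_form (f : X -> k^o) : f \in regular ->
  exists D, forall D', (D <= D')%N -> exists C, @monomial_form D' f C.
Proof.
case/asboolP=> p pE; exists (msize p).+1; case=> // D' DD'.
pose red (a : multinom #|I|) : {ffun I -> 'I_D'.+1} :=
  [ffun i => inord (a (enum_rank i))].
exists (fun alpha => \sum_(a <- msupp p | red a == alpha) mcoeff a p) => x.
rewrite pE mevalE (partition_big red xpredT) //=; apply: eq_bigr => alpha _.
rewrite mulr_suml big_seq_cond [RHS]big_seq_cond; apply: eq_bigr => a.
case/andP=> a_p /eqP <-; congr (_ * _); rewrite (reindex _ (onW_bij _ (@enum_rank_bij I))) /=.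
apply: eq_bigr => i _; rewrite enum_rankK ffunE inordK // (leq_trans _ DD') //.
have := msize_mdeg_lt a_p; rewrite ltnS => /ltnW; apply: leq_trans.
by rewrite mdegE (bigD1 (enum_rank i)) //= leq_addr.
Qed.

End RegularFunctions.

Lemma regular_pull (k : fieldType) (X Y : Type) (I J : finType)
    (c : I -> X -> k^o) (d : J -> Y -> k^o) (h : Y -> X) (f : X -> k^o) :
    (forall i, (fun y => c i (h y)) \in regular_fun d) ->
  f \in regular_fun c -> (fun y => f (h y)) \in regular_fun d.
Proof.
move=> hR fR; have [D /(_ D (leqnn D))[C fC]] := regular_monomial_form fR.
apply: (regular_ext (fun y => esym (fC (h y)))).
apply: regular_bigsum => alpha _; apply: regular_mul; first exact: regular_cst.
by apply: regular_bigprod => i _; apply: regular_exp.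
Qed.

Lemma regular_line (k : fieldType) (X : Type) (I : finType) (c : I -> X -> k^o)
    (h : k -> X) (q : I -> {poly k}) (f : X -> k^o) :
    (forall i x, c i (h x) = (q i).[x]) -> f \in regular_fun c ->
  exists p : {poly k}, forall x, f (h x) = p.[x].
Proof.
move=> hq fR; have [D /(_ D (leqnn D))[C fC]] := regular_monomial_form fR.
exists (\sum_alpha C alpha *: \prod_i q i ^+ alpha i) => x.
rewrite fC horner_sum; apply: eq_bigr => alpha _.
rewrite hornerZ horner_prod; congr (_ * _); apply: eq_bigr => i _.
by rewrite horner_exp hq.
Qed.

Section Homogeneous.
Variables (k : closedFieldType) (J : finType).
Local Notation coord := (fun (j : J) (v : J -> k) => v j : k^o).

(** Compare coefficients of [c] in the polynomial [f (c v)]: only monomials of total degree one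
    survive. *)
Lemma regular_homog1 (f : (J -> k) -> k^o) : f \in regular_fun coord ->
  (forall v c, c != 0 -> f (fun j => c * v j) = c * f v) ->
  forall v, f v = \sum_j v j * f (fun i => (i == j)%:R).
Proof.
move=> fR f_c; have [D /(_ D (leqnn D))[C fC]] := regular_monomial_form fR.
pose deg (alpha : {ffun J -> 'I_D}) := (\sum_i alpha i)%N.
(* In total degree one, [(alpha j)%:R] is the indicator of the monomial [v j]. *)
pose K j := \sum_(alpha | deg alpha == 1%N) C alpha * (alpha j)%:R.
have fK v : f v = \sum_j v j * K j.
  pose p : {poly k} :=
    \sum_alpha (C alpha * \prod_i v i ^+ alpha i) *: 'X^(deg alpha).
  have pE c : f (fun j => c * v j) = p.[c].
    rewrite fC horner_sum; apply: eq_bigr => alpha _.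
    rewrite hornerZ hornerXn -mulrA; congr (_ * _).
    under eq_bigr do rewrite exprMn.
    by rewrite big_split /= prodrXr mulrC.
  have : p - f v *: 'X = 0.
    apply: (@poly_fun_neq0_eq0 _ _ 'X); first by rewrite polyX_eq0.
    by move=> c; rewrite !hornerE -pE => /f_c->; rewrite [f v * c]mulrC subrr.
  move/subr0_eq/(congr1 (fun q : {poly k} => q`_1)).
  rewrite coefZ coefX mulr1 => <-; rewrite coef_sum.
  under eq_bigr do rewrite coefZ coefXn.
  under [RHS]eq_bigr do rewrite mulr_sumr.
  rewrite exchange_big /= [RHS]big_mkcond; apply: eq_bigr => alpha _.
  rewrite eq_sym /=; case: eqP => [d1|_]; last by rewrite mulr0.
  rewrite mulr1 (_ : \sum_j v j * _ = C alpha * \sum_j v j * (alpha j)%:R); last first.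
    by rewrite mulr_sumr; apply: eq_bigr => j _; rewrite mulrCA.
  congr (_ * _).
  have [j0 aj0] : exists j0, alpha j0 != 0%N :> nat.
    apply/existsP; apply: contraPT d1; rewrite negb_exists => /forallP a0.
    by rewrite /deg big1 // => i _; apply/eqP; rewrite -[_ == _]negbK.
  have [aj01 a0] : alpha j0 = 1%N :> nat /\ forall j, j != j0 -> alpha j = 0%N :> nat.
    have := d1; rewrite /deg (bigD1 j0) //= => d1'.
    have S0 : (\sum_(i | i != j0) alpha i = 0)%N by lia.
    split; first by lia.
    move=> j jj0; move: S0; rewrite (bigD1 j) //= => S0; lia.
  rewrite (bigD1 j0) //= big1 => [|j /a0->]; last by rewrite expr0.
  rewrite (bigD1 j0) //= big1 => [|j /a0->]; last by rewrite mulr0.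
  by rewrite aj01 expr1 !mulr1 addr0.
move=> v; rewrite fK; apply: eq_bigr => j _; rewrite fK (bigD1 j) //= eqxx.
by rewrite mul1r big1 ?addr0 // => i /negPf->; rewrite mul0r.
Qed.

End Homogeneous.

Section CoefficientFunctional.
Variables (k : closedFieldType) (I : finType) (D : nat).
Variables (tau : 'I_D -> k) (W : nat -> 'I_D -> k).
Hypothesis tauW :
  forall (q : {poly k}) n, (size q <= D)%N -> \sum_t W n t * q.[tau t] = q`_n.

(* Extracts the coefficient of [x ^ beta] by evaluation at points only, so that it
   applies to functions which are not given in expanded form. *)
Definition coef_functional (beta : I -> nat) (f : (I -> k) -> k) : k :=
  \sum_(theta : {ffun I -> 'I_D})
    (\prod_i W (beta i) (theta i)) * f (fun i => tau (theta i)).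

Lemma coef_functional_monomial (beta alpha : I -> nat) :
  (forall i, alpha i < D)%N ->
  coef_functional beta (fun x => \prod_i x i ^+ alpha i) =
    [forall i, alpha i == beta i]%:R.
Proof.
move=> aD; rewrite /coef_functional.
under eq_bigr do rewrite -big_split /=.
rewrite -(bigA_distr_bigA (fun i t => W (beta i) t * tau t ^+ alpha i)) /=.
have E i : \sum_t W (beta i) t * tau t ^+ alpha i = (alpha i == beta i)%:R.
  under eq_bigr do rewrite -hornerXn.
  by rewrite tauW ?size_polyXn // coefXn eq_sym.
under eq_bigr do rewrite E.
case: forallP => [e|/forallP]; first by rewrite big1 // => i _; rewrite e.
by rewrite negb_forall => /existsP[i /negPf ne]; rewrite (bigD1 i) //= ne mul0r.
Qed.
End CoefficientFunctional.

Lemma fiber_card_perm (B : finType) (Y : eqType) (h h' : B -> Y) :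
    (forall y, #|[pred b | h b == y]| = #|[pred b | h' b == y]|) ->
  exists p : {perm B}, forall b, h' b = h (p b).
Proof.
move=> hh'; have countE (f : B -> Y) y : count_mem y (codom f) = #|[pred b | f b == y]|.
  by rewrite count_map enumT -size_filter cardE.
have : perm_eq (codom_tuple h') (codom_tuple h).
  by apply/allP => y _ /=; apply/eqP; rewrite !countE hh'.
case/tuple_permP=> p pE.
have enum_p_inj : injective (fun b => enum_val (p (enum_rank b))).
  by move=> b c /enum_val_inj/perm_inj/enum_rank_inj.
exists (perm enum_p_inj) => b; rewrite permE.
have := congr1 (fun s : seq Y => nth (h' b) s (enum_rank b)) pE.
by rewrite nth_codom enum_rankK -tnth_nth tnth_mktuple (tnth_nth (h' b)) nth_codom.
Qed.

(** * Multilinear forms and linear systems over finite index types *)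

Section Multilinear.
Variables (R : comNzRingType) (B J : finType).
Implicit Types (V : B -> J -> R) (psi : (B -> J -> R) -> R).

Definition upd V b v : B -> J -> R := fun b' => if b' == b then v else V b'.
Definition basis_vec j : J -> R := fun i => (i == j)%:R.

(** Linearity is expressed as expansion over the basis vectors, the form in which [regular_homog1]
    delivers it. *)
Definition multilinear psi :=
  forall V b, psi V = \sum_j V b j * psi (upd V b (basis_vec j)).

Lemma upd_id V b v : upd V b v b = v.
Proof. by rewrite /upd eqxx. Qed.

Lemma upd_upd V b v v' : upd (upd V b v) b v' = upd V b v'.
Proof. by apply/funext => b'; rewrite /upd; case: eqP. Qed.

Lemma upd_same V b : upd V b (V b) = V.
Proof. by apply/funext => b'; rewrite /upd; case: eqP => // ->. Qed.

(** Induction on the number of arguments that are not basis vectors: expanding one of them lowers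
    this number. *)
Lemma multilinear_vanish psi : multilinear psi ->
    (forall w : {ffun B -> J}, psi (fun b => basis_vec (w b)) = 0) ->
  forall V, psi V = 0.
Proof.
move=> psiM psi0; pose bad V := [pred b | ~~ [exists j, `[< V b = basis_vec j >]]].
suff H n : forall V, (#|bad V| <= n)%N -> psi V = 0 by move=> V; apply: (H _ V).
elim: n => [|n IH] V badV.
  have /choice[w wE] : forall b, exists j, V b = basis_vec j.
    move=> b; move: badV; rewrite leqn0 => /eqP/card0_eq/(_ b).
    by rewrite inE => /negbFE/existsP[j /asboolP]; exists j.
  rewrite -[RHS](psi0 (finfun w)); congr psi; apply/funext => b.
  by rewrite ffunE.
have [b b_bad|bad0] := pickP (bad V); last first.
  by apply: IH; rewrite (eq_card0 bad0).
rewrite (psiM V b) big1 // => j _; rewrite IH ?mulr0 // -ltnS.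
apply: leq_trans badV; apply: proper_card; apply/properP; split.
  apply/subsetP => b'; rewrite !inE /upd; case: eqP => // ->.
  by move=> /existsP[]; exists j; apply/asboolP.
exists b => //; rewrite !inE upd_id negbK; apply/existsP; exists j.
exact/asboolP.
Qed.

Lemma multilinear_expand psi V : multilinear psi ->
  psi V = \sum_(w : {ffun B -> J})
            (\prod_b V b (w b)) * psi (fun b => basis_vec (w b)).
Proof.
move=> psiM; apply/subr0_eq; move: V; apply: multilinear_vanish.
  move=> V b; under [RHS]eq_bigr do rewrite mulrBr.
  rewrite sumrB -psiM; congr (_ - _); under [RHS]eq_bigr do rewrite mulr_sumr.
  rewrite exchange_big /=; apply: eq_bigr => w _.
  rewrite (bigD1 (w b)) //= [X in _ = _ + X]big1 => [|j jw]; last first.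
    by rewrite (bigD1 b) //= upd_id /basis_vec eq_sym (negPf jw) !mul0r mulr0.
  rewrite addr0 mulrA; congr (_ * _); rewrite [LHS](bigD1 b) //= [in RHS](bigD1 b) //=.
  rewrite upd_id /basis_vec eqxx mul1r; congr (_ * _); apply: eq_bigr => b' b'b.
  by rewrite /upd (negPf b'b).
move=> w; apply/eqP; rewrite subr_eq0 (bigD1 w) //= [X in X * _]big1; last first.
  by move=> b _; rewrite /basis_vec eqxx.
rewrite mul1r big1 ?addr0 // => w' w'w.
have [b wb] : exists b, w' b != w b.
  apply/existsP; apply: contraNT w'w; rewrite negb_exists => /forallP ww.
  by apply/eqP/ffunP => b; apply/eqP; rewrite -[_ == _]negbK.
by rewrite (bigD1 b) //= /basis_vec (negPf wb) !mul0r.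
Qed.

End Multilinear.

Lemma linear_dependence (k : fieldType) (I J : finType) (a : I -> J -> k) :
    (#|J| < #|I|)%N ->
  exists c : I -> k, (exists i, c i != 0) /\ forall j, \sum_i c i * a i j = 0.
Proof.
move=> JI; pose A := \matrix_(i < #|I|, j < #|J|) a (enum_val i) (enum_val j).
have : kermx A != 0.
  rewrite -mxrank_eq0 mxrank_ker -lt0n subn_gt0.
  exact: leq_ltn_trans (rank_leq_col A) JI.
case/rowV0Pn=> v /sub_kermxP vA v0; exists (fun i => v 0 (enum_rank i)); split.
  have [i vi] : exists i, v 0 i != 0.
    apply/existsP; apply: contraNT v0; rewrite negb_exists => /forallP v0.
    by apply/eqP/rowP => i; apply/eqP; rewrite mxE -[_ == _]negbK.
  by exists (enum_val i); rewrite enum_valK.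
move=> j; have := congr1 (fun u : 'rV_#|J| => u 0 (enum_rank j)) vA.
rewrite [X in X = _]mxE [X in _ = X]mxE => vA0.
rewrite -[RHS]vA0 [RHS](reindex _ (onW_bij _ (@enum_rank_bij I))).
by apply: eq_bigr => i _; rewrite mxE !enum_rankK.
Qed.

(** Adjoining [d] as one more row forces a linear dependence, and injectivity makes its coefficient
    at [d] nonzero. *)
Lemma square_system (k : fieldType) (I : finType) (a : I -> I -> k) (d : I -> k) :
    (forall c, (forall j, \sum_i c i * a i j = 0) -> forall i, c i = 0) ->
  exists c, forall j, \sum_i c i * a i j = d j.
Proof.
move=> a_inj.
have [|c [[i0 ci0] cE]] :=
  @linear_dependence k (option I) I (fun i => if i is Some i then a i else d).
  by rewrite card_option.
have {}cE j : c None * d j + \sum_i c (Some i) * a i j = 0.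
  rewrite -[RHS](cE j) [RHS](bigD1 None) //=; congr (_ + _).
  rewrite [RHS](reindex_omap Some id) /=; last by case.
  by apply: eq_bigl => i; rewrite eqxx.
have cN : c None != 0.
  apply: contraNneq ci0 => c0.
  have c_0 : forall i, c (Some i) = 0.
    by apply: a_inj => j; rewrite -[RHS](cE j) c0 mul0r add0r.
  by case: i0 => [i|]; rewrite ?c0 ?c_0.
exists (fun i => - (c None)^-1 * c (Some i)) => j.
under eq_bigr do rewrite -mulrA.
rewrite -mulr_sumr; have /eqP := cE j; rewrite addrC addr_eq0 => /eqP->.
by rewrite mulrN mulNr opprK mulrA mulVf ?mul1r.
Qed.

(** * Highest weight functions as alternating forms *)

Lemma GL_mx_unitmx (k : fieldType) n (g : GL k n) : GL_mx g \in unitmx.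
Proof. exact: Defs.GL_unit. Qed.

Section HighestWeightFunctions.
Variables (k : fieldType) (r s m : nat).
Implicit Types (A : mats k r s m) (f : mats k r s m -> k^o).

Definition lrmul (P : 'M[k]_r) (Q : 'M[k]_s) A : mats k r s m :=
  [ffun i => P *m A i *m Q].

Lemma lrmulM P P' Q Q' A : lrmul P Q (lrmul P' Q' A) = lrmul (P *m P') (Q' *m Q) A.
Proof. by apply/ffunP => i; rewrite !ffunE !mulmxA. Qed.

Lemma fun_act_rsE R S f A :
  fun_act_rs R S f A = f (lrmul (invmx (GL_mx R)) (GL_mx S) A).
Proof.
rewrite /fun_act_rs; congr f; apply/ffunP => i; rewrite !ffunE.
by rewrite invgK.
Qed.

Lemma lrmulK (R : GL k r) (S : 'M_s) A :
  lrmul (invmx (GL_mx R)) 1%:M (lrmul (GL_mx R) S A) = lrmul 1%:M S A.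
Proof. by rewrite lrmulM mulVmx ?GL_mx_unitmx // mulmx1. Qed.

Lemma diag_torus_neq0 n (D : GL k n) i : D \in @diag_torus k n -> GL_mx D i i != 0.
Proof.
case/diag_mxP=> d DE; have := GL_mx_unitmx D.
rewrite DE unitmxE det_diag unitfE => /prodf_neq0/(_ i isT).
by rewrite mxE eqxx mulr1n.
Qed.

Lemma weight_char_neq0 n (chi : 'I_n -> int) D : D \in @diag_torus k n ->
  weight_char chi D != 0.
Proof.
by move=> DT; apply/prodf_neq0 => i _; apply/expfz_neq0/diag_torus_neq0.
Qed.

(** The action inverts only the left factor. Removing this inverse, by treating one group at a time,
    turns the weight condition into a scaling rule in which only [chi] is inverted. *)
Lemma hwvP chi psi f :
  reflect [/\ f \in regular_fun (@mats_coord k r s m),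
    forall R S, R \in @upper_unitri k r -> S \in @upper_unitri k s ->
      forall A, f (lrmul (GL_mx R) (GL_mx S) A) = f A
  & forall D E, D \in @diag_torus k r -> E \in @diag_torus k s ->
      forall A, f (lrmul (GL_mx D) (GL_mx E) A) =
        (weight_char chi D)^-1 * weight_char psi E * f A]
  (f \in hwv k m chi psi).
Proof.
have U1 n : (1%g : GL k n) \in @upper_unitri k n.
  apply/andP; split; first by rewrite trmx1; apply: scalar_mx_is_trig.
  by apply/forallP => i; rewrite mxE eqxx.
have T1 n : (1%g : GL k n) \in @diag_torus k n by apply: scalar_mx_is_diag.
have W1 n chi' : weight_char chi' (1%g : GL k n) = 1.
  by apply: big1 => i _; rewrite mxE eqxx exp1rz.
apply: (iffP (asboolP _)) => -[fR fU fT]; split=> //.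
- move=> R S RU SU A.
  have /(congr1 (@^~ (lrmul (GL_mx R) (GL_mx S) A))) := fU R 1%g RU (U1 s).
  rewrite /= fun_act_rsE lrmulK => <-.
  by have /(congr1 (@^~ A)) := fU 1%g S (U1 r) SU; rewrite /= fun_act_rsE invmx1.
- move=> D E DT ET A.
  have /(congr1 (@^~ (lrmul (GL_mx D) (GL_mx E) A))) := fT D 1%g DT (T1 s).
  rewrite /= fun_act_rsE lrmulK W1 mulr1.
  have /(congr1 (@^~ A)) := fT 1%g E (T1 r) ET.
  rewrite /= fun_act_rsE invmx1 W1 mul1r => -> fE.
  apply: (mulfI (weight_char_neq0 chi DT)).
  rewrite -[LHS]fE -mulrA mulVKf ?weight_char_neq0 //.
- move=> R S RU SU; apply/funext => A; rewrite fun_act_rsE.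
  by rewrite -(fU R 1%g RU (U1 s)) lrmulM mulmxV ?GL_mx_unitmx // mulmx1 -[RHS](fU 1%g S).
- move=> D E DT ET; apply/funext => A; rewrite fun_act_rsE.
  have := fT D 1%g DT (T1 s) (lrmul (invmx (GL_mx D)) (GL_mx E) A).
  rewrite lrmulM mulmxV ?GL_mx_unitmx // mulmx1 W1 mulr1 => fE.
  have := fT 1%g E (T1 r) ET A; rewrite W1 invr1 mul1r => fE'.
  apply: (mulfI (invr_neq0 (weight_char_neq0 chi DT))).
  rewrite -[LHS]fE [LHS]fE'.
rewrite -[(_ *: f) A]/((weight_char chi D * weight_char psi E) * f A).
by rewrite -mulrA mulKf ?weight_char_neq0.
Qed.
End HighestWeightFunctions.

Lemma diag_GL_unit (k : fieldType) n (d : 'I_n -> k) : (forall i, d i != 0) ->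
  diag_mx (\row_i d i) \in unitmx.
Proof.
move=> d0; rewrite unitmxE det_diag unitfE; apply/prodf_neq0 => i _.
by rewrite mxE.
Qed.

Lemma transvection_unit (k : fieldType) n (x y : 'I_n) (c : k) : (x < y)%N ->
  exists2 g : GL k n, g \in @upper_unitri k n & GL_mx g = 1%:M + c *: delta_mx x y.
Proof.
move=> xy; pose M : 'M[k]_n := 1%:M + c *: delta_mx x y.
have Mtrig : is_trig_mx M^T.
  apply/is_trig_mxP => i j ij; have /negPf ji : j != i by rewrite -val_eqE gtn_eqF.
  rewrite !mxE ji add0r; case: eqP => [xj|]; rewrite ?mulr0 //; case: eqP => [iy|]; rewrite ?mulr0 //.
  by move: xy ij; rewrite -xj -iy => /ltnW; rewrite ltnNge => ->.
have Mdiag i : M i i = 1.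
  rewrite !mxE eqxx; case: eqP => [->|]; rewrite ?mulr0 ?addr0 //.
  by rewrite -val_eqE /= ltn_eqF // mulr0 addr0.
have MU : M \in unitmx.
  by rewrite unitmxE -det_tr det_trig // unitfE; apply/prodf_neq0 => i _;
    rewrite mxE Mdiag oner_neq0.
exists (GLof MU) => //; rewrite unfold_in /= Mtrig.
by apply/forallP => i; rewrite Mdiag.
Qed.

Lemma last_ord_val r n (n_r : (n <= r)%N) (i : 'I_n) : last_ord n_r i = (r - n + i)%N :> nat.
Proof. by have := ltn_ord i; rewrite /=; lia. Qed.

Lemma last_ord_inj r n (n_r : (n <= r)%N) : injective (last_ord n_r).
Proof.
by move=> i j /(congr1 (@nat_of_ord r))/eqP; rewrite !last_ord_val eqn_add2l => /eqP/val_inj.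
Qed.

Section Boxes.
Variables (r : nat) (la : seq nat).
Hypothesis (la_r : (part_size la <= r)%N).

Definition box_rank (b : box la) : 'I_(part_size la) := tagnat.rank b.
Definition box_unrank (a : 'I_(part_size la)) : box la := tagnat.sig a.
Definition mat_row (b : box la) : 'I_r := last_ord la_r (box_rank b).

Lemma box_rankK : cancel box_rank box_unrank.
Proof. exact: tagnat.rankK. Qed.

Lemma box_unrankK : cancel box_unrank box_rank.
Proof. exact: tagnat.sigK. Qed.

Lemma mat_row_inj : injective mat_row.
Proof. by move=> b c /last_ord_inj/(can_inj box_rankK). Qed.

Lemma mat_rowP (x : 'I_r) : reflect (exists b, mat_row b = x) (rev_ord x < part_size la)%N.
Proof.
apply: (iffP idP) => [xt|[b <-]]; last first.
  by have := ltn_ord (box_rank b); have := last_ord_val la_r (box_rank b);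
    rewrite /=; lia.
have lt : (x - (r - part_size la) < part_size la)%N.
  by have := ltn_ord x; move: xt => /=; lia.
exists (box_unrank (Ordinal lt)); apply: ord_inj.
rewrite last_ord_val box_unrankK /=.
by move: xt => /=; lia.
Qed.

End Boxes.

Section RowForms.
Variables (k : closedFieldType) (r s m : nat) (la : seq nat).
Hypotheses (la_r : (part_size la <= r)%N) (la_s : (size la <= s)%N).
Local Notation t := (part_size la).
Local Notation J := ('I_s * 'I_m)%type.
Local Notation chi1 := (neg_rev (part_weight r (nseq t 1%N))).
Local Notation psi1 := (part_weight s la).
Local Notation row_of := (mat_row la_r).

(* The last [t] rows are indexed by the boxes of [la], and the entry of row [b] in
   column [j] of the [i]-th matrix is [V b (j, i)]. *)
Definition rows_mats (V : box la -> J -> k) : mats k r s m :=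
  [ffun i => \matrix_(x, j) \sum_(b | row_of b == x) V b (j, i)].

Lemma rows_mats_row V i b j : rows_mats V i (row_of b) j = V b (j, i).
Proof.
rewrite ffunE mxE (bigD1 b) //= big1 ?addr0 // => c /andP[/eqP/mat_row_inj->].
by rewrite eqxx.
Qed.

Lemma rows_mats_out V i x j : ~~ (rev_ord x < t)%N -> rows_mats V i x j = 0.
Proof.
move=> /mat_rowP out; rewrite ffunE mxE big_pred0 // => b.
by apply/eqP => bx; apply: out; exists b.
Qed.

Lemma eq_mats (A A' : mats k r s m) :
  (forall i x j, A i x j = A' i x j) -> A = A'.
Proof. by move=> AA'; apply/ffunP => i; apply/matrixP => x j. Qed.

Lemma weight_char_neg_rev (D : GL k r) :
  (weight_char chi1 D)^-1 = \prod_x GL_mx D x x ^+ (rev_ord x < t)%N.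
Proof.
rewrite /weight_char -prodfV; apply: eq_bigr => x _.
rewrite /neg_rev /part_weight nth_nseq; case: ifP => _; rewrite ?oppr0 ?invr1 //.
by rewrite -exprnN invrK.
Qed.

Variable f : mats k r s m -> k^o.
Hypothesis f_hwv : f \in hwv k m chi1 psi1.

Lemma hwv_scale_rows (d : 'I_r -> k) (A : mats k r s m) : (forall x, d x != 0) ->
  f [ffun i => \matrix_(x, j) (d x * A i x j)] =
  (\prod_x d x ^+ (rev_ord x < t)%N) * f A.
Proof.
move=> d0; have [_ _ fT] := hwvP _ _ _ f_hwv.
have DT : GLof (diag_GL_unit d0) \in @diag_torus k r by apply: diag_mx_is_diag.
have T1 : (1%g : GL k s) \in @diag_torus k s by apply: scalar_mx_is_diag.
have := fT _ _ DT T1 A; rewrite weight_char_neg_rev [weight_char _ 1%g]big1.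
  rewrite mulr1 => fE; have <- : f (lrmul (diag_mx (\row_i d i)) 1%:M A) =
      (\prod_x d x ^+ (rev_ord x < t)%N) * f A.
    rewrite [LHS]fE; congr (_ * _); apply: eq_bigr => x _.
    by rewrite /= !mxE eqxx mulr1n.
  congr f; apply/ffunP => i; rewrite !ffunE mulmx1.
  by apply/matrixP => x j; rewrite mul_diag_mx !mxE.
by move=> i _; rewrite mxE eqxx exp1rz.
Qed.

Lemma hwv_scale_cols (e : 'I_s -> k) (A : mats k r s m) : (forall x, e x != 0) ->
  f [ffun i => \matrix_(x, j) (A i x j * e j)] =
  (\prod_j e j ^+ nth 0%N la j) * f A.
Proof.
move=> e0; have [_ _ fT] := hwvP _ _ _ f_hwv.
have ET : GLof (diag_GL_unit e0) \in @diag_torus k s by apply: diag_mx_is_diag.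
have T1 : (1%g : GL k r) \in @diag_torus k r by apply: scalar_mx_is_diag.
have := fT _ _ T1 ET A; rewrite [weight_char _ 1%g]big1.
  rewrite invr1 mul1r => fE; have <- : f (lrmul 1%:M (diag_mx (\row_i e i)) A) =
      (\prod_j e j ^+ nth 0%N la j) * f A.
    rewrite [LHS]fE; congr (_ * _); apply: eq_bigr => x _.
    by rewrite /= !mxE eqxx mulr1n.
  congr f; apply/ffunP => i; rewrite !ffunE mul1mx.
  by apply/matrixP => x j; rewrite mul_mx_diag !mxE.
by move=> i _; rewrite mxE eqxx exp1rz.
Qed.

Lemma hwv_add_row (x y : 'I_r) (A : mats k r s m) : (x < y)%N ->
  f [ffun i => \matrix_(x', j) (A i x' j + (x' == x)%:R * A i y j)] = f A.
Proof.
move=> xy; have [_ fU _] := hwvP _ _ _ f_hwv.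
have [g gU gE] := transvection_unit (1 : k) xy.
have U1 : (1%g : GL k s) \in @upper_unitri k s.
  apply/andP; split; first by rewrite trmx1; apply: scalar_mx_is_trig.
  by apply/forallP => i; rewrite mxE eqxx.
rewrite -[RHS](fU _ _ gU U1); congr f; apply/ffunP => i; rewrite !ffunE mulmx1 gE.
apply/matrixP => x' j; rewrite mulmxDl mul1mx scale1r !mxE; congr (_ + _).
rewrite (bigD1 y) //= mxE eqxx andbT big1 ?addr0 // => z /negPf zy.
by rewrite mxE zy andbF mul0r.
Qed.

Lemma hwv_sub_col (p q : 'I_s) (A : mats k r s m) : (p < q)%N ->
  f [ffun i => \matrix_(x, j) (A i x j - (j == q)%:R * A i x p)] = f A.
Proof.
move=> pq; have [_ fU _] := hwvP _ _ _ f_hwv.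
have [g gU gE] := transvection_unit (-1 : k) pq.
have U1 : (1%g : GL k r) \in @upper_unitri k r.
  apply/andP; split; first by rewrite trmx1; apply: scalar_mx_is_trig.
  by apply/forallP => i; rewrite mxE eqxx.
rewrite -[RHS](fU _ _ U1 gU); congr f; apply/ffunP => i; rewrite !ffunE mul1mx gE.
apply/matrixP => x j; rewrite mulmxDr mulmx1 !mxE; congr (_ + _).
rewrite (bigD1 p) //= !mxE eqxx big1 ?addr0 => [|z /negPf zp].
  by rewrite mulrCA mulN1r mulrC.
by rewrite !mxE zp mulr0 mulr0.
Qed.

(** Scaling the rows above the last [t] by [c] does not change [f] for nonzero [c]. The value is a
    polynomial in [c], hence constant, and [c = 0] clears these rows. *)
Lemma hwv_rows (A : mats k r s m) : f A = f (rows_mats (fun b ji => A ji.2 (row_of b) ji.1)).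
Proof.
have [fR _ _] := hwvP _ _ _ f_hwv.
pose Ac (c : k) : mats k r s m :=
  [ffun i => \matrix_(x, j) ((if (rev_ord x < t)%N then 1 else c) * A i x j)].
have [p pE] : exists p : {poly k}, forall c, f (Ac c) = p.[c].
  apply: (regular_line (q := fun ixj : 'I_m * 'I_r * 'I_s =>
    (if (rev_ord ixj.1.2 < t)%N then 1 else 'X) * (A ixj.1.1 ixj.1.2 ixj.2)%:P)) fR.
  move=> [[i x] j] c; rewrite /mats_coord ffunE mxE /= hornerM hornerC.
  by case: (_ < _)%N; rewrite ?hornerX ?hornerC.
have pC : p = (f A)%:P.
  apply/subr0_eq/(@poly_fun_neq0_eq0 _ _ 'X); first by rewrite polyX_eq0.
  move=> c; rewrite !hornerE -pE => c0; rewrite hwv_scale_rows => [|x].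
    rewrite big1 ?mul1r ?subrr // => x _.
    by case: ifP => _; rewrite ?expr1n ?expr0.
  by case: ifP; rewrite ?oner_neq0.
have -> : f A = f (Ac 0) by rewrite pE pC hornerC.
congr f; apply: eq_mats => i x j; rewrite ffunE mxE.
case: ifP => [/mat_rowP[b <-]|/negbT out]; last by rewrite rows_mats_out // mul0r.
by rewrite mul1r rows_mats_row.
Qed.

Definition box_form (V : box la -> J -> k) : k := f (rows_mats V).

(** The weight makes [f] homogeneous of degree one in each of the last [t] rows, and a homogeneous
    polynomial function of degree one is linear. *)
Lemma box_form_multilinear : multilinear box_form.
Proof.
have [fR _ _] := hwvP _ _ _ f_hwv.
move=> V b; have homog := @regular_homog1 k J (fun v => box_form (upd V b v)).
rewrite -{1}(upd_same V b); apply: (homog _ _ (V b)) => {homog}.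
  apply: regular_pull fR => -[[i x] j]; rewrite /mats_coord /=.
  have [/eqP bx|bx] := boolP (row_of b == x).
    apply: (regular_ext _ (regular_coord _ (j, i))) => v.
    by rewrite -bx rows_mats_row upd_id.
  apply: (regular_ext _ (regular_cst _ (rows_mats V i x j))) => v.
  rewrite !ffunE !mxE; apply: eq_bigr => c /eqP cx.
  by rewrite /upd; case: eqP => // cb; rewrite -cx cb eqxx in bx.
move=> v c c0; pose d x := if x == row_of b then c else 1.
have d0 x : d x != 0 by rewrite /d; case: ifP; rewrite ?oner_neq0.
have -> : box_form (upd V b (fun j => c * v j)) =
    f [ffun i => \matrix_(x, j) (d x * rows_mats (upd V b v) i x j)].
  congr f; apply: eq_mats => i x j; rewrite [in RHS]ffunE mxE.
  have [/mat_rowP[b' <-]|out] := boolP (rev_ord x < t)%N; last first.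
    by rewrite !rows_mats_out ?mulr0.
  rewrite !rows_mats_row /d /upd (inj_eq (@mat_row_inj _ _ _)).
  by case: eqP; rewrite ?mul1r.
rewrite hwv_scale_rows // (bigD1 (row_of b)) //= big1 => [|x xb].
  rewrite /d eqxx mulr1; congr (_ * _); apply/eqP.
  have -> : (r - (row_of b).+1 < t)%N by apply/mat_rowP; exists b.
  by rewrite expr1.
by rewrite /d (negPf xb) expr1n.
Qed.

Definition box_coef (w : box la -> J) : k := box_form (fun b => basis_vec k (w b)).

Lemma box_form_expand V :
  box_form V = \sum_(w : {ffun box la -> J}) (\prod_b V b (w b)) * box_coef w.
Proof. exact: multilinear_expand box_form_multilinear. Qed.

Lemma hwv_expand (A : mats k r s m) : f A =
  \sum_(w : {ffun box la -> J})
    (\prod_b A (w b).2 (row_of b) (w b).1) * box_coef w.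
Proof. rewrite hwv_rows.
exact: (box_form_expand (fun b ji => A ji.2 (row_of b) ji.1)). Qed.

(** Scaling matrix column [j] by [c] multiplies the value at these basis vectors by [c] to the
    number of boxes sent to [j], by multilinearity, and by [c] to the part [j] of [la], by the
    weight. *)
Lemma box_coef_content (w : box la -> J) :
  box_coef w != 0 -> forall j : 'I_s, #|[pred b | (w b).1 == j]| = nth 0%N la j.
Proof.
move=> Fw j; apply: (@expr_fun_inj k) => c c0; apply: (mulIf Fw).
pose e j' := if j' == j then c else 1.
have e0 x : e x != 0 by rewrite /e; case: ifP; rewrite ?oner_neq0.
have := hwv_scale_cols (rows_mats (fun b => basis_vec k (w b))) e0.
rewrite (bigD1 j) //= [\prod_(i | _) _]big1 => [|i /negPf ij]; last first.
  by rewrite /e ij expr1n.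
rewrite /e eqxx mulr1 => <-.
rewrite (_ : finfun _ = rows_mats (fun b ji => basis_vec k (w b) ji * e (w b).1)).
  2: {
  apply: eq_mats => i x j'; rewrite [in LHS]ffunE mxE.
  have [/mat_rowP[b' <-]|out] := boolP (rev_ord x < t)%N; last first.
    by rewrite !rows_mats_out ?mul0r.
  rewrite !rows_mats_row /basis_vec; case: eqP => [<-//|_].
  by rewrite !mul0r. }
rewrite -[RHS]/(box_form _) box_form_expand (bigD1 (finfun w)) //=.
rewrite [X in _ = _ + X]big1 => [|w' w'w].
  rewrite addr0; congr (_ * _).
    rewrite -[LHS](prodr_const [pred b | (w b).1 == j] c) big_mkcond.
    apply: eq_bigr => b _; rewrite ffunE /basis_vec eqxx mul1r /e /=.
    by rewrite inE.
  by congr box_form; apply/funext => b; rewrite ffunE.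
have [b wb] : exists b, w' b != w b.
  apply/existsP; apply: contraNT w'w; rewrite negb_exists => /forallP ww.
  by apply/eqP/ffunP => b; apply/eqP; rewrite ffunE -[_ == _]negbK.
by rewrite (bigD1 b) //= /basis_vec (negPf wb) !mul0r.
Qed.

End RowForms.

(** * Straightening *)

Section Straightening.
Variables (k : closedFieldType) (r s m : nat) (la : seq nat).
Hypotheses (la_r : (part_size la <= r)%N) (la_s : (size la <= s)%N).
Local Notation t := (part_size la).
Local Notation J := ('I_s * 'I_m)%type.
Local Notation chi1 := (neg_rev (part_weight r (nseq t 1%N))).
Local Notation psi1 := (part_weight s la).
Local Notation row_of := (mat_row la_r).
Local Notation mat_col := (fun b : box la => widen_ord la_s (tag b)).

Definition tab_index (T : tableau la m) (b : box la) : J := (mat_col b, T b).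

(* The statistic for which straightening is increasing and the coefficients of
   the [u_T] are unitriangular. *)
Definition moment (w : box la -> J) : nat := (\sum_b (w b).1 * (w b).2)%N.

Variable f : mats k r s m -> k^o.
Hypothesis f_hwv : f \in hwv k m chi1 psi1.
Local Notation form := (box_form la_r f).
Local Notation coef := (box_coef la_r f).

Lemma box_form_addv V b u v :
  form (upd V b (fun j => u j + v j)) = form (upd V b u) + form (upd V b v).
Proof.
have E w : form (upd V b w) = \sum_j w j * form (upd V b (basis_vec k j)).
  rewrite (box_form_multilinear la_r f_hwv _ b); apply: eq_bigr => j _.
  by rewrite upd_id upd_upd.
by rewrite !E -big_split /=; apply: eq_bigr => j _; rewrite mulrDl.
Qed.

(** Adding row [b'] to row [b] preserves the form, so by additivity the form with row [b] replaced
    by row [b'] is zero. No division by 2 occurs. *)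
Lemma box_form_alt V b b' : b != b' -> V b = V b' -> form V = 0.
Proof.
wlog bb' : b b' / (row_of b < row_of b')%N => [H|_ Vbb'].
  move=> b_b' Vbb'; have [lt|gt|/val_inj/mat_row_inj e] := ltngtP (row_of b) (row_of b').
  - exact: (H b b').
  - by apply: (H b' b); rewrite // eq_sym.
  - by rewrite e eqxx in b_b'.
have : form (upd V b (fun j => V b j + V b' j)) = form V.
  rewrite -[RHS](hwv_add_row f_hwv (rows_mats la_r V) bb'); congr f; apply: eq_mats => i x j.
  rewrite [in RHS]ffunE mxE; have [/mat_rowP[c <-]|out] := boolP (rev_ord x < t)%N.
    rewrite !rows_mats_row (inj_eq (@mat_row_inj _ _ _)) /upd.
    by case: eqP => [->|]; rewrite ?mul1r // mul0r addr0.
  rewrite !(fun V i j => @rows_mats_out k r s m la la_r V i x j out) add0r.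
  case: eqP => [xb|]; last by rewrite mul0r.
  by case/negP: out; apply/mat_rowP; exists b.
rewrite box_form_addv upd_same -Vbb' upd_same => /eqP.
by rewrite -subr_eq0 addrK => /eqP.
Qed.

Lemma box_coef_inj w : coef w != 0 -> injective w.
Proof.
move=> Fw b b' wbb'; apply/eqP; apply: contraNT Fw => bb'.
by apply/eqP/(box_form_alt bb'); rewrite wbb'.
Qed.

Lemma box_coef_tperm w b b' : b != b' -> coef (w \o tperm b b') = - coef w.
Proof.
move=> bb'; pose V := fun c => basis_vec k (w c).
pose u := V b; pose v := V b'.
have upd2 x y : upd (upd V b x) b' y =
    fun c => if c == b' then y else if c == b then x else V c.
  by apply/funext.
have alt x y : x = y -> form (upd (upd V b x) b' y) = 0.
  move=> <-; apply: (box_form_alt bb'); rewrite upd2 eqxx (negPf bb').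
  by rewrite eqxx.
have := alt _ _ (erefl (fun j => u j + v j)).
rewrite box_form_addv.
have upd_comm x y : upd (upd V b x) b' y = upd (upd V b' y) b x.
  rewrite upd2; apply/funext => c; rewrite /upd; case: eqP => // ->.
  by rewrite eq_sym (negPf bb').
rewrite 2!upd_comm 2!box_form_addv -!upd_comm (alt u u erefl) (alt v v erefl) add0r addr0.
rewrite (_ : upd (upd V b u) b' v = V); last by rewrite !upd_same.
move=> /eqP; rewrite addr_eq0 => /eqP fV; rewrite -[coef w]/(form V) -fV.
rewrite upd2; congr form; apply/funext => c /=; rewrite permE /=.
case: (eqVneq c b') => [->|cb']; first by rewrite eq_sym (negPf bb').
by case: eqP.
Qed.

Lemma box_coef_perm w (p : {perm box la}) : coef w = 0 -> coef (w \o p) = 0.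
Proof.
have [ts -> ts_d] := prod_tpermP p => {p}; elim: ts w ts_d => [|[b b'] ts IH] w /=.
  move=> _ <-; rewrite big_nil; congr (box_form _ _); apply/funext => b.
  by rewrite /= perm1.
case/andP=> bb' ts_d w0; rewrite big_cons /=.
rewrite (_ : w \o _ = (w \o (\prod_(j <- ts) tperm j.1 j.2)%g) \o tperm b b').
  by rewrite box_coef_tperm // IH ?oppr0.
by apply/funext => c; rewrite /= permM.
Qed.

End Straightening.

Section Garnir.
Variables (k : closedFieldType) (r s m : nat) (la : seq nat).
Hypotheses (la_r : (part_size la <= r)%N) (la_s : (size la <= s)%N).
Local Notation t := (part_size la).
Local Notation J := ('I_s * 'I_m)%type.
Local Notation chi1 := (neg_rev (part_weight r (nseq t 1%N))).
Local Notation psi1 := (part_weight s la).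
Local Notation mat_col := (fun b : box la => widen_ord la_s (tag b)).

Definition row_strict (T : tableau la m) := forall b c : box la,
  box_row b = box_row c -> (box_col b < box_col c)%N -> (T b < T c)%N.

Lemma row_strict_le T (b c : box la) : row_strict T ->
  box_row b = box_row c -> (box_col b <= box_col c)%N -> (T b <= T c)%N.
Proof.
move=> TS row_bc; rewrite leq_eqVlt => /predU1P[col_bc|/TS/ltnW]; last exact.
by rewrite (_ : b = c) //; case: b c row_bc col_bc => [i a] [i' a'] /=;
  rewrite /box_row /box_col /= => /val_inj ii'; case: i' / ii' a' => a' /val_inj->.
Qed.

(** The common column is counted in both rows, which gives one box more than the row of [x] has. *)
Lemma garnir_box_card (x y : box la) : box_col x = box_col y -> box_row x != box_row y ->
  (nth 0%N la (box_row x) <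
   #|[pred b : box la | (box_row b == box_row x) && (box_col x <= box_col b) ||
                        (box_row b == box_row y) && (box_col b <= box_col y)]|)%N.
Proof.
(* The row of [y] is listed up to the common column, then the row of [x] from that column on, with
   the index shifted by one. The defaults of [insubd] are never taken. *)
move=> col_xy row_xy; pose h (n : 'I_(nth 0%N la (box_row x)).+1) : box la :=
  if (n <= box_col x)%N
  then Tagged (fun i : 'I_(size la) => 'I_(nth 0%N la i)) (insubd (tagged y) (val n))
  else Tagged (fun i : 'I_(size la) => 'I_(nth 0%N la i)) (insubd (tagged x) n.-1).
have h1 (n : 'I_(nth 0%N la (box_row x)).+1) :
    (n <= box_col x)%N -> box_row (h n) = box_row y /\ box_col (h n) = n :> nat.
  move=> nx; rewrite /h nx /box_row /box_col /=; split=> //.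
  rewrite val_insubd ifT // (leq_ltn_trans nx) // col_xy; exact: ltn_ord (tagged y).
have h2 (n : 'I_(nth 0%N la (box_row x)).+1) :
    (box_col x < n)%N -> box_row (h n) = box_row x /\ box_col (h n) = n.-1.
  move=> nx; rewrite /h leqNgt nx /box_row /box_col /=; split=> //.
  rewrite val_insubd ifT //; have := ltn_ord n; rewrite ltnS.
  by case: (val n) nx => //= n'; rewrite /box_row.
have h_inj : injective h.
  move=> n n' hh; apply/val_inj => /=.
  have [nx|nx] := leqP n (box_col x); have [n'x|n'x] := leqP n' (box_col x).
  - by have [_ <-] := h1 _ nx; have [_ <-] := h1 _ n'x; rewrite hh.
  - have [r1 _] := h1 _ nx; have [r2 _] := h2 _ n'x.
    by rewrite -r1 -r2 hh eqxx in row_xy.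
  - have [r1 _] := h2 _ nx; have [r2 _] := h1 _ n'x.
    by rewrite -r1 -r2 hh eqxx in row_xy.
  - have [_ c1] := h2 _ nx; have [_ c2] := h2 _ n'x.
    by move: c1 c2; rewrite hh => -> /eqP; lia.
rewrite -[X in (X <= _)%N]card_ord -(card_codom h_inj); apply/subset_leq_card/subsetP.
move=> _ /codomP[n ->]; rewrite inE; have [nx|nx] := leqP n (box_col x).
  by have [-> ->] := h1 _ nx; rewrite eqxx -col_xy nx orbT.
have [-> ->] := h2 _ nx; rewrite eqxx.
by have -> : (box_col x <= n.-1)%N by move: nx; lia.
Qed.

Variable f : mats k r s m -> k^o.
Hypothesis f_hwv : f \in hwv k m chi1 psi1.
Local Notation form := (box_form la_r f).
Local Notation coef := (box_coef la_r f).
Local Notation index := (tab_index la_s).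

Lemma mat_col_eq (b c : box la) : (mat_col b == mat_col c) = (box_row b == box_row c).
Proof. by []. Qed.

(** This sum depends on the content alone, so multiples of it can be subtracted when two moments are
    compared. *)
Lemma moment_sum (w : box la -> J) : coef w != 0 ->
  (\sum_b (w b).1 = \sum_(j < s) j * nth 0 la j)%N.
Proof.
move=> Fw; rewrite (partition_big (fun b => (w b).1) xpredT) //=.
apply: eq_bigr => j _; rewrite -(box_coef_content f_hwv Fw) mulnC -sum_nat_const.
by apply: eq_bigr => b /eqP->.
Qed.

(* Let [p < q] be the rows of [x] and [y]. The boxes of row [p] from [x] on and
   of row [q] up to [y] receive [e_p + e_q]; applying [1 - E_pq] shows that the
   form vanishes on these rows, since there are more than [la_p] such boxes.
   Expanding, every other surviving term has a larger moment. *)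
Lemma garnir (T : tableau la m) (x y : box la) :
    row_strict T -> box_col x = box_col y -> (box_row x < box_row y)%N ->
    (T y < T x)%N ->
    (forall w, (moment (index T) < moment w)%N -> coef w = 0) ->
  coef (index T) = 0.
Proof.
move=> TS col_xy row_xy Tyx IH; apply/eqP/contraT => FT.
pose Y := [pred b : box la | (box_row b == box_row x) && (box_col x <= box_col b)%N ||
                   (box_row b == box_row y) && (box_col b <= box_col y)%N].
pose P := mat_col x; pose Q := mat_col y.
have PQ : (P < Q)%N by [].
have PnQ : P == Q = false by apply: ltn_eqF.
pose e := @basis_vec k J.
pose V b (ji : J) := if b \in Y then e (P, T b) ji + e (Q, T b) ji else e (index T b) ji.
(* The rows of [V] after matrix column [P] has been subtracted from matrix column [Q]. *)
pose V' b (ji : J) := if b \in Y then e (P, T b) ji else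
  if box_row b == box_row x then e (P, T b) ji - e (Q, T b) ji else e (index T b) ji.
have VV' b j i : V' b (j, i) = V b (j, i) - (j == Q)%:R * V b (P, i).
  rewrite /V /V' /e /basis_vec; case: ifP => _.
    rewrite !xpair_eqE eqxx PnQ /=.
    by case: (j == Q); rewrite /= ?mul1r ?mul0r !addr0 ?subr0 ?addrK //.
  have [bx|bx] := eqVneq (box_row b) (box_row x).
    rewrite /tab_index (_ : mat_col b = P); last by apply/eqP; rewrite mat_col_eq bx.
    rewrite !xpair_eqE eqxx /=; by case: (j == Q); rewrite ?mul1r ?mul0r ?subr0.
  rewrite /tab_index !xpair_eqE [P == _]eq_sym mat_col_eq (negPf bx).
  by rewrite mulr0 subr0.
have VE : form V = form V'.
  rewrite -[LHS](hwv_sub_col f_hwv (rows_mats la_r V) PQ); congr f.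
  apply: eq_mats => i z j; rewrite [in LHS]ffunE mxE.
  have [/mat_rowP[b <-]|out] := boolP (rev_ord z < t)%N.
    by rewrite !rows_mats_row VV'.
  by rewrite !rows_mats_out // mulr0 subr0.
(* A nonzero term would send all boxes of [Y] to [P], more than the content allows. *)
have V'0 : form V' = 0.
  rewrite (box_form_expand la_r f_hwv) big1 // => w _; apply/eqP.
  rewrite mulf_eq0; apply: contraT; rewrite negb_or => /andP[/prodf_neq0 wV' Fw].
  have := garnir_box_card col_xy (negbT (ltn_eqF row_xy)).
  have /= <- := box_coef_content f_hwv Fw P; rewrite ltnNge => /negP[].
  apply/subset_leq_card/subsetP => b bY; rewrite inE.
  have := wV' b isT; rewrite /V' ifT //; rewrite /e /basis_vec.
  by case: (w b =P (P, T b)) => [->|_]; rewrite ?eqxx.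
have : form V = coef (index T).
  rewrite (box_form_expand la_r f_hwv) (bigD1 (finfun (index T))) //=.
  rewrite big1 => [|b _]; last first.
    rewrite ffunE /V /e /basis_vec eqxx; case: ifP => // /orP[]/andP[/eqP bx _].
      have -> : index T b = (P, T b) by congr (_, _); apply/eqP; rewrite mat_col_eq bx.
      by rewrite eqxx xpair_eqE PnQ addr0.
    have -> : index T b = (Q, T b) by congr (_, _); apply/eqP; rewrite mat_col_eq bx.
    by rewrite eqxx xpair_eqE [Q == P]eq_sym PnQ add0r.
  rewrite mul1r big1 => [|w wT].
    by rewrite addr0; congr (box_form _ _); apply/funext => b; rewrite ffunE.
  apply/eqP; rewrite mulf_eq0; apply: contraT; rewrite negb_or => /andP[/prodf_neq0 wV Fw].
  have wP b : w b = index T b \/ b \in Y /\ (w b = (P, T b) \/ w b = (Q, T b)).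
    have := wV b isT; rewrite /V /e /basis_vec; case: ifP => bY.
      case: (w b =P (P, T b)) => [->|_]; first by right; split=> //; left.
      case: (w b =P (Q, T b)) => [->|_]; first by right; split=> //; right.
      by rewrite addr0 eqxx.
    by case: (w b =P index T b) => [->|_]; rewrite ?eqxx //; left.
  (* The difference of the two sides is the change of the matrix column times [T b - T x]. Boxes
     moved from [P] to [Q] have entries at least [T x], boxes moved from [Q] to [P] have entries at
     most [T y], so it is never negative. *)
  have wle b : ((index T b).1 * (index T b).2 + T x * (w b).1 <=
                (w b).1 * (w b).2 + T x * (index T b).1)%N.
    have [->//|[bY wb]] := wP b.
    case/orP: bY => /andP[/eqP bx bc].
      have Tb : (T x <= T b)%N by apply: row_strict_le.
      have -> : index T b = (P, T b) by congr (_, _); apply/eqP; rewrite mat_col_eq bx.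
      by case: wb => -> //=; have : (P < Q)%N by []; rewrite /=; nia.
    have Tb : (T b <= T y)%N by apply: row_strict_le.
    have -> : index T b = (Q, T b) by congr (_, _); apply/eqP; rewrite mat_col_eq bx.
    by case: wb => -> //=; have : (P < Q)%N by []; rewrite /=; nia.
  (* Some box must move from [Q] to [P]: otherwise all changes go from [P] to [Q], and the content
     of [P] drops. This box makes the inequality strict. *)
  have [b bQ wb] : exists2 b, (index T b).1 = Q /\ b \in Y & w b = (P, T b).
    apply: contrapT => noQ.
    have wQ b : (index T b).1 = Q -> w b = index T b.
      move=> bQ; have [//|[bY [wb|wb]]] := wP b; last by rewrite wb -bQ.
      by case: noQ; exists b.
    have [b wb] : exists b, w b != index T b.
      apply/existsP; apply: contraNT wT; rewrite negb_exists => /forallP ww.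
      by apply/eqP/ffunP => b; apply/eqP; rewrite ffunE -[_ == _]negbK.
    have := box_coef_content f_hwv FT P; rewrite -(box_coef_content f_hwv Fw P).
    apply/eqP; rewrite gtn_eqF //; apply: proper_card; apply/properP; split.
      apply/subsetP => c; rewrite !inE => /eqP wc.
      have [wcT|[cY _]] := wP c; first by rewrite -wc wcT.
      case/orP: cY => /andP[cx _]; first by rewrite mat_col_eq.
      have cQ : (index T c).1 = Q by apply/eqP; rewrite mat_col_eq.
      by move/eqP: wc; rewrite (wQ _ cQ) cQ eq_sym PnQ.
    exists b; rewrite !inE.
      have [wbT|[bY _]] := wP b; first by rewrite wbT eqxx in wb.
      case/orP: bY => /andP[bx _]; first by rewrite mat_col_eq.
      by rewrite wQ ?eqxx // in wb; apply/eqP; rewrite mat_col_eq.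
    have [wbT|[bY [wbP|wbQ]]] := wP b; first by rewrite wbT eqxx in wb.
      case/orP: bY => /andP[bx _].
        move: wb; rewrite wbP => /eqP[]; congr (_, _); apply/eqP.
        by rewrite eq_sym mat_col_eq.
      by rewrite wQ ?eqxx // in wb; apply/eqP; rewrite mat_col_eq.
    by rewrite wbQ /= eq_sym PnQ.
  have wlt : ((index T b).1 * (index T b).2 + T x * (w b).1 <
                (w b).1 * (w b).2 + T x * (index T b).1)%N.
    case: bQ => bQ bY; rewrite bQ wb /=.
    have Tb : (T b <= T y)%N.
      case/orP: bY => /andP[/eqP bx bc]; last exact: row_strict_le.
      move/eqP: bQ; rewrite mat_col_eq bx => /eqP e1.
      by move: row_xy; rewrite e1 ltnn.
    by have := PQ; rewrite /=; nia.
  case/eqP: (Fw); apply: IH.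
  have : (\sum_b ((index T b).1 * (index T b).2 + T x * (w b).1) <
          \sum_b ((w b).1 * (w b).2 + T x * (index T b).1))%N.
    rewrite (bigD1 b) //= [X in (_ < X)%N](bigD1 b) //= -addSn leq_add //.
    by apply: leq_sum => c _; apply: wle.
  rewrite !big_split /= -!big_distrr /= (moment_sum Fw).
  by rewrite [X in (_ < _ + _ * X)%N](moment_sum FT) ltn_add2r.
by rewrite VE V'0 => F0; rewrite -F0 eqxx in FT.
Qed.

End Garnir.

Section Determination.
Variables (k : closedFieldType) (r s m : nat) (la : seq nat).
Hypotheses (la_r : (part_size la <= r)%N) (la_s : (size la <= s)%N).
Local Notation t := (part_size la).
Local Notation J := ('I_s * 'I_m)%type.
Local Notation chi1 := (neg_rev (part_weight r (nseq t 1%N))).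
Local Notation psi1 := (part_weight s la).
Local Notation mat_col := (fun b : box la => widen_ord la_s (tag b)).
Variable f : mats k r s m -> k^o.
Hypothesis f_hwv : f \in hwv k m chi1 psi1.
Local Notation coef := (box_coef la_r f).
Local Notation index := (@tab_index s m la la_s).

Lemma row_semistandardP (T : tableau la m) :
  reflect (row_strict T /\ forall b c : box la, box_col b = box_col c ->
             (box_row b < box_row c)%N -> (T b <= T c)%N)
          (row_semistandard T).
Proof.
apply: (iffP forallP) => [H|[TR TC] b].
  split=> b c; have /forallP/(_ c)/andP[H1 H2] := H b.
    by move=> bc bc'; move: H1; rewrite bc eqxx bc'.
  by move=> bc bc'; move: H2; rewrite bc eqxx bc'.
apply/forallP => c; apply/andP; split; apply/implyP => /andP[/eqP bc].
  exact: TR.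
exact: TC.
Qed.

Lemma sorted_enum_ord n (A : {set 'I_n}) : sorted (fun i j : 'I_n => i < j)%N (enum A).
Proof.
rewrite /enum_mem; have: sorted (fun i j : 'I_n => i < j)%N (Finite.enum 'I_n).
  by have := iota_ltn_sorted 0 n; rewrite -val_enum_ord sorted_map enumT.
by apply: sorted_filter => i j l; apply: ltn_trans.
Qed.

Lemma tab_index_inj (T : tableau la m) : row_strict T -> injective (index T).
Proof.
move=> TS b c [/eqP]; rewrite -[_ == _]/(mat_col b == mat_col c) mat_col_eq => /eqP bc Tbc.
have [lt|gt|e] := ltngtP (box_col b) (box_col c).
- by have := TS _ _ bc lt; rewrite Tbc ltnn.
- by have := TS _ _ (esym bc) gt; rewrite Tbc ltnn.
case: b c bc e {Tbc} => [i a] [i' a'].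
by rewrite /box_row /box_col /= => /val_inj ii'; case: i' / ii' a' => a' /val_inj->.
Qed.

(** As [w] is injective, the boxes sent to matrix column [i] carry a set of distinct entries, as
    many as row [i] has boxes; listing each set in increasing order gives the rows of [T]. *)
Lemma box_coef_sort w : coef w != 0 ->
  exists2 T : tableau la m, row_strict T &
    exists p : {perm box la}, index T =1 w \o p.
Proof.
move=> Fw; have w_inj := box_coef_inj f_hwv Fw.
pose A (i : 'I_(size la)) := [set x : 'I_m | [exists b, w b == (widen_ord la_s i, x)]].
have cardA i : #|A i| = nth 0%N la i.
  rewrite -(box_coef_content f_hwv Fw (widen_ord la_s i)).
  have -> : A i = [set (w b).2 | b in [pred b | (w b).1 == widen_ord la_s i]].
    apply/setP => x; rewrite inE; apply/existsP/imsetP => -[b].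
      by move/eqP=> wb; exists b; rewrite ?inE wb ?eqxx.
    by rewrite inE => /eqP wb ->; exists b; rewrite -wb -surjective_pairing.
  rewrite card_in_imset // => b c; rewrite !inE => /eqP bi /eqP ci bc.
  by apply: w_inj; rewrite (surjective_pairing (w b)) (surjective_pairing (w c)) bi ci bc.
pose T : tableau la m := [ffun b => nth (w b).2 (enum (A (tag b))) (tagged b)].
have sizeA (b : box la) : (tagged b < size (enum (A (tag b))))%N.
  by rewrite -cardE cardA; exact: ltn_ord (tagged b).
have TA b : T b \in A (tag b) by rewrite -mem_enum ffunE mem_nth.
have TS : row_strict T.
  move=> [i a] [i' a']; rewrite /box_row /box_col /= => /val_inj ii'.
  case: i' / ii' a' => a' aa'; rewrite !ffunE /=.
  have sa := sizeA (existT _ i a); have sa' := sizeA (existT _ i a').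
  rewrite (set_nth_default (w (existT _ i a')).2 _ sa).
  apply: (sorted_ltn_nth _ _ (sorted_enum_ord (A i))) => //.
  by move=> x y z; apply: ltn_trans.
exists T => //.
have /choice[h hE] : forall b, exists c, w c = index T b.
  by move=> b; have := TA b; rewrite inE => /existsP[c /eqP]; exists c.
have h_inj : injective h.
  by move=> b c hbc; apply: (tab_index_inj TS); rewrite -!hE hbc.
by exists (perm h_inj) => b; rewrite /= permE hE.
Qed.

Lemma moment_perm (w : box la -> J) (p : {perm box la}) : moment (w \o p) = moment w.
Proof. by rewrite [RHS](reindex_inj (@perm_inj _ p)). Qed.

Lemma moment_le (w : box la -> J) : (moment w <= \sum_(b : box la) s * m)%N.
Proof.
apply: leq_sum => b _; apply: leq_mul.
  exact: ltnW (ltn_ord _).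
exact: ltnW (ltn_ord _).
Qed.

(** Descending induction on the moment, which is bounded; sorting the rows leaves it unchanged, and
    [garnir] only refers to larger moments. *)
Lemma box_coef_determined :
  (forall T : tableau la m, row_semistandard T -> coef (index T) = 0) ->
  forall w, coef w = 0.
Proof.
move=> F0; suff H n w : (\sum_(b : box la) s * m < moment w + n)%N -> coef w = 0.
  by move=> w; apply: (H (\sum_(b : box la) s * m).+1); rewrite addnS ltnS leq_addl.
elim: n w => [|n IH] w; first by rewrite addn0 ltnNge moment_le.
move=> wn; apply/eqP/contraT => Fw.
have [T TS [p Tp]] := box_coef_sort Fw; have {}Tp := funext Tp.
have T0 : coef (index T) = 0.
  have [/F0//|Tns] := boolP (row_semistandard T).
  have [x [y [xy row_xy Tyx]]] : exists x, exists y : box la,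
      [/\ box_col x = box_col y, (box_row x < box_row y)%N & (T y < T x)%N].
    apply: contrapT => noxy; move/negP: Tns; apply; apply/row_semistandardP.
    split=> // b c bc row_bc; rewrite leqNgt; apply/negP => Tcb.
    by apply: noxy; exists b, c.
  apply: (garnir f_hwv TS xy row_xy Tyx) => w' w'gt; apply: IH.
  have := moment_perm w p; rewrite -Tp => e; move: w'gt; rewrite e => w'gt.
  by apply: leq_trans wn _; rewrite addnS -addSn leq_add2r.
case/eqP: Fw; rewrite (_ : w = index T \o p^-1%g).
  exact: box_coef_perm.
by rewrite Tp; apply/funext => b; rewrite /= permKV.
Qed.

Lemma hwv_determined :
  (forall T : tableau la m, row_semistandard T -> coef (index T) = 0) ->
  f = 0.
Proof.
move=> F0; apply/funext => A; rewrite (hwv_expand la_r f_hwv) big1 // => w _.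
by rewrite box_coef_determined ?mulr0.
Qed.

End Determination.

(** * The functions u_T *)

(** A sorted list is determined by the number of its entries below each threshold, and [p] preserves
    these numbers. This is applied to columns, for orbits, and to rows, for triangularity. *)
Lemma monotone_rearrangement (B : finType) (m : nat) (cls pos : B -> nat)
    (T S : B -> 'I_m) (p : {perm B}) :
    (forall b, cls (p b) = cls b) -> (forall b, S b = T (p b)) ->
    (forall b c, cls b = cls c -> (pos b <= pos c)%N -> (T b <= T c)%N) ->
    (forall b c, cls b = cls c -> (pos b <= pos c)%N -> (S b <= S c)%N) ->
  S =1 T.
Proof.
move=> p_cls ST Tmono Smono b; apply/val_inj/eqP => /=.
have card_le (v : nat) :
    #|[set c | (cls c == cls b) && (S c <= v)%N]| =
    #|[set c | (cls c == cls b) && (T c <= v)%N]|.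
  rewrite -[LHS](card_imset _ (@perm_inj _ p)); apply: eq_card => c.
  apply/imsetP/idP => [[d]|].
    by rewrite !inE => /andP[db dv] ->; rewrite p_cls db -ST.
  rewrite inE => /andP[cb cv]; exists (p^-1%g c); rewrite ?permKV //.
  by rewrite inE ST permKV cv andbT -(p_cls (p^-1%g c)) permKV.
have contra (U U' : B -> 'I_m) :
    (forall b c, cls b = cls c -> (pos b <= pos c)%N -> (U b <= U c)%N) ->
    (forall b c, cls b = cls c -> (pos b <= pos c)%N -> (U' b <= U' c)%N) ->
    (U b < U' b)%N ->
    (#|[set c | (cls c == cls b) && (U' c <= U b)%N]| <
     #|[set c | (cls c == cls b) && (U c <= U b)%N]|)%N.
  move=> Um U'm UU'; apply: proper_card; apply/properP; split.
    apply/subsetP => c; rewrite !inE => /andP[/eqP cb cU]; rewrite cb eqxx /=.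
    apply: Um => //; rewrite leqNgt; apply/negP => /ltnW/(U'm _ _ (esym cb)) bc.
    by have := leq_trans bc cU; rewrite leqNgt UU'.
  by exists b; rewrite !inE eqxx /= ?leqnn // -ltnNge.
have [lt|lt|//] := ltngtP (S b) (T b).
  by have := contra S T Smono Tmono lt; rewrite card_le ltnn.
by have := contra T S Tmono Smono lt; rewrite card_le ltnn.
Qed.

Section BoxDeterminants.
Variables (k : fieldType) (r s m : nat) (la : seq nat).
Hypotheses (la_r : (part_size la <= r)%N) (la_s : (size la <= s)%N).
Local Notation t := (part_size la).
Local Notation J := ('I_s * 'I_m)%type.
Local Notation mat_col := (fun b : box la => widen_ord la_s (tag b)).
Local Notation index := (@tab_index s m la la_s).
Local Notation mats := (mats k r s m).

Definition box_mx (G : box la -> 'I_t -> k) : 'M[k]_t :=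
  \matrix_(a, c) G (box_unrank c) a.

Lemma box_detE G : \det (box_mx G) =
  \sum_(p : 'S_t) (-1) ^+ p * \prod_b G b (p (box_rank b)).
Proof.
rewrite -det_tr; apply: eq_bigr => p _; congr (_ * _).
rewrite (reindex _ (onW_bij _ (Bijective (@box_rankK la) (@box_unrankK la)))) /=.
by apply: eq_bigr => b _; rewrite !mxE box_rankK.
Qed.

Lemma box_det_expand (I : finType) (h : box la -> I -> k) (X : I -> box la -> 'I_t -> k) :
  \det (box_mx (fun b a => \sum_i h b i * X i b a)) =
  \sum_(phi : {ffun box la -> I})
    (\prod_b h b (phi b)) * \det (box_mx (fun b a => X (phi b) b a)).
Proof.
under [RHS]eq_bigr do rewrite box_detE mulr_sumr.
rewrite box_detE exchange_big /=; apply: eq_bigr => p _.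
rewrite bigA_distr_bigA /= mulr_sumr; apply: eq_bigr => phi _.
by rewrite big_split /= mulrCA.
Qed.

Lemma box_det_alt G b b' : b != b' -> G b = G b' -> \det (box_mx G) = 0.
Proof.
move=> bb' Gbb'; rewrite -det_tr.
apply: (@determinant_alternate _ _ _ (box_rank b) (box_rank b')).
  by rewrite (inj_eq (can_inj (@box_rankK la))).
by move=> a; rewrite !mxE !box_rankK Gbb'.
Qed.

Lemma box_det_tperm G b b' : b != b' ->
  \det (box_mx (G \o tperm b b')) = - \det (box_mx G).
Proof.
move=> bb'; have -> : box_mx (G \o tperm b b') = xcol (box_rank b) (box_rank b') (box_mx G).
  apply/matrixP => a c; rewrite !mxE /=; congr (G _ a).
  by rewrite (inj_tperm _ _ _ (can_inj (@box_unrankK la))) !box_rankK.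
rewrite xcolE det_mulmx det_perm odd_tperm (inj_eq (can_inj (@box_rankK la))) bb'.
by rewrite mulrN1.
Qed.

Definition box_det (w : box la -> J) (A : mats) : k :=
  \det (box_mx (fun b a => A (w b).2 (last_ord la_r a) (w b).1)).

Lemma box_det_regular w : box_det w \in regular_fun (@mats_coord k r s m).
Proof.
apply: (@regular_det k mats _ (@mats_coord k r s m) t
  (fun A : mats => box_mx (fun b a => A (w b).2 (last_ord la_r a) (w b).1))) => a c.
apply: (regular_ext _ (regular_coord _ ((w (box_unrank c)).2, last_ord la_r a, (w (box_unrank c)).1))).
by move=> A; rewrite mxE.
Qed.

Lemma uTE (T : tableau la m) (A : mats) :
  uT k la_r la_s T A = \sum_(S in col_orbit T) box_det (index S) A.
Proof.
apply: eq_bigr => S _; congr (\det _); apply/matrixP => a c.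
rewrite !mxE -[existT _ _ _]/(Tagged _ _) -tagnat.sigE12 (bigD1 (mat_col (box_unrank c))) //=.
rewrite mxE !eqxx mulr1 big1 ?addr0 // => j /negPf jc.
by rewrite mxE jc mulr0.
Qed.

Lemma big_last_ord (R : Type) (idx : R) (op : Monoid.com_law idx) (F : 'I_r -> R) :
  \big[op/idx]_(y | (rev_ord y < t)%N) F y = \big[op/idx]_(a < t) F (last_ord la_r a).
Proof.
clear la_s; rewrite (reindex_omap (last_ord la_r) (fun y => insub (y - (r - t))%N)).
  apply: eq_bigl => a; apply/andP; split.
    by apply/(mat_rowP la_r); exists (box_unrank a); rewrite /mat_row box_unrankK.
  by rewrite last_ord_val addKn valK.
move=> y yt; have lt : (y - (r - t) < t)%N by move: yt => /=; have := ltn_ord y; lia.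
rewrite (insubT (fun n => n < t)%N lt) /=; congr Some; apply: ord_inj.
by rewrite last_ord_val /=; move: yt => /=; have := ltn_ord y; lia.
Qed.

Lemma sum_last_ord (F : 'I_r -> k) : (forall y, ~~ (rev_ord y < t)%N -> F y = 0) ->
  \sum_y F y = \sum_(a < t) F (last_ord la_r a).
Proof.
move=> F0; rewrite (bigID (fun y => rev_ord y < t)%N) /= addrC big1 ?add0r //.
exact: big_last_ord.
Qed.

(** For upper triangular [P] the last [t] rows of a product involve only the last [t] rows of the
    right factor, so the lower right block of [P] splits off. *)
Lemma box_det_mul_rows w (P : 'M[k]_r) A : is_trig_mx P^T ->
  box_det w (lrmul P 1%:M A) = (\prod_x P x x ^+ (rev_ord x < t)%N) * box_det w A.
Proof.
clear la_s; move=> Ptrig; have P0 (x y : 'I_r) : (y < x)%N -> P x y = 0.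
  by move=> yx; have := is_trig_mxP Ptrig y x yx; rewrite mxE.
pose Q : 'M[k]_t := \matrix_(a, c) P (last_ord la_r a) (last_ord la_r c).
have -> : box_det w (lrmul P 1%:M A) = \det (Q *m box_mx (fun b a => A (w b).2 (last_ord la_r a) (w b).1)).
  congr (\det _); apply/matrixP => a c; rewrite !mxE ffunE mulmx1 mxE sum_last_ord.
    by apply: eq_bigr => a' _; rewrite !mxE.
  move=> y yt; rewrite P0 ?mul0r // last_ord_val.
  by move: yt => /=; have := ltn_ord y; have := ltn_ord a; lia.
rewrite det_mulmx; congr (_ * _); rewrite -det_tr det_trig; last first.
  apply/is_trig_mxP => i j ij; rewrite !mxE P0 // !last_ord_val.
  by rewrite ltn_add2l.
rewrite [RHS](bigID (fun y : 'I_r => rev_ord y < t)%N) /= [X in _ = _ * X]big1 ?mulr1; last first.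
  by move=> x /negPf->; rewrite expr0.
rewrite big_last_ord; apply: eq_bigr => a _; rewrite !mxE.
suff -> : (rev_ord (last_ord la_r a) < t)%N by rewrite expr1.
by apply/(mat_rowP la_r); exists (box_unrank a); rewrite /mat_row box_unrankK.
Qed.

Lemma box_det_mul_cols (T : tableau la m) (Q : 'M[k]_s) A :
  box_det (index T) (lrmul 1%:M Q A) =
  \sum_(rho : {ffun box la -> 'I_s})
    (\prod_b Q (rho b) (mat_col b)) * box_det (fun b => (rho b, T b)) A.
Proof.
rewrite -(box_det_expand (fun b j => Q j (mat_col b))
  (fun j b a => A (T b) (last_ord la_r a) j)).
congr (\det _); apply/matrixP => a c; rewrite !mxE ffunE mul1mx mxE.
by apply: eq_bigr => j _; rewrite mulrC.
Qed.

Lemma box_det_mats_act (T : tableau la m) (g : GL k m) A :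
  box_det (index T) (mats_act_m g^-1%g A) =
  \sum_(S : tableau la m)
    (\prod_b GL_mx g (S b) (T b)) * box_det (index S) A.
Proof.
rewrite -(box_det_expand (fun b j => GL_mx g j (T b))
  (fun j b a => A j (last_ord la_r a) (mat_col b))).
congr (\det _); apply/matrixP => a c; rewrite !mxE ffunE invgK summxE.
by apply: eq_bigr => j _; rewrite mxE.
Qed.

End BoxDeterminants.

Section Triangularity.
Variables (k : closedFieldType) (r s m : nat) (la : seq nat).
Hypotheses (la_r : (part_size la <= r)%N) (la_s : (size la <= s)%N).
Local Notation t := (part_size la).
Local Notation index := (@tab_index s m la la_s).
Local Notation det_of := (@box_det k r s m la la_r).
Local Notation coef := (@box_coef k r s m la la_r).
Local Notation u := (@uT k r s m la la_r la_s).

Lemma box_coef_det w w' : coef (det_of w) w' =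
  \det (box_mx (fun b a => (w b == w' (box_unrank a))%:R : k)).
Proof.
congr (\det _); apply/matrixP => a c; rewrite !mxE.
have -> : last_ord la_r a = mat_row la_r (box_unrank a).
  by rewrite /mat_row box_unrankK.
by rewrite rows_mats_row -surjective_pairing.
Qed.

(** The coefficient is the determinant of an incidence matrix; a nonzero term in its Leibniz
    expansion matches [w] with [w']. *)
Lemma box_coef_det_perm w w' : coef (det_of w) w' != 0 ->
  exists p : {perm box la}, w' =1 w \o p.
Proof.
rewrite box_coef_det => D0.
have [p /prodf_neq0 pw] : exists p : 'S_t,
    \prod_a (box_mx (fun b a => (w b == w' (box_unrank a))%:R : k)) a (p a) != 0.
  apply/existsP; apply: contraNT D0; rewrite negb_exists => /forallP D0.
  by rewrite /determinant big1 // => p _; have /negPn/eqP-> := D0 p; rewrite mulr0.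
have h_inj : injective (fun b : box la => box_unrank (p (box_rank b))).
  by move=> b c /(can_inj (@box_unrankK la))/perm_inj/(can_inj (@box_rankK la)).
exists (perm h_inj) => b; rewrite /= permE; apply/eqP.
have := pw (box_rank b) isT; rewrite mxE box_rankK.
by case: (w _ =P w' b) => [->|_]; rewrite ?eqxx.
Qed.

Lemma box_coef_det_diag w : injective w -> coef (det_of w) w = 1.
Proof.
move=> w_inj; rewrite box_coef_det -[RHS](det1 k t); congr (\det _).
apply/matrixP => a c; rewrite !mxE (inj_eq w_inj) (inj_eq (can_inj (@box_unrankK la))).
by rewrite eq_sym.
Qed.

Lemma col_orbitP (T S : tableau la m) :
  reflect (exists2 p : {perm box la}, (forall b, box_col (p b) = box_col b) &
             forall b, S b = T (p b))
          (S \in col_orbit T).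
Proof.
apply: (iffP imsetP) => [[p]|[p p_col ST]].
  rewrite inE => /forallP p_col ->; exists p^-1%g => b; last by rewrite ffunE.
  by have /eqP := p_col (p^-1%g b); rewrite permKV.
exists p^-1%g; last by apply/ffunP => b; rewrite ffunE invgK ST.
by rewrite inE; apply/forallP => b; apply/eqP; rewrite -(p_col (p^-1%g b)) permKV.
Qed.

Lemma col_orbit_id (T : tableau la m) : T \in col_orbit T.
Proof. by apply/col_orbitP; exists 1%g => b; rewrite perm1. Qed.

Lemma box_eq (b c : box la) : box_row b = box_row c -> box_col b = box_col c -> b = c.
Proof.
case: b c => [i a] [i' a']; rewrite /box_row /box_col /= => /val_inj ii'.
by case: i' / ii' a' => a' /val_inj->.
Qed.

Lemma col_orbit_tperm (T S : tableau la m) b c : box_col b = box_col c ->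
  S \in col_orbit T -> [ffun d => S (tperm b c d)] \in col_orbit T.
Proof.
move=> bc /col_orbitP[p p_col SE]; apply/col_orbitP.
exists (tperm b c * p)%g => d; last by rewrite ffunE SE permM.
by rewrite permM p_col; case: tpermP => [->|->|].
Qed.

Lemma semistandard_le_row (T : tableau la m) (b c : box la) : row_semistandard T ->
  box_row b = box_row c -> (box_col b <= box_col c)%N -> (T b <= T c)%N.
Proof. by move=> /row_semistandardP[TR _]; apply: row_strict_le. Qed.

Lemma semistandard_le_col (T : tableau la m) (b c : box la) : row_semistandard T ->
  box_col b = box_col c -> (box_row b <= box_row c)%N -> (T b <= T c)%N.
Proof.
move=> /row_semistandardP[_ TC] bc; rewrite leq_eqVlt => /predU1P[row_bc|/TC]; last exact.
by rewrite (box_eq row_bc bc).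
Qed.

(** Exchanging two entries of a column that are out of order raises the moment, so the sorted
    tableau is the unique maximum of its orbit. *)
Lemma moment_col_orbit (T S : tableau la m) : row_semistandard T ->
  S \in col_orbit T -> S = T \/ (moment (index S) < moment (index T))%N.
Proof.
move=> TS; have [n] := ubnP (\sum_(b : box la) s * m - moment (index S)).
elim: n S => // n IH S Sn ST.
have [Ssorted|] := boolP [forall b, forall c, (box_col b == box_col c) &&
    (box_row b < box_row c)%N ==> (S b <= S c)%N].
  left; apply/ffunP; have [p p_col SE] := col_orbitP _ _ ST.
  apply: (monotone_rearrangement (pos := @box_row la) p_col SE).
    by move=> b c; apply: semistandard_le_col.
  move=> b c bc; rewrite leq_eqVlt => /predU1P[row_bc|lt].
    by rewrite (box_eq row_bc bc).
  by have /forallP/(_ b)/forallP/(_ c) := Ssorted; rewrite bc eqxx lt.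
rewrite negb_forall => /existsP[b]; rewrite negb_forall => /existsP[c].
rewrite negb_imply -ltnNge => /andP[/andP[/eqP bc row_bc] Scb]; right.
pose S' : tableau la m := [ffun d => S (tperm b c d)].
have cb : c != b by apply: contraTneq row_bc => ->; rewrite ltnn.
have SS' : (moment (index S) < moment (index S'))%N.
  rewrite /moment (bigD1 b) //= (bigD1 c) //= [X in (_ < X)%N](bigD1 b) //=.
  rewrite [X in (_ < _ + X)%N](bigD1 c) //= !ffunE tpermL tpermR !addnA -addSn.
  apply: leq_add; first by move: row_bc; rewrite /box_row; nia.
  apply: leq_sum => d /andP[db dc]; rewrite ffunE.
  by rewrite tpermD // eq_sym.
have S'T := col_orbit_tperm bc ST.
have S'n : (\sum_(b : box la) s * m - moment (index S') < n)%N.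
  have := moment_le (index S'); move: (\sum_(b : box la) s * m)%N Sn SS' => N.
  move: (moment _) (moment _) => x y; lia.
by have [<-//|] := IH S' S'n S'T; apply: ltn_trans.
Qed.

Lemma box_coef_uT (T : tableau la m) w :
  coef (u T) w = \sum_(S in col_orbit T) coef (det_of (index S)) w.
Proof. by rewrite /box_coef /box_form uTE. Qed.

(** A contributing [S] in the orbit has the moment of [T'], as moments ignore the order of boxes. If
    [S] is [T], then [T'] rearranges [T] within rows, and both have sorted rows. *)
Lemma box_coef_uT_triangular (T T' : tableau la m) :
    row_semistandard T -> row_semistandard T' ->
    coef (u T) (index T') != 0 ->
  T' = T \/ (moment (index T') < moment (index T))%N.
Proof.
move=> TS T'S; rewrite box_coef_uT => uT0.
have [S ST Sw] : exists2 S, S \in col_orbit T & coef (det_of (index S)) (index T') != 0.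
  apply: contrapT => noS; case/eqP: uT0; apply: big1 => S ST.
  by apply/eqP/contraT => S0; case: noS; exists S.
have [p pE] := box_coef_det_perm Sw.
have -> : moment (index T') = moment (index S) by rewrite (funext pE) moment_perm.
have [ST'|] := moment_col_orbit TS ST; [left | by right].
rewrite ST' in pE; apply/ffunP.
apply: (@monotone_rearrangement _ _ (@box_row la) (@box_col la) _ _ p).
- move=> b; have := congr1 fst (pE b) => /= /eqP.
  by rewrite mat_col_eq => /eqP->.
- by move=> b; have := congr1 snd (pE b).
- by move=> b c; apply: semistandard_le_row.
- by move=> b c; apply: semistandard_le_row.
Qed.

Lemma box_coef_uT_diag (T : tableau la m) : row_semistandard T ->
  coef (u T) (index T) = 1.
Proof.
move=> TS; rewrite box_coef_uT (bigD1 T) ?col_orbit_id //=.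
rewrite box_coef_det_diag; last by apply: tab_index_inj; case/row_semistandardP: TS.
rewrite big1 ?addr0 // => S /andP[ST S_T]; apply/eqP/contraT => /box_coef_det_perm[p pE].
have [SE|] := moment_col_orbit TS ST; first by rewrite SE eqxx in S_T.
by rewrite (funext pE) moment_perm ltnn.
Qed.

End Triangularity.

(** * The [u_T] form a basis *)

Section HighestWeightBasis.
Variables (k : closedFieldType) (r s m : nat) (la : seq nat).
Hypothesis la_partition : is_partition la.
Hypotheses (la_r : (part_size la <= r)%N) (la_s : (size la <= s)%N).
Local Notation t := (part_size la).
Local Notation chi1 := (neg_rev (part_weight r (nseq t 1%N))).
Local Notation psi1 := (part_weight s la).
Local Notation mat_col := (fun b : box la => widen_ord la_s (tag b)).
Local Notation index := (@tab_index s m la la_s).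
Local Notation det_of := (@box_det k r s m la la_r).
Local Notation coef := (@box_coef k r s m la la_r).
Local Notation u := (@uT k r s m la la_r la_s).

Lemma card_box_row (j : 'I_s) : #|[pred b : box la | mat_col b == j]| = nth 0%N la j.
Proof.
rewrite -sum1_card (eq_bigl (fun b : box la => (tag b == j :> nat) && true)); last first.
  by move=> b; rewrite inE andbT -val_eqE.
rewrite -(@sig_big_dep _ _ _ _ (fun i : 'I_(size la) => 'I_(nth 0%N la i))
  (fun i => i == j :> nat) (fun _ _ => true) (fun _ _ => 1%N)) /=.
have [js|sj] := ltnP j (size la).
  rewrite (big_pred1 (Ordinal js)); last by move=> i; rewrite /= -val_eqE.
  by rewrite sum1_card card_ord.
rewrite nth_default // big_pred0 // => i; apply: ltn_eqF.
exact: leq_trans (ltn_ord i) sj.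
Qed.

Lemma prod_mat_col (F : 'I_s -> k) :
  \prod_(b : box la) F (mat_col b) = \prod_j F j ^+ nth 0%N la j.
Proof.
rewrite (partition_big (fun b : box la => mat_col b) xpredT) //=; apply: eq_bigr => j _.
rewrite -card_box_row -prodr_const; apply: eq_big => [b|b /eqP->] //.
Qed.

(* The orbit is split by the order of the entries in [b] and [c]: pairing each
   tableau with its swap keeps the argument valid in characteristic 2. *)
Lemma orbit_alternating (T : tableau la m) (rho : box la -> 'I_s) b c A :
    b != c -> box_col b = box_col c -> rho b = rho c ->
  \sum_(S in col_orbit T) det_of (fun d => (rho d, S d)) A = 0.
Proof.
move=> bc col_bc rho_bc; pose sw (S : tableau la m) : tableau la m := [ffun d => S (tperm b c d)].
have swK : involutive sw by move=> S; apply/ffunP => d; rewrite !ffunE tpermK.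
have sw_orb S : (sw S \in col_orbit T) = (S \in col_orbit T).
  by apply/idP/idP => /(col_orbit_tperm col_bc); rewrite -/(sw _) ?swK.
have swD S : det_of (fun d => (rho d, sw S d)) A = - det_of (fun d => (rho d, S d)) A.
  rewrite /box_det -(box_det_tperm _ bc); congr (\det _); apply/matrixP => a d; rewrite !mxE /= ffunE.
  by case: tpermP => [->|->|]; rewrite // rho_bc.
rewrite (bigID (fun S : tableau la m => S b < S c)%N) /=.
rewrite [X in _ + X](bigID (fun S : tableau la m => S c < S b)%N) /=.
rewrite [X in _ + (_ + X)]big1 ?addr0 => [|S /andP[/andP[_ nbc] ncb]]; last first.
  apply: (box_det_alt bc); apply/funext => a; rewrite rho_bc /=.
  suff -> : S b = S c by [].
  by apply/val_inj/eqP; rewrite /= eqn_leq (leqNgt (S b)) ncb leqNgt nbc.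
rewrite [X in _ + X](reindex_inj (inv_inj swK)) /=.
under [X in _ + X]eq_bigr do rewrite swD.
rewrite sumrN; apply/eqP; rewrite subr_eq0; apply/eqP; apply: eq_bigl => S.
rewrite sw_orb !ffunE tpermL tpermR; by case: (_ \in _); case: (ltngtP (S b) (S c)).
Qed.

(** Take a moved box in the topmost possible row. It is sent to the number of a higher row; the box
    of that row in the same column exists because [la] is a partition, and by minimality it is not
    moved. *)
Lemma below_diagonal_repeat (rho : box la -> 'I_s) :
    (forall b, rho b <= mat_col b)%N -> (exists b, rho b != mat_col b) ->
  exists b, exists c, [/\ b != c, box_col b = box_col c & rho b = rho c].
Proof.
move=> rho_le [b0 b0P].
case: (@arg_minnP _ b0 (fun b => rho b != mat_col b) (@box_row la) b0P) => b bP bmin.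
have lt : (rho b < box_row b)%N by rewrite ltn_neqAle (rho_le b) andbT -val_eqE in bP *.
have lt_s : (rho b < size la)%N := ltn_trans lt (ltn_ord (tag b)).
have lt_c : (box_col b < nth 0%N la (Ordinal lt_s))%N.
  apply: leq_trans (ltn_ord (tagged b)) _; case/andP: la_partition => la_sorted _.
  have geq_trans : transitive geq by move=> x y z xy yz; apply: leq_trans yz xy.
  exact: (sorted_ltn_nth geq_trans 0%N la_sorted _ _ lt_s (ltn_ord (tag b)) lt).
pose c : box la := Tagged (fun i : 'I_(size la) => 'I_(nth 0%N la i)) (Ordinal lt_c).
exists b, c; split=> //.
  by apply: contraTneq lt => bc; rewrite {2}bc /= ltnn.
have [/eqP cP|/bmin] := boolP (rho c == mat_col c); last by rewrite leqNgt lt.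
by rewrite cP; apply: val_inj.
Qed.

(** Invariance under [U_s] is the delicate part: after expansion in the columns, a term survives
    only if no box is sent to a larger index, and unless it is the identity it repeats an index
    within a column, so its orbit sum cancels. *)
Lemma uT_mem_hwv (T : tableau la m) : u T \in hwv k m chi1 psi1.
Proof.
have split_lr P Q (A : mats k r s m) : lrmul P Q A = lrmul P 1%:M (lrmul 1%:M Q A).
  by rewrite lrmulM mulmx1 mulmx1.
apply/hwvP; split.
- apply: (regular_ext (fun A => esym (uTE la_r la_s T A))).
  by apply: regular_bigsum => S _; apply: box_det_regular.
- move=> R Q /andP[Rt /forallP R1] /andP[Qt /forallP Q1] A; rewrite split_lr !uTE.
  have RE : \prod_x GL_mx R x x ^+ (rev_ord x < t)%N = 1.
    by rewrite big1 // => x _; rewrite (eqP (R1 x)) expr1n.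
  under eq_bigr do rewrite (fun w A => @box_det_mul_rows k r s m la la_r w _ A Rt) RE mul1r.
  under eq_bigr do rewrite box_det_mul_cols.
  rewrite exchange_big /= (bigD1 [ffun b => mat_col b]) //=.
  rewrite [X in _ + X]big1 => [|rho rhoP].
    rewrite addr0; apply: eq_bigr => S _; rewrite big1 ?mul1r.
      by congr (box_det _ _ _); apply/funext => b; rewrite ffunE.
    by move=> b _; rewrite ffunE (eqP (Q1 _)).
  rewrite -mulr_sumr.
  have [Q0|rho_le] := pselect (exists b, (mat_col b < rho b)%N).
    have [b bP] := Q0; rewrite (bigD1 b) //=.
    by have := is_trig_mxP Qt _ _ bP; rewrite mxE => ->; rewrite !mul0r.
  have {}rho_le b : (rho b <= mat_col b)%N.
    by rewrite leqNgt; apply/negP => bP; apply: rho_le; exists b.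
  have rho_ne : exists b, rho b != mat_col b.
    apply/existsP; apply: contraNT rhoP; rewrite negb_exists => /forallP ww.
    by apply/eqP/ffunP => b; apply/eqP; rewrite ffunE -[_ == _]negbK.
  have [b [c [bc col_bc rho_bc]]] := below_diagonal_repeat rho_le rho_ne.
  by rewrite (orbit_alternating _ _ bc) ?mulr0.
- move=> D E DT ET A; rewrite split_lr !uTE mulr_sumr; apply: eq_bigr => S _.
  have Dt : is_trig_mx (GL_mx D)^T.
    by case/diag_mxP: DT => d ->; rewrite tr_diag_mx; apply: diag_mx_is_trig.
  rewrite box_det_mul_rows // weight_char_neg_rev -mulrA; congr (_ * _).
  rewrite box_det_mul_cols (bigD1 [ffun b => mat_col b]) //=.
  rewrite [X in _ + X]big1 => [|rho rhoP]; last first.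
    have [b bP] : exists b, rho b != mat_col b.
      apply/existsP; apply: contraNT rhoP; rewrite negb_exists => /forallP ww.
      by apply/eqP/ffunP => b; apply/eqP; rewrite ffunE -[_ == _]negbK.
    case/diag_mxP: ET => e ->; rewrite (bigD1 b) //= mxE -val_eqE in bP *.
    by rewrite (negPf bP) !mul0r.
  rewrite addr0; congr (_ * _); last first.
    by congr (box_det _ _ _); apply/funext => b; rewrite ffunE.
  under eq_bigr do rewrite ffunE.
  rewrite (prod_mat_col (fun j => GL_mx E j j)); apply: eq_bigr => j _.
  by rewrite /part_weight.
Qed.

Local Notation SST := {T : tableau la m | row_semistandard T}.

(** At a tableau of maximal moment among those with nonzero coefficient, triangularity leaves only
    the diagonal term. *)
Lemma uT_independent (c : SST -> k) :
  (forall T' : SST, \sum_(T : SST) c T * coef (u (val T)) (index (val T')) = 0) ->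
  forall T, c T = 0.
Proof.
move=> c0 T; apply/eqP/contraT => cT.
case: (@arg_maxnP _ T (fun T => c T != 0) (fun T => moment (index (val T))) cT) => T0 cT0 T0max.
case/eqP: (cT0); rewrite -(c0 T0) (bigD1 T0) //= box_coef_uT_diag ?(valP T0) // mulr1.
rewrite big1 ?addr0 // => T1 T10; apply/eqP; rewrite mulf_eq0 -implyNb; apply/implyP.
move=> /T0max le; apply/contraT => /(box_coef_uT_triangular (valP T1) (valP T0)).
case=> [/val_inj e|]; first by rewrite e eqxx in T10.
by move=> lt; have := leq_trans lt le; rewrite ltnn.
Qed.

Lemma uT_basis :
  is_basis (hwv k m chi1 psi1) (fun T : SST => u (val T)).
Proof.
have coef_lin (c : SST -> k) w : coef (\sum_T c T *: u (val T)) w = \sum_T c T * coef (u (val T)) w.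
  rewrite /box_coef /box_form; move: (rows_mats _ _) => A.
  by elim/big_rec2: _ => // T x y _ <-.
split=> [T|c cE|f fH].
- exact: uT_mem_hwv.
- apply: uT_independent => T'; rewrite -coef_lin cE.
  by [].
(* Independence makes the square system of values at semi-standard tableaux solvable; the difference
   from [f] then vanishes by [hwv_determined]. *)
have [c cE] := square_system (fun T : SST => coef f (index (val T))) uT_independent.
exists c; apply/esym/eqP; rewrite -subr_eq0; apply/eqP.
have [h0 hD] := @hwv_submod k r s m chi1 psi1.
have sumH : \sum_T c T *: u (val T) \in hwv k m chi1 psi1.
  elim/big_ind: _ => // [x y xH yH|T _].
    by rewrite -[x]scale1r; apply: hD.
  by rewrite -[_ *: _]addr0; apply: hD => //; apply: uT_mem_hwv.
have dH : \sum_T c T *: u (val T) - f \in hwv k m chi1 psi1.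
  by rewrite addrC -scaleN1r; apply: hD.
apply: (hwv_determined (la_r := la_r) (la_s := la_s) dH) => T TS.
have -> : coef (\sum_T c T *: u (val T) - f) (index T) =
    coef (\sum_T c T *: u (val T)) (index T) - coef f (index T) by [].
by rewrite coef_lin; have /= -> := cE (exist _ T TS); rewrite subrr.
Qed.

End HighestWeightBasis.

(** * Semi-invariant polynomials on matrices *)

Section SemiInvariantPolynomials.
Variables (k : closedFieldType) (m D : nat) (nu : 'I_m -> nat).
Local Notation I := ('I_m * 'I_m)%type.
Local Notation expo := {ffun I -> 'I_D}.

Definition entry (e : I) (g : 'M[k]_m) : k^o := g e.1 e.2.
Definition mx_of (x : I -> k) : 'M[k]_m := \matrix_(i, j) x (i, j).

Definition height (alpha : expo) (j : 'I_m) (v : nat) : nat :=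
  (\sum_(i < m | (i < v)%N) alpha (i, j))%N.

(* If [alpha (i, j)] is read as the multiplicity of the entry [i] in a multiset
   attached to [j], with the multisets as the columns of a tableau in decreasing
   order of [j], the second condition is strict increase along rows. *)
Definition good_expo (alpha : expo) : bool :=
  [forall j, height alpha j m == nu j] &&
  [forall j : 'I_m, forall j' : 'I_m, forall v : 'I_m,
    (j' == j.+1 :> nat) ==> (height alpha j v.+1 <= height alpha j' v)%N].

Definition mrow (alpha : expo) (i : 'I_m) : nat := (\sum_(l < m) l * alpha (i, l))%N.
(** The counterpart of [moment], but straightening lowers it. *)
Definition expo_moment (alpha : expo) : nat := (\sum_(i < m) i * mrow alpha i)%N.

Variables (P : 'M[k]_m -> k^o) (C : expo -> k).
Hypothesis PC : monomial_form entry P C.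
Hypothesis P_scale : forall (g : 'M[k]_m) (e : 'I_m -> k), (forall j, e j != 0) ->
  P (\matrix_(i, j) (g i j * e j)) = (\prod_j e j ^+ nu j) * P g.
Hypothesis P_sub : forall (g : 'M[k]_m) (j j' : 'I_m), (j < j')%N ->
  P (\matrix_(i, l) (g i l - (l == j)%:R * g i j')) = P g.

Variables (tau : 'I_D.*2 -> k) (W : nat -> 'I_D.*2 -> k).
Hypothesis tauW :
  forall (q : {poly k}) n, (size q <= D.*2)%N -> \sum_t W n t * q.[tau t] = q`_n.
Local Notation cf := (coef_functional tau W).

Lemma coef_functional_sum (T : finType) (beta : I -> nat) (a : T -> k) (F : T -> (I -> k) -> k) :
  cf beta (fun x => \sum_i a i * F i x) = \sum_i a i * cf beta (F i).
Proof.
rewrite /coef_functional; under eq_bigr do rewrite mulr_sumr.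
rewrite exchange_big /=; apply: eq_bigr => i _; rewrite mulr_sumr.
by apply: eq_bigr => theta _; rewrite mulrCA.
Qed.

(** The substitutions below add two exponents less than [D], which is why interpolation uses [D.*2]
    points. *)
Lemma expo_lt (alpha : expo) e : (alpha e < D.*2)%N.
Proof. by apply: leq_trans (ltn_ord _) _; rewrite -addnn leq_addr. Qed.

Lemma monomial_form_coef (alpha : expo) (a : expo -> k) :
  cf (fun e => alpha e) (fun x => \sum_beta (C beta * a beta) * \prod_e x e ^+ beta e) = C alpha * a alpha.
Proof.
rewrite coef_functional_sum (bigD1 alpha) //= (coef_functional_monomial tauW _ (expo_lt alpha)).
have -> : [forall i, alpha i == alpha i :> nat] by apply/forallP.
rewrite mulr1 big1 ?addr0 // => beta beta_alpha.
rewrite (coef_functional_monomial tauW _ (expo_lt beta)).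
case: forallP => [e|]; last by rewrite mulr0.
by case/eqP: beta_alpha; apply/ffunP => i; apply/val_inj/eqP; apply: e.
Qed.

(** Scaling column [j] by [c] multiplies each monomial by [c] to its degree in that column, and [P]
    by [c ^+ nu j]; compare the coefficients of [alpha]. *)
Lemma expo_col_sum (alpha : expo) j : C alpha != 0 -> (\sum_i alpha (i, j) = nu j)%N.
Proof.
move=> Ca; apply: (@expr_fun_inj k) => c c0; apply: (mulfI Ca).
pose e l := if l == j then c else 1.
have e0 l : e l != 0 by rewrite /e; case: ifP; rewrite ?oner_neq0.
have prod_e (F : 'I_m -> nat) : \prod_l e l ^+ F l = c ^+ F j.
  rewrite (bigD1 j) //= /e eqxx big1 ?mulr1 // => l /negPf->.
  by rewrite expr1n.
rewrite -(monomial_form_coef alpha (fun beta => c ^+ (\sum_i beta (i, j)))).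
rewrite -(monomial_form_coef alpha (fun beta => c ^+ nu j)).
congr (coef_functional _ _ _ _); apply/funext => x.
have := P_scale (mx_of x) e0; rewrite !PC prod_e mulr_sumr => H.
transitivity (\sum_(a : expo) C a * \prod_i entry i (\matrix_(i0, j0) (mx_of x i0 j0 * e j0)) ^+ a i).
  apply: eq_bigr => a _; rewrite -mulrA; congr (_ * _).
  rewrite -[in LHS](prod_e (fun l => \sum_i a (i, l))%N).
  under [in LHS]eq_bigr do rewrite -prodrXr.
  rewrite exchange_big pair_big -big_split /=; apply: eq_bigr => -[i l] _.
  by rewrite /entry !mxE exprMn mulrC.
rewrite [LHS]H; apply: eq_bigr => a _; rewrite mulrCA mulrA; congr (_ * _).
by apply: eq_bigr => -[i l] _; rewrite /entry !mxE.
Qed.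

Section Substitution.
Variables (j j' : 'I_m) (F : (I -> k) -> 'M[k]_m).
Variables (b : 'I_m -> 'I_D -> nat -> nat -> k) (p q : 'I_m -> 'I_D -> nat -> nat -> nat).
Hypothesis jj' : j != j'.
Hypothesis F_other : forall x i l, l != j -> l != j' -> F x i l = x (i, l).
Hypothesis F_row : forall x i (A B : 'I_D),
  F x i j' ^+ A * F x i j ^+ B =
    \sum_kappa b i kappa A B * (x (i, j') ^+ p i kappa A B * x (i, j) ^+ q i kappa A B).
Hypothesis p_lt : forall i kappa (A B : 'I_D), (p i kappa A B < D.*2)%N.
Hypothesis q_lt : forall i kappa (A B : 'I_D), (q i kappa A B < D.*2)%N.

Definition subst_expo (alpha : expo) (kappa : {ffun 'I_m -> 'I_D}) (e : I) : nat :=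
  if e.2 == j' then p e.1 (kappa e.1) (alpha (e.1, j')) (alpha (e.1, j))
  else if e.2 == j then q e.1 (kappa e.1) (alpha (e.1, j')) (alpha (e.1, j))
  else alpha e.

(** A common frame for both substitutions of the Garnir argument: only two columns change, and each
    row is expanded with its own index [kappa i]. *)
Lemma coef_functional_subst (beta : I -> nat) :
  cf beta (fun x => P (F x)) =
  \sum_(alpha : expo) C alpha * \sum_(kappa : {ffun 'I_m -> 'I_D})
    (\prod_i b i (kappa i) (alpha (i, j')) (alpha (i, j))) *
      [forall e, subst_expo alpha kappa e == beta e]%:R.
Proof.
have row_split (G : 'I_m -> k) : \prod_l G l = G j' * G j * \prod_(l | (l != j) && (l != j')) G l.
  rewrite (bigD1 j') //= (bigD1 j) //= mulrA; congr (_ * _).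
  by apply: eq_bigl => l; rewrite andbC.
have -> : (fun x => P (F x)) = fun x => \sum_(alpha : expo) C alpha *
    \sum_(kappa : {ffun 'I_m -> 'I_D}) (\prod_i b i (kappa i) (alpha (i, j')) (alpha (i, j))) *
      \prod_e x e ^+ subst_expo alpha kappa e.
  apply/funext => x; rewrite PC; apply: eq_bigr => alpha _; congr (_ * _).
  have -> : \prod_e entry e (F x) ^+ alpha e =
      \prod_i \prod_l F x i l ^+ alpha (i, l).
    by rewrite pair_bigA; apply: eq_bigr => -[].
  have rowE i : \prod_l F x i l ^+ alpha (i, l) =
      \sum_kappa b i kappa (alpha (i, j')) (alpha (i, j)) *
        (x (i, j') ^+ p i kappa (alpha (i, j')) (alpha (i, j)) *
         x (i, j) ^+ q i kappa (alpha (i, j')) (alpha (i, j)) *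
         \prod_(l | (l != j) && (l != j')) F x i l ^+ alpha (i, l)).
    rewrite row_split F_row mulr_suml; apply: eq_bigr => kappa _.
    by rewrite -!mulrA.
  rewrite (eq_bigr _ (fun i _ => rowE i)).
  rewrite bigA_distr_bigA; apply: eq_bigr => kappa _; rewrite big_split; congr (_ * _).
  have -> : \prod_e x e ^+ subst_expo alpha kappa e =
      \prod_i \prod_l x (i, l) ^+ subst_expo alpha kappa (i, l).
    by rewrite pair_bigA; apply: eq_bigr => -[].
  apply: eq_bigr => i _; rewrite row_split /subst_expo /= eqxx (negPf jj') eqxx.
  congr (_ * _); apply: eq_bigr => l /andP[lj lj'].
  by rewrite F_other // (negPf lj) (negPf lj').
rewrite coef_functional_sum; apply: eq_bigr => alpha _; congr (_ * _).
rewrite coef_functional_sum; apply: eq_bigr => kappa _; congr (_ * _).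
apply: (coef_functional_monomial tauW) => e; rewrite /subst_expo.
by case: ifP => _; [exact: p_lt | case: ifP => _; [exact: q_lt | exact: expo_lt]].
Qed.

End Substitution.

(** The index runs over ['I_D] for every exponent, so that the index type does not vary with the
    row; the additional binomial coefficients are zero. *)
Lemma binomial_bounded (x y : k) (A : 'I_D) :
  (x + y) ^+ A = \sum_(kappa < D) 'C(A, kappa)%:R * (x ^+ (A - kappa) * y ^+ kappa).
Proof.
rewrite exprDn (big_ord_widen D (fun i => x ^+ (A - i) * y ^+ i *+ 'C(A, i))) //.
rewrite big_mkcond; apply: eq_bigr => i _; rewrite ltnS mulr_natl.
by case: leqP => // lt; rewrite bin_small.
Qed.

Section GarnirPolynomial.
Variables (j j' v : 'I_m).
Hypothesis jj' : (j < j')%N.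

(* Columns [j'] and [j] are replaced by [x + y] and [y + z] with [x] supported on
   rows above [v] and [z] on rows below [v]; the surviving variables are stored
   in the two columns themselves. *)
Definition garnir_mx (x : I -> k) : 'M[k]_m := \matrix_(i, l)
  if l == j' then if (i < v)%N then x (i, j') + x (i, j) else if (v < i)%N then x (i, j') else x (i, j)
  else if l == j then if (v < i)%N then x (i, j') + x (i, j) else x (i, j)
  else x (i, l).

(* Coefficients and exponents in the binomial expansion of row [i]. *)
Definition garnir_b i (kappa : 'I_D) (A B : nat) : k :=
  if (i < v)%N then 'C(A, kappa)%:R else if (v < i)%N then 'C(B, kappa)%:R else (kappa == 0%N :> nat)%:R.
Definition garnir_p i (kappa : 'I_D) (A B : nat) : nat :=
  if (i < v)%N then (A - kappa)%N else if (v < i)%N then (A + kappa)%N else 0%N.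
Definition garnir_q i (kappa : 'I_D) (A B : nat) : nat :=
  if (i < v)%N then (kappa + B)%N else if (v < i)%N then (B - kappa)%N else (A + B)%N.

(* These are the columns [x + y] and [z - x], so that the degree in [y] is at most
   [nu j']. *)
Definition reduced_mx (x : I -> k) : 'M[k]_m := \matrix_(i, l)
  (garnir_mx x i l - (l == j)%:R * garnir_mx x i j').
Definition reduced_b i (kappa : 'I_D) (A B : nat) : k :=
  if (i < v)%N then 'C(A, kappa)%:R * (-1) ^+ B
  else if (v < i)%N then (kappa == 0%N :> nat)%:R
  else (kappa == 0%N :> nat)%:R * 0 ^+ B.
Definition reduced_p i (kappa : 'I_D) (A B : nat) : nat :=
  if (i < v)%N then (A - kappa + B)%N else if (v < i)%N then A else 0%N.
Definition reduced_q i (kappa : 'I_D) (A B : nat) : nat :=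
  if (i < v)%N then kappa : nat else if (v < i)%N then B else A.

Let j_neq_j' : j != j'. Proof. by rewrite -val_eqE ltn_eqF. Qed.

(** Rows without a binomial expansion still carry an index, which is pinned to zero. *)
Lemma sum_kappa0 (A : 'I_D) (y : k) : \sum_(kappa < D) (kappa == 0%N :> nat)%:R * y = y.
Proof.
case: D A => [[]//|D' _]; rewrite (bigD1 ord0) //= mul1r big1 ?addr0 // => i i0.
by rewrite -[_ == 0%N]/(i == ord0) (negPf i0) mul0r.
Qed.

Lemma garnir_row x i (A B : 'I_D) :
  garnir_mx x i j' ^+ A * garnir_mx x i j ^+ B =
    \sum_kappa garnir_b i kappa A B *
      (x (i, j') ^+ garnir_p i kappa A B * x (i, j) ^+ garnir_q i kappa A B).
Proof.
rewrite /garnir_b /garnir_p /garnir_q !mxE !eqxx (negPf j_neq_j').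
case: (ltngtP i v) => _.
- rewrite binomial_bounded mulr_suml; apply: eq_bigr => kappa _.
  by rewrite exprD !mulrA.
- rewrite addrC binomial_bounded mulr_sumr; apply: eq_bigr => kappa _.
  by rewrite exprD; ring.
- by rewrite (sum_kappa0 A) expr0 mul1r exprD.
Qed.

Lemma reduced_row x i (A B : 'I_D) :
  reduced_mx x i j' ^+ A * reduced_mx x i j ^+ B =
    \sum_kappa reduced_b i kappa A B *
      (x (i, j') ^+ reduced_p i kappa A B * x (i, j) ^+ reduced_q i kappa A B).
Proof.
rewrite /reduced_b /reduced_p /reduced_q !mxE !eqxx [j' == j]eq_sym (negPf j_neq_j').
rewrite !mul0r !mul1r !subr0; case: (ltngtP i v) => _.
- rewrite opprD addrCA subrr addr0 binomial_bounded mulr_suml; apply: eq_bigr => kappa _.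
  by rewrite exprD [(- x _) ^+ _]exprNn; ring.
- by rewrite addrAC subrr add0r sum_kappa0.
- rewrite subrr; under eq_bigr do rewrite -mulrA.
  by rewrite (sum_kappa0 A) expr0 mul1r mulrC.
Qed.

(** The exponent arising from [alpha] when all binomial indices are zero. In row [v] both columns
    equal [y], stored at [(v, j)], so their exponents add up there. *)
Definition garnir_target (alpha : expo) (e : I) : nat :=
  if e.1 == v then if e.2 == j' then 0%N
    else if e.2 == j then (alpha (v, j) + alpha (v, j'))%N else alpha e
  else alpha e.

(** The target has degree [height alpha j v.+1 + (nu j' - height alpha j' v)] in [y], which exceeds
    [nu j']; in [reduced_mx] only column [j'] contains [y]. *)
Lemma reduced_coef0 (alpha : expo) : C alpha != 0 ->
    (height alpha j' v < height alpha j v.+1)%N ->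
  cf (garnir_target alpha) (fun x => P (reduced_mx x)) = 0.
Proof.
move=> Ca bad.
rewrite (@coef_functional_subst j j' _ reduced_b reduced_p reduced_q j_neq_j').
- apply: big1 => a _; apply/eqP; rewrite mulf_eq0 -implyNb; apply/implyP => Ca'.
  apply/eqP/big1 => kappa _; apply/eqP; rewrite mulf_eq0 -implyNb; apply/implyP.
  move=> /prodf_neq0 b0; case: forallP => // eqs.
  (* The left side is the degree of the target in the variable [y] of row [i]. *)
  have le (i : 'I_m) : ((if (i <= v)%N then alpha (i, j) : nat else 0) +
      (if (v <= i)%N then alpha (i, j') : nat else 0) <= a (i, j'))%N.
    have := eqs (i, j'); have := eqs (i, j); have := b0 i isT.
    rewrite /subst_expo /garnir_target /= !eqxx (negPf j_neq_j') /reduced_b /reduced_p /reduced_q -val_eqE /=.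
    case: (ltngtP i v) => [iv|iv|/val_inj->] /=.
    + move=> b_ /eqP <- _; rewrite addn0 leqNgt; apply/negP => lt.
      by rewrite bin_small // mul0r eqxx in b_.
    + by move=> _ _ /eqP <-.
    + by move=> _ /eqP -> _.
  have : (\sum_(i < m) ((if (i <= v)%N then alpha (i, j) : nat else 0) +
      (if (v <= i)%N then alpha (i, j') : nat else 0)) <= \sum_i a (i, j'))%N.
    by apply: leq_sum => i _; apply: le.
  rewrite big_split /= -!big_mkcond /= (expo_col_sum _ Ca') -(expo_col_sum j' Ca).
  rewrite [X in (_ <= X)%N](bigID (fun i : 'I_m => (i < v)%N)) /=.
  rewrite [X in (_ <= _ + X)%N](eq_bigl (fun i : 'I_m => (v <= i)%N)) => [|i]; last by rewrite -leqNgt.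
  by rewrite leq_add2r leqNgt; case/negP.
- move=> x i l lj lj'; rewrite !mxE (negPf lj) (negPf lj') mul0r subr0 //.
- exact: reduced_row.
- by move=> i kappa A B; rewrite /reduced_p; case: ifP => _; [|case: ifP => _];
    have := ltn_ord A; have := ltn_ord B; lia.
- by move=> i kappa A B; rewrite /reduced_q; case: ifP => _; [|case: ifP => _];
    have := ltn_ord A; have := ltn_ord B; have := ltn_ord kappa; lia.
Qed.

(** Exchange between two columns with fixed row sum changes [mrow] by [j' - j] times the amount
    moved; the additive form avoids truncated subtraction. *)
Lemma mrow_split (a alpha : expo) (i : 'I_m) :
  (forall l, l != j -> l != j' -> a (i, l) = alpha (i, l) :> nat) ->
  (a (i, j') + a (i, j) = alpha (i, j') + alpha (i, j))%N ->
  (mrow a i + (j' - j) * alpha (i, j') = mrow alpha i + (j' - j) * a (i, j'))%N.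
Proof.
move=> a_other a_sum; rewrite /mrow (bigD1 j') //= (bigD1 j) //=.
rewrite [in RHS](bigD1 j') //= [in RHS](bigD1 j) //=.
rewrite [in LHS](eq_bigr (fun l : 'I_m => (l * alpha (i, l))%N)) => [|l /andP[lj' lj]].
  by move: (\sum_(_ | _) _)%N => z; move: jj' a_sum; nia.
by rewrite a_other.
Qed.

Lemma sum_mrow (a : expo) : C a != 0 -> (\sum_i mrow a i = \sum_(l < m) l * nu l)%N.
Proof.
move=> Ca; rewrite /mrow exchange_big /=; apply: eq_bigr => l _.
by rewrite -(expo_col_sum l Ca) big_distrr.
Qed.

(** Any other exponent reaching the target has more weight in column [j'] above row [v] and less
    below it, with the same row and column sums; hence its moment is smaller. *)
Lemma garnir_coef (alpha : expo) :
    C alpha != 0 ->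
    (forall a, (expo_moment a < expo_moment alpha)%N -> C a = 0) ->
  cf (garnir_target alpha) (fun x => P (garnir_mx x)) = C alpha.
Proof.
move=> Ca IH.
have D_gt0 : (0 < D)%N by apply: leq_ltn_trans (ltn_ord (alpha (j, j))).
rewrite (@coef_functional_subst j j' _ garnir_b garnir_p garnir_q j_neq_j').
- rewrite (bigD1 alpha) //= (bigD1 [ffun=> Ordinal D_gt0]) //=.
  rewrite [\prod_i _]big1 => [|i _]; last first.
    by rewrite /garnir_b ffunE !bin0; case: ifP => //; case: ifP.
  have -> : [forall e, subst_expo j j' garnir_p garnir_q alpha [ffun=> Ordinal D_gt0] e ==
      garnir_target alpha e].
    apply/forallP => -[i l]; rewrite /subst_expo /garnir_target /garnir_p /garnir_q ffunE /= -[i == v]val_eqE /=.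
    have [->|lj'] := eqVneq l j'.
      by case: (ltngtP i v) => // _; rewrite ?subn0 ?addn0.
    have [->|lj] := eqVneq l j; last by case: ifP.
    by case: (ltngtP i v) => [_|_|/val_inj->]; rewrite ?subn0 // addnC.
  rewrite mulr1 [X in C alpha * (_ + X)]big1 ?addr0 ?mulr1 => [|kappa kappa0].
    rewrite -[RHS]addr0; congr (_ + _); apply: big1 => a a_alpha.
    apply/eqP; rewrite mulf_eq0 -implyNb; apply/implyP => Ca'.
    apply/eqP/big1 => kappa _; apply/eqP; rewrite mulf_eq0 -implyNb; apply/implyP.
    move=> /prodf_neq0 b0; case: forallP => // eqs; case/eqP: (Ca'); apply: IH.
    have a_other i l : l != j -> l != j' -> a (i, l) = alpha (i, l) :> nat.
      move=> lj lj'; have := eqs (i, l).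
      rewrite /subst_expo /garnir_target /= (negPf lj) (negPf lj') => /eqP ->.
      by case: eqP => // ->.
    have rowP (i : 'I_m) : [/\ (a (i, j') + a (i, j) = alpha (i, j') + alpha (i, j))%N,
        (i < v -> alpha (i, j') <= a (i, j'))%N & (v < i -> a (i, j') <= alpha (i, j'))%N].
      have := eqs (i, j'); have := eqs (i, j); have := b0 i isT.
      rewrite /subst_expo /garnir_target /= !eqxx (negPf j_neq_j') /garnir_b /garnir_p /garnir_q -val_eqE /=.
      case: (ltngtP i v) => [iv|iv|/val_inj->] /=.
      + have [ka|ka] := leqP (kappa i) (a (i, j')); last by rewrite bin_small // eqxx.
        by move=> _ /eqP e1 /eqP e2; split=> //; lia.
      + have [ka|ka] := leqP (kappa i) (a (i, j)); last by rewrite bin_small // eqxx.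
        by move=> _ /eqP e1 /eqP e2; split=> //; lia.
      + by move=> _ /eqP e1 _; split=> //; lia.
    have a_row i := mrow_split (a_other i) (let: And3 e _ _ := rowP i in e).
    (* With row weights shifted to [i - v], every row contributes with the same sign; the shift
       cancels because [sum_mrow] fixes the total. *)
    have le (i : 'I_m) : (i * mrow a i + v * mrow alpha i <= i * mrow alpha i + v * mrow a i)%N.
      have [_ lt gt] := rowP i; have := a_row i; move: (mrow a i) (mrow alpha i) => x y e.
      case: (ltngtP i v) => [iv|vi|-> //]; last by rewrite addnC.
        have yx : (y <= x)%N by have := lt iv; nia.
        by nia.
      have xy : (x <= y)%N by have := gt vi; nia.
      by nia.
    have [i0 i0P] : exists i : 'I_m, a (i, j') != alpha (i, j').
      apply: contrapT => same; case/eqP: a_alpha; apply/ffunP => -[i l]; apply: val_inj => /=.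
      have e1 : a (i, j') = alpha (i, j') :> nat.
        by apply/eqP; rewrite -[_ == _]negbK; apply/negP => ne; apply: same; exists i.
      have [->//|lj'] := eqVneq l j'; have [->|lj] := eqVneq l j; last exact: a_other.
      by have [+ _ _] := rowP i; rewrite e1 => /addnI.
    (* The sum of column [j'] is fixed, so a difference cannot be confined to row [v], the only row
       that contributes nothing. *)
    have [i1 i1v i1P] : exists2 i : 'I_m, i != v & a (i, j') != alpha (i, j').
      have [i0v|] := eqVneq i0 v; last by exists i0.
      apply: contrapT => same.
      have := expo_col_sum j' Ca'; rewrite -(expo_col_sum j' Ca) (bigD1 v) //= [RHS](bigD1 v) //=.
      rewrite (eq_bigr (fun i => alpha (i, j') : nat)) => [|i iv].
        by move/addIn/val_inj => e; rewrite i0v e eqxx in i0P.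
      by apply/eqP; rewrite -[_ == _]negbK; apply/negP => ne; apply: same; exists i.
    have lt1 : (i1 * mrow a i1 + v * mrow alpha i1 < i1 * mrow alpha i1 + v * mrow a i1)%N.
      have [_ lt gt] := rowP i1; have := a_row i1; move: (mrow a i1) (mrow alpha i1) => x y e.
      move: i1v i1P; rewrite -!val_eqE /= => i1v i1P.
      case: (ltngtP i1 v) => [iv|vi|iv]; last by rewrite iv eqxx in i1v.
        have yx : (y < x)%N by have := lt iv; move: i1P jj'; nia.
        by nia.
      have xy : (x < y)%N by have := gt vi; move: i1P jj'; nia.
      by nia.
    have : (\sum_(i < m) (i * mrow a i + v * mrow alpha i) <
        \sum_(i < m) (i * mrow alpha i + v * mrow a i))%N.
      rewrite (bigD1 i1) //= [X in (_ < X)%N](bigD1 i1) //= -addSn leq_add //.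
      by apply: leq_sum => i _; apply: le.
    by rewrite !big_split /= -!big_distrr /= (sum_mrow Ca') (sum_mrow Ca) ltn_add2r.
  apply/eqP; rewrite mulf_eq0 -implyNb; apply/implyP => /prodf_neq0 b0.
  case: forallP => // eqs; case/eqP: kappa0; apply/ffunP => i; apply: val_inj; rewrite ffunE /=.
  have := eqs (i, j'); have := eqs (i, j); have := b0 i isT.
  rewrite /subst_expo /garnir_target /= !eqxx (negPf j_neq_j') /garnir_b /garnir_p /garnir_q -val_eqE /=.
  case: (ltngtP i v) => [iv|iv|/val_inj->] /=.
  + by move=> _ /eqP e1 _; lia.
  + by move=> _ _ /eqP e1; lia.
  + move=> h _ _; apply/eqP; apply: contraNT h => /negPf->; exact: eqxx.
- by move=> x i l lj lj'; rewrite mxE (negPf lj) (negPf lj').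
- exact: garnir_row.
- by move=> i kappa A B; rewrite /garnir_p; case: ifP => _; [|case: ifP => _];
    have := ltn_ord A; have := ltn_ord B; have := ltn_ord kappa; lia.
- by move=> i kappa A B; rewrite /garnir_q; case: ifP => _; [|case: ifP => _];
    have := ltn_ord A; have := ltn_ord B; have := ltn_ord kappa; lia.
Qed.

End GarnirPolynomial.

(** By [P_sub] both substitutions give the same function, so a violated inequality would make one
    coefficient equal to both [C alpha] and 0. *)
Lemma semi_invariant_straighten (alpha : expo) : C alpha != 0 ->
    (forall a, (expo_moment a < expo_moment alpha)%N -> C a = 0) ->
  good_expo alpha.
Proof.
move=> Ca IH; apply/andP; split.
  apply/forallP => j; rewrite -(expo_col_sum j Ca); apply/eqP.
  by apply: eq_bigl => i; rewrite ltn_ord.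
apply/forallP => j; apply/forallP => j'; apply/forallP => v; apply/implyP => /eqP jj'.
have lt : (j < j')%N by rewrite jj'.
rewrite leqNgt; apply/negP => bad; case/eqP: (Ca).
rewrite -(garnir_coef v lt Ca IH) -(reduced_coef0 lt Ca bad).
by congr (coef_functional _ _ _ _); apply/funext => x; rewrite /reduced_mx P_sub.
Qed.

Lemma semi_invariant_determined :
  (forall alpha, good_expo alpha -> C alpha = 0) -> forall g, P g = 0.
Proof.
move=> C0; suff H n alpha : (expo_moment alpha < n)%N -> C alpha = 0.
  by move=> g; rewrite PC big1 // => alpha _; rewrite (H _ alpha (leqnn _)) mul0r.
elim: n alpha => // n IH alpha; rewrite ltnS => le; apply/eqP/contraT => Ca.
have IH' a : (expo_moment a < expo_moment alpha)%N -> C a = 0.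
  by move=> lt; apply: IH; apply: leq_trans lt le.
by have e := C0 _ (semi_invariant_straighten Ca IH'); rewrite e eqxx in Ca.
Qed.

End SemiInvariantPolynomials.

(** * Counting good exponents by tableaux *)

Section CountExponents.
Variables (m D N : nat) (la : seq nat).
Hypotheses (la_partition : is_partition la) (la_m : (head 0%N la <= m)%N).
Local Notation expo := {ffun 'I_m * 'I_m -> 'I_D}.
Local Notation SST := {T : tableau la m | row_semistandard T}.

Definition col_height (c : nat) : nat := nth 0%N (transpose_part la) c.

Lemma part_nth_le i j : (i <= j)%N -> (nth 0%N la j <= nth 0%N la i)%N.
Proof.
case/andP: la_partition => la_sorted _; rewrite leq_eqVlt => /predU1P[->//|ij].
have geq_trans : transitive geq by move=> x y z xy yz; apply: leq_trans yz xy.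
have [jl|lj] := ltnP j (size la); last by rewrite nth_default.
exact: (sorted_ltn_nth geq_trans 0%N la_sorted _ _ (ltn_trans ij jl) jl ij).
Qed.

Lemma col_heightE c : col_height c = count (fun p => c < p)%N la.
Proof.
rewrite /col_height /transpose_part; have [ch|hc] := ltnP c (head 0%N la).
  by rewrite nth_mkseq.
rewrite nth_default ?size_mkseq //; apply/esym/eqP; rewrite -leqn0 leqNgt -has_count.
apply/negP => /(has_nthP 0%N)[i _]; rewrite ltnNge => /negP; apply.
apply: leq_trans hc; rewrite -nth0; exact: part_nth_le.
Qed.

Lemma col_heightP i c : (i < col_height c)%N = (c < nth 0%N la i)%N.
Proof.
rewrite col_heightE; have := part_nth_le; move: i; elim: la => [|p l IH] i H /=.
  by rewrite nth_nil.
have Hl i' j' : (i' <= j')%N -> (nth 0 l j' <= nth 0 l i')%N.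
  by move=> ij; apply: (H i'.+1 j'.+1).
have tail0 : (p <= c)%N -> (count (fun p0 => c < p0) l = 0)%N.
  move=> pc; apply/eqP; rewrite -leqn0 leqNgt -has_count; apply/negP => /(has_nthP 0%N)[j _ cj].
  by have := H 0%N j.+1 isT => /= /(leq_trans cj); rewrite ltnNge pc.
case: i => [|i] /=; first by case: (ltnP c p) => // /tail0->.
by rewrite -IH //; case: (ltnP c p) => [_|/tail0->]; rewrite ?add1n ?ltnS.
Qed.

Lemma box_col_lt (b : box la) : (box_col b < m)%N.
Proof.
apply: leq_trans la_m; rewrite -nth0; apply: leq_trans (part_nth_le (leq0n _)).
exact: ltn_ord (tagged b).
Qed.

(** In a good exponent larger matrix columns carry smaller entries, so they become tableau columns
    further to the left. *)
Definition col_index (b : box la) : 'I_m := rev_ord (Ordinal (box_col_lt b)).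

Lemma col_index_eq b c : (col_index b == col_index c) = (box_col b == box_col c).
Proof. by rewrite (inj_eq rev_ord_inj). Qed.

Lemma box_row_lt_height (b : box la) : (box_row b < col_height (box_col b))%N.
Proof. by rewrite col_heightP; apply: ltn_ord (tagged b). Qed.

Lemma box_exists i c : (i < col_height c)%N ->
  exists b : box la, box_row b = i /\ box_col b = c.
Proof.
rewrite col_heightP => ci; have il : (i < size la)%N.
  by rewrite ltnNge; apply/negP => li; rewrite nth_default in ci.
by exists (Tagged (fun i : 'I_(size la) => 'I_(nth 0%N la i)) (i := Ordinal il) (Ordinal ci)).
Qed.

(* Column degrees of [f * det ^ N] for [f] in the costandard module. *)
Definition lowest_exponents (j : 'I_m) : nat := (col_height (rev_ord j) + N)%N.

Section OneExponent.
Variable alpha : expo.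
Hypothesis alpha_good : good_expo lowest_exponents alpha.
Local Notation h := (height alpha).

Lemma good_height_total (j : 'I_m) : h j m = (col_height (rev_ord j) + N)%N.
Proof. by case/andP: alpha_good => /forallP/(_ j)/eqP. Qed.

Lemma height_mono j v w : (v <= w)%N -> (h j v <= h j w)%N.
Proof.
move=> vw; rewrite /height [X in (_ <= X)%N](bigID (fun i : 'I_m => i < v)%N) /=.
rewrite (eq_bigl (fun i : 'I_m => (i < w) && (i < v))%N) ?leq_addr // => i.
by case: ltnP => iv; rewrite ?andbF ?andbT // (leq_trans iv vw).
Qed.

Lemma good_height_step (d : nat) (j j' : 'I_m) w :
  (j + d = j')%N -> (w + d <= m)%N -> (h j (w + d) <= h j' w)%N.
Proof.
elim: d j w => [|d IH] j w jj' wm.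
  by rewrite addn0 in jj'; rewrite addn0 (val_inj jj').
have j1m : (j.+1 < m)%N by apply: leq_ltn_trans (ltn_ord j'); lia.
apply: leq_trans (IH (Ordinal j1m) w _ _); rewrite /= ?addSnnS //; last by lia.
have wd : (w + d < m)%N by lia.
case/andP: alpha_good => _ /forallP/(_ j)/forallP/(_ (Ordinal j1m))/forallP/(_ (Ordinal wd)).
by rewrite /= eqxx addnS.
Qed.

(** Moving [w] columns to the right lowers the threshold to 0. *)
Lemma good_height_low (j : 'I_m) w : (j + w < m)%N -> h j w = 0%N.
Proof.
move=> jw; apply/eqP; rewrite -leqn0.
have := @good_height_step w j (Ordinal jw) 0 erefl; rewrite add0n => /(_ _).
have -> : h (Ordinal jw) 0 = 0%N by rewrite /height big_pred0.
by apply; lia.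
Qed.

(** Column 0 has total at least [N]; moving from it by [j] columns lowers the threshold from [m] to
    [m - j]. *)
Lemma good_height_high (j : 'I_m) w : (m <= j + w)%N -> (N <= h j w)%N.
Proof.
move=> jw; have m_gt0 : (0 < m)%N by apply: leq_ltn_trans (ltn_ord j).
have e : ((m - j) + j = m)%N by have := ltn_ord j; lia.
apply: (@leq_trans (h j (m - j))); last by apply: height_mono; lia.
apply: (@leq_trans (h (Ordinal m_gt0) (m - j + j))).
  by rewrite e good_height_total leq_addl.
by apply: good_height_step => //; rewrite e.
Qed.

(* Removes the contribution [N] of the antidiagonal positions, where every good
   exponent is at least [N]. *)
Definition reduced_height (j : 'I_m) (w : nat) : nat :=
  if (m <= j + w)%N then (h j w - N)%N else 0%N.

Lemma reduced_height_mono j v w : (v <= w)%N -> (reduced_height j v <= reduced_height j w)%N.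
Proof.
move=> vw; rewrite /reduced_height; case: (leqP m (j + v)) => // mv.
by rewrite ifT ?leq_sub2r ?height_mono //; lia.
Qed.

Lemma good_height_lt (j j' : 'I_m) w : (j < j')%N -> (w < m)%N -> (h j w.+1 <= h j' w)%N.
Proof.
move=> jj' wm; have [d jd] : exists d, (j.+1 + d = j')%N by exists (j' - j.+1)%N; lia.
elim: d j jd {jj'} => [|d IH] j jd.
  rewrite addn0 in jd; rewrite -addn1; apply: good_height_step; lia.
have j1m : (j.+1 < m)%N by apply: leq_ltn_trans (ltn_ord j'); lia.
apply: leq_trans (IH (Ordinal j1m) _); last by rewrite /= addSnnS.
rewrite -addn1; apply: leq_trans (@good_height_step 1 j (Ordinal j1m) w _ _) _; rewrite /= ?addn1 //.
by rewrite height_mono.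
Qed.

Lemma reduced_height_step (j j' : 'I_m) w : (j < j')%N -> (w < m)%N ->
  (reduced_height j w.+1 <= reduced_height j' w)%N.
Proof.
move=> jj' wm; rewrite /reduced_height; case: ifP => // jw.
by rewrite ifT ?leq_sub2r ?good_height_lt //; lia.
Qed.

Lemma reduced_heightK (j : 'I_m) w :
  h j w = (reduced_height j w + if (m <= j + w)%N then N else 0)%N.
Proof.
rewrite /reduced_height; case: leqP => jw; last by rewrite good_height_low.
by rewrite subnK // good_height_high.
Qed.

Lemma reduced_height_total (j : 'I_m) : reduced_height j m = col_height (rev_ord j).
Proof. by rewrite /reduced_height leq_addl good_height_total addnK. Qed.

Lemma box_entry_exists (b : box la) :
  exists v, (box_row b < reduced_height (col_index b) v.+1)%N.
Proof.
exists m.-1; rewrite prednK ?(leq_ltn_trans _ (ltn_ord (col_index b))) //.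
rewrite reduced_height_total rev_ordK; exact: box_row_lt_height.
Qed.

Lemma box_entry_lt (b : box la) : (ex_minn (box_entry_exists b) < m)%N.
Proof.
case: ex_minnP => v _ vmin; have m_gt0 : (0 < m)%N.
  exact: leq_ltn_trans (ltn_ord (col_index b)).
apply: leq_ltn_trans (vmin m.-1 _) _; last by rewrite prednK.
rewrite prednK // reduced_height_total rev_ordK; exact: box_row_lt_height.
Qed.

(** Each reduced multiset is listed in increasing order: row [i], counted from 0, receives the least
    [v] such that more than [i] elements are at most [v]. *)
Definition tableau_of_expo : tableau la m := [ffun b => Ordinal (box_entry_lt b)].

Lemma tableau_of_expo_le (b : box la) (v : nat) :
  (tableau_of_expo b <= v)%N = (box_row b < reduced_height (col_index b) v.+1)%N.
Proof.
rewrite ffunE /=; case: ex_minnP => w wP wmin; apply/idP/idP => [wv|/wmin//].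
by apply: leq_trans wP _; apply: reduced_height_mono.
Qed.

Lemma tableau_of_expo_semistandard : row_semistandard tableau_of_expo.
Proof.
apply/row_semistandardP; split=> b c.
  move=> row_bc col_bc; have := leqnn (tableau_of_expo c).
  rewrite tableau_of_expo_le => rc.
  have lt : (col_index c < col_index b)%N.
    by rewrite /=; have := box_col_lt c; lia.
  have := leq_trans rc (reduced_height_step lt (ltn_ord _)).
  case: {rc}(nat_of_ord (tableau_of_expo c)) => [|v].
    by rewrite /reduced_height /height big_pred0 //; case: ifP; rewrite ltn0.
  by rewrite ltnS tableau_of_expo_le row_bc.
move=> col_bc row_bc.
have := leqnn (tableau_of_expo c); rewrite tableau_of_expo_le => rc.
rewrite tableau_of_expo_le; move: rc.
have -> : col_index b = col_index c by apply/eqP; rewrite col_index_eq col_bc.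
exact: ltn_trans.
Qed.

End OneExponent.

(** Where two reduced heights differ, the box whose row number is the smaller one separates the
    tableaux. Successive differences of heights recover the exponents. *)
Lemma tableau_of_expo_inj (alpha beta : expo)
    (ga : good_expo lowest_exponents alpha) (gb : good_expo lowest_exponents beta) :
  tableau_of_expo ga = tableau_of_expo gb -> alpha = beta.
Proof.
have le (a b : expo) (ga' : good_expo lowest_exponents a) (gb' : good_expo lowest_exponents b) j w :
    tableau_of_expo ga' = tableau_of_expo gb' -> (w < m)%N ->
    (reduced_height a j w.+1 <= reduced_height b j w.+1)%N.
  move=> e wm; rewrite leqNgt; apply/negP => lt.
  have [i [row_i col_i]] : exists i : box la,
      box_row i = reduced_height b j w.+1 /\ box_col i = rev_ord j.
    apply: box_exists; apply: leq_trans lt _; rewrite -(reduced_height_total ga').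
    exact: reduced_height_mono.
  have ij : col_index i = j by apply: rev_ord_inj; apply: ord_inj; rewrite rev_ordK -col_i.
  have := tableau_of_expo_le ga' i w; rewrite e tableau_of_expo_le ij row_i lt.
  by rewrite ltnn.
move=> e; have height_eq j w : (w <= m)%N -> height alpha j w = height beta j w.
  case: w => [|w] wm; first by rewrite /height !big_pred0.
  rewrite (reduced_heightK ga) (reduced_heightK gb); congr (_ + _)%N.
  by apply/eqP; rewrite eqn_leq (le _ _ ga gb) // (le _ _ gb ga).
apply/ffunP => -[i j]; apply: val_inj => /=.
have := height_eq j i.+1 (ltn_ord i); rewrite /height (bigD1 i) //= [RHS](bigD1 i) //=.
have E (a : expo) : (\sum_(i0 < m | (i0 < i.+1)%N && (i0 != i)) a (i0, j) = height a j i)%N.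
  apply: eq_bigl => i0; rewrite ltnS -val_eqE /=; lia.
by rewrite !E height_eq ?(ltnW (ltn_ord i)) // => /addIn.
Qed.

Lemma card_good_expo :
  (#|{: {alpha : expo | good_expo lowest_exponents alpha}}| <= #|{: SST}|)%N.
Proof.
pose to_tab (a : {alpha : expo | good_expo lowest_exponents alpha}) : SST :=
  exist (fun T => row_semistandard T) _ (tableau_of_expo_semistandard (valP a)).
apply: (leq_card to_tab) => a b /(congr1 val) /= /tableau_of_expo_inj ab.
by case: a b ab => [a ga] [b gb] /= ab; apply: val_inj.
Qed.

End CountExponents.

(** * The costandard module *)

Section CostandardDimension.
Variables (k : closedFieldType) (m : nat) (la : seq nat).
Hypotheses (la_partition : is_partition la) (la_m : (head 0%N la <= m)%N).
Local Notation SST := {T : tableau la m | row_semistandard T}.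
Local Notation chi := (neg_rev (part_weight m (transpose_part la))).
Local Notation regular_mx := (regular_fun (@entry k m)).

(** On the line [g + x%:M] the determinant is a characteristic polynomial, hence nonzero, so the
    restriction of [Q] vanishes identically, also at [x = 0]. *)
Lemma regular_mx_dense (Q : 'M[k]_m -> k^o) : Q \in regular_mx ->
  (forall g, g \in unitmx -> Q g = 0) -> forall g, Q g = 0.
Proof.
move=> QR Q0 g.
have [p pE] : exists p : {poly k}, forall x, Q (g + x%:M) = p.[x].
  apply: (regular_line (q := fun e => (g e.1 e.2)%:P + (e.1 == e.2)%:R *: 'X)) QR.
  move=> [i j] x; rewrite /entry /= !mxE !hornerE mulrC.
  by case: eqP; rewrite ?mulr1 ?mulr0 ?mulr1n ?mulr0n.
have p0 : p = 0.
  apply: (poly_fun_neq0_eq0 (monic_neq0 (char_poly_monic (- g)))) => x.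
  rewrite -/(root _ x) -eigenvalue_root_char /eigenvalue /eigenspace negbK -pE => /eqP ker0.
  apply: Q0; have -> : g + x%:M = (-1) *: (- g - x%:M) by rewrite scaleN1r opprB opprK addrC.
  by rewrite unitmxZ ?unitrN1 // -row_free_unit -kermx_eq0 ker0.
by have := pE 0; rewrite p0 horner0 raddf0 addr0.
Qed.

Lemma bigprod_option (R : comNzRingType) (T : finType) (F : option T -> R) :
  \prod_x F x = F None * \prod_i F (Some i).
Proof.
rewrite (bigD1 None) //=; congr (_ * _).
rewrite (reindex_omap Some id) /=; last by case.
by apply: eq_bigl => i; rewrite eqxx.
Qed.

Lemma GL_regular_denominator (f : GL k m -> k^o) : f \in regular_fun (@GL_coord k m) ->
  exists N0, forall N, (N0 <= N)%N -> exists2 P : 'M[k]_m -> k^o, P \in regular_mx &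
    forall g : GL k m, P (GL_mx g) = f g * \det (GL_mx g) ^+ N.
Proof.
case/regular_monomial_form => D /(_ D (leqnn D))[C fC]; exists D => N DN.
exists (fun g : 'M[k]_m => \sum_alpha C alpha *
    ((\prod_e g e.1 e.2 ^+ alpha (Some e)) * \det g ^+ (N - alpha None)) : k^o).
  apply: regular_bigsum => alpha _; apply: regular_mul; first exact: regular_cst.
  apply: regular_mul.
    apply: regular_bigprod => e _; apply: regular_exp.
    exact: (regular_coord (@entry k m) e).
  apply: regular_exp; apply: (@regular_det _ _ _ _ _ id) => i j.
  exact: (regular_coord _ (i, j)).
move=> g; rewrite fC mulr_suml; apply: eq_bigr => alpha _.
rewrite bigprod_option /= -!mulrA; congr (_ * _).
rewrite mulrCA; congr (_ * _); first by apply: eq_bigr => -[i j].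
have d0 : \det (GL_mx g) != 0 by rewrite -unitfE -unitmxE; apply: GL_mx_unitmx.
have aN : (alpha None <= N)%N by apply: leq_trans DN; apply: ltnW.
by rewrite exprVn -{2}(subnK aN) exprD mulrCA mulVf ?mulr1 // expf_neq0.
Qed.

Section SemiInvariance.
Variables (f : GL k m -> k^o) (N : nat) (P : 'M[k]_m -> k^o).
Hypotheses (f_ind : f \in induced chi) (P_reg : P \in regular_mx).
Hypothesis Pf : forall g : GL k m, P (GL_mx g) = f g * \det (GL_mx g) ^+ N.
Local Notation nu := (@lowest_exponents m N la).

Lemma weight_char_costandard (b : GL k m) :
  (weight_char chi b)^-1 = \prod_j GL_mx b j j ^+ col_height la (rev_ord j).
Proof.
rewrite /weight_char -prodfV; apply: eq_bigr => j _.
by rewrite /neg_rev /part_weight -exprnN invrK.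
Qed.

(** For triangular [b] the factor [det ^ N] adds [N] to every exponent; density carries the rule
    from invertible [g] to all matrices. *)
Lemma semi_invariant_borel (b : GL k m) g : b \in @lower_borel k m ->
  P (g *m GL_mx b) = (\prod_j GL_mx b j j ^+ nu j) * P g.
Proof.
move=> bB; apply/subr0_eq; move: g; apply: regular_mx_dense.
  have -> : (fun g => P (g *m GL_mx b) - (\prod_j GL_mx b j j ^+ nu j) * P g) =
      (fun g => P (g *m GL_mx b) + (- \prod_j GL_mx b j j ^+ nu j) * P g : k^o).
    by apply/funext => g; rewrite mulNr.
  apply: regular_add; last by apply: regular_mul => //; apply: regular_cst.
  apply: regular_pull P_reg => -[i j].
  apply: (regular_ext (f := fun g : 'M[k]_m => \sum_l g i l * GL_mx b l j : k^o)).
    by move=> g; rewrite /entry mxE.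
  apply: regular_bigsum => l _; apply: regular_mul; last exact: regular_cst.
  exact: (regular_coord _ (i, l)).
move=> g gU; pose g' := GLof gU; have [_ fB] := asboolP _ f_ind.
have := Pf (g' * b)%g; rewrite fB // weight_char_costandard /= => ->.
rewrite (Pf g') det_mulmx exprMn (det_trig bB) /= /lowest_exponents.
under [in X in _ - X * _]eq_bigr do rewrite exprD.
rewrite big_split /= prodrXl; apply/eqP; rewrite subr_eq0; apply/eqP; ring.
Qed.

Lemma semi_invariant_scale (g : 'M[k]_m) (e : 'I_m -> k) : (forall j, e j != 0) ->
  P (\matrix_(i, j) (g i j * e j)) = (\prod_j e j ^+ nu j) * P g.
Proof.
move=> e0; have bB : GLof (diag_GL_unit e0) \in @lower_borel k m by apply: diag_mx_is_trig.
have := semi_invariant_borel g bB; rewrite /= => H.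
rewrite (_ : \matrix_(i, j) (g i j * e j) = g *m diag_mx (\row_i e i)).
  by rewrite H; congr (_ * _); apply: eq_bigr => j _; rewrite !mxE eqxx mulr1n.
by apply/matrixP => i j; rewrite mul_mx_diag !mxE.
Qed.

(** Subtracting a later column from an earlier one is right multiplication by a transposed
    transvection, which lies in the lower Borel subgroup. *)
Lemma semi_invariant_sub (g : 'M[k]_m) (j j' : 'I_m) : (j < j')%N ->
  P (\matrix_(i, l) (g i l - (l == j)%:R * g i j')) = P g.
Proof.
move=> jj'; have [b /andP[bT /forallP b1] bE] := transvection_unit (-1 : k) jj'.
have btU : (GL_mx b)^T \in unitmx by rewrite unitmx_tr GL_mx_unitmx.
have btB : GLof btU \in @lower_borel k m by [].
have := semi_invariant_borel g btB; rewrite /= big1 => [|i _]; last first.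
  by rewrite mxE (eqP (b1 i)) expr1n.
rewrite mul1r => <-; congr P; apply/matrixP => i l; rewrite bE !mxE.
rewrite (bigD1 l) //= !mxE eqxx.
have [->|lj] := eqVneq l j.
  rewrite (bigD1 j') //=; last by rewrite -val_eqE gtn_eqF.
  rewrite [X in _ + (_ + X)]big1 => [|l' /andP[l'j l'j']]; last first.
    by rewrite !mxE [j == l']eq_sym (negPf l'j) (negPf l'j') andbF mulr0 addr0 mulr0.
  by rewrite !mxE !eqxx [j == j'](ltn_eqF jj') /=; ring.
rewrite big1 => [|l' l'l]; first by rewrite /=; ring.
by rewrite !mxE [l == l']eq_sym (negPf l'l) (negPf lj) mulr0 addr0 mulr0.
Qed.

End SemiInvariance.

(** The upper bound for the dimension: with common [N] and [D], there are fewer good exponents than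
    functions, so some nontrivial combination has zero coefficients at all of them and vanishes. *)
Lemma costandard_dependent (I : finType) (f : I -> GL k m -> k^o) :
    (forall i, f i \in induced chi) -> (#|{: SST}| < #|I|)%N ->
  exists c : I -> k, (exists i, c i != 0) /\ forall g, \sum_i c i * f i g = 0.
Proof.
move=> f_ind card_I.
have /choice[N0 N0P] i : exists N0, forall N, (N0 <= N)%N ->
    exists2 P : 'M[k]_m -> k^o, P \in regular_mx &
      forall g : GL k m, P (GL_mx g) = f i g * \det (GL_mx g) ^+ N.
  by apply: GL_regular_denominator; have [] := asboolP _ (f_ind i).
pose N := (\max_i N0 i)%N.
have /choice[P PE] i : exists P : 'M[k]_m -> k^o, P \in regular_mx /\
    forall g : GL k m, P (GL_mx g) = f i g * \det (GL_mx g) ^+ N.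
  by have [P PR PE] := N0P i N (leq_bigmax i); exists P.
have /choice[D0 D0P] i : exists D, forall D', (D <= D')%N ->
    exists C, @monomial_form k _ _ (@entry k m) D' (P i) C.
  by apply: regular_monomial_form; have [] := PE i.
pose D := (\max_i D0 i)%N.
have /choice[C CE] i := D0P i D (leq_bigmax i).
pose good := {alpha : {ffun 'I_m * 'I_m -> 'I_D} | good_expo (lowest_exponents N la) alpha}.
have card_good : (#|{: good}| < #|I|)%N.
  by apply: leq_ltn_trans card_I; apply: card_good_expo.
have [c [c_neq0 cE]] := linear_dependence (fun i (alpha : good) => C i (val alpha)) card_good.
exists c; split=> // g.
have [tau [W tauW]] := interpolation_weights k D.*2.
pose Q (x : 'M[k]_m) : k^o := \sum_i c i * P i x.
have QC : monomial_form (@entry k m) Q (fun alpha => \sum_i c i * C i alpha).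
  move=> x; rewrite /Q; under eq_bigr do rewrite CE mulr_sumr.
  rewrite exchange_big; apply: eq_bigr => alpha _; rewrite mulr_suml.
  by apply: eq_bigr => i _; rewrite mulrA.
have Q0 : forall x, Q x = 0.
  apply: (semi_invariant_determined (nu := lowest_exponents N la) QC _ _ tauW).
  - move=> x e e0; rewrite /Q mulr_sumr; apply: eq_bigr => i _.
    have [PR Pf] := PE i.
    by rewrite (semi_invariant_scale (f_ind i) PR Pf) // mulrCA.
  - move=> x j j' jj'; apply: eq_bigr => i _; have [PR Pf] := PE i.
    by rewrite (semi_invariant_sub (f_ind i) PR Pf).
  - by move=> alpha ga; apply: (cE (exist (fun a => good_expo _ a) alpha ga)).
have d0 : \det (GL_mx g) != 0 by rewrite -unitfE -unitmxE; apply: GL_mx_unitmx.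
apply: (mulIf (expf_neq0 N d0)); rewrite mul0r mulr_suml -[RHS](Q0 (GL_mx g)).
by apply: eq_bigr => i _; have [_ ->] := PE i; rewrite mulrA.
Qed.

End CostandardDimension.

Lemma costandard_valP (k : fieldType) m (chi : 'I_m -> int) (a : k)
    (F F' : costandard k chi) (g : GL k m) :
  (val (a *: F + F') : GL k m -> k^o) g =
  a * (val F : GL k m -> k^o) g + (val F' : GL k m -> k^o) g.
Proof. by rewrite /=. Qed.

(** * The Weyl module through matrix coefficients *)

Section WeylIsomorphism.
Local Notation gact := Defs.gact.
Variables (k : closedFieldType) (m : nat) (chi : 'I_m -> int) (M : gmodule k (GL k m)).
Variables (I : finType) (e : I -> M) (coord : I -> M -> k) (v0 : M).
Hypothesis coordK : forall v, v = \sum_i coord i v *: e i.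
Hypothesis coord_linear : forall i a u v, coord i (a *: u + v) = a * coord i u + coord i v.
Hypothesis coord_basis : forall i j, coord i (e j) = (i == j)%:R.
Local Notation mcoef i := (fun g : GL k m => coord i (gact g v0) : k^o).
Hypothesis mcoef_induced : forall i, mcoef i \in @induced k m chi.
Hypothesis mcoef_free : forall c : I -> k,
  (forall g, \sum_i c i * mcoef i g = 0) -> forall i, c i = 0.
Hypothesis mcoef_span : forall f, f \in @induced k m chi ->
  exists c : I -> k, forall g, f g = \sum_i c i * mcoef i g.

(* The map sending a linear form [l] on [M] to the function [g |-> l (g v0)] is an
   isomorphism onto the costandard module; this is its transpose. *)
Lemma dual_costandard_iso : gmod_iso M (dual_gmodule (costandard k chi)).
Proof.
have /choice[l lE] (F : costandard k chi) :
    exists c : I -> k, forall g, (val F : GL k m -> k^o) g = \sum_i c i * mcoef i g.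
  exact: mcoef_span (valP F).
have l_uniq F (c : I -> k) :
    (forall g, (val F : GL k m -> k^o) g = \sum_i c i * mcoef i g) -> l F =1 c.
  move=> cE i; apply/subr0_eq; move: i; apply: mcoef_free => g.
  under eq_bigr do rewrite mulrBl.
  by rewrite sumrB -(lE F) -cE subrr.
have l_linear a F F' i : l (a *: F + F') i = a * l F i + l F' i.
  move: i; apply: l_uniq => g.
  rewrite costandard_valP (lE F) (lE F') mulr_sumr -big_split; apply: eq_bigr => i _ /=.
  by rewrite mulrDl mulrA.
have coord_sum i (c : I -> k) : coord i (\sum_j c j *: e j) = c i.
  have c0 : coord i 0 = 0.
    by have := coord_linear i (-1) 0 0; rewrite scaler0 addr0 mulN1r addNr.
  transitivity (\sum_j c j * coord i (e j)).
    by elim/big_rec2: _ => // j x y _ <-; rewrite coord_linear.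
  rewrite (bigD1 i) //= coord_basis eqxx mulr1 big1 ?addr0 // => j ji.
  by rewrite coord_basis eq_sym (negPf ji) mulr0.
pose phi0 (v : M) : costandard k chi -> k^o := fun F => \sum_i l F i * coord i v.
have phi0P v : phi0 v \in @linear_form _ _ (costandard k chi).
  apply/asboolP => a F F'; rewrite /phi0 scaler_sumr -big_split; apply: eq_bigr => i _.
  by rewrite l_linear mulrDl -mulrA.
pose phi (v : M) : dual_gmodule (costandard k chi) := exist _ (phi0 v) (phi0P v).
have phi_linear : linear phi.
  move=> a u v; apply: val_inj; apply/funext => F /=.
  transitivity (a * phi0 u F + phi0 v F); last by [].
  rewrite /phi0 mulr_sumr -big_split; apply: eq_bigr => i _.
  by rewrite coord_linear mulrDr mulrCA.
pose dual_elt (i : I) : costandard k chi := exist _ (mcoef i : GL k m -> k^o) (mcoef_induced i).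
have l_dual i j : l (dual_elt i) j = (j == i)%:R.
  move: j; apply: l_uniq => g /=; rewrite (bigD1 i) //= eqxx mul1r big1 ?addr0 //.
  by move=> j /negPf->; rewrite mul0r.
have phi_dual v i : phi0 v (dual_elt i) = coord i v.
  rewrite /phi0 (bigD1 i) //= l_dual eqxx mul1r big1 ?addr0 // => j ji.
  by rewrite l_dual (negPf ji) mul0r.
have phi_inj : injective phi.
  move=> u v uv; rewrite (coordK u) (coordK v); apply: eq_bigr => i _; congr (_ *: _).
  by rewrite -!phi_dual; have := congr1 (fun w => val w (dual_elt i)) uv.
have phi_surj w : exists v, phi v = w.
  (* The coordinates of the preimage are the values of [w] on the dual basis [dual_elt]. *)
  exists (\sum_i (val w : costandard k chi -> k^o) (dual_elt i) *: e i).
  apply: val_inj; apply/funext => F /=; rewrite /phi0.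
  have wL := asboolP _ (valP w).
  have FE : F = \sum_i l F i *: dual_elt i.
    apply: val_inj; apply/funext => g; rewrite lE.
    elim/big_rec2: _ => // i x y _ ->; by [].
  rewrite [in RHS]FE; transitivity (\sum_i l F i * (val w : costandard k chi -> k^o) (dual_elt i)).
    by apply: eq_bigr => i _; rewrite coord_sum.
  have w0 : (val w : costandard k chi -> k^o) 0 = 0.
    by have := wL (-1) 0 0; rewrite scaler0 addr0 scaleN1r addNr.
  by elim/big_rec2: _ => // i x y _ ->; rewrite wL.
have /choice[psi psiK] := phi_surj.
have coord_act j g v : coord j (gact g v) = \sum_i coord i v * coord j (gact g (e i)).
  have act0 : gact g (0 : M) = 0.
    by have := @gact_linear _ _ M g (-1) 0 0; rewrite scaler0 addr0 scaleN1r addNr.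
  have c0 : coord j 0 = 0.
    by have := coord_linear j (-1) 0 0; rewrite scaler0 addr0 mulN1r addNr.
  rewrite {1}(coordK v); elim/big_rec2: _ => [|i x y _ <-]; first by rewrite act0.
  by rewrite gact_linear coord_linear.
pose phiL : {linear M -> dual_gmodule (costandard k chi)} :=
  HB.pack phi (GRing.isLinear.Build k M (dual_gmodule (costandard k chi)) _ phi phi_linear).
exists phiL; split; first by exists psi => // v; apply: phi_inj; rewrite psiK.
move=> g v; apply: val_inj; apply/funext => F /=; rewrite /fun_gact /phi0.
(* Translating a matrix coefficient by [g^-1] applies [g] to the vector, so functions transform by
   the transpose of the action on [M]. *)
have lg : forall i, l (gact g^-1%g F) i = \sum_j l F j * coord j (gact g (e i)).
  apply: l_uniq => x /=; rewrite /fun_gact invgK lE.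
  under [RHS]eq_bigr do rewrite mulr_suml.
  rewrite exchange_big; apply: eq_bigr => j _ /=.
  under [RHS]eq_bigr do rewrite -mulrA.
  rewrite -mulr_sumr Defs.gactM; congr (_ * _); rewrite coord_act.
  by apply: eq_bigr => i _; rewrite mulrC.
under [RHS]eq_bigr do rewrite lg mulr_suml.
rewrite exchange_big; apply: eq_bigr => j _ /=; rewrite coord_act mulr_sumr.
by apply: eq_bigr => i _; rewrite mulrA mulrAC -mulrA.
Qed.

End WeylIsomorphism.

Section WeylModule.
Variables (k : closedFieldType) (r s m : nat) (la : seq nat).
Hypotheses (la_partition : is_partition la) (la_m : (head 0%N la <= m)%N).
Hypotheses (la_r : (part_size la <= r)%N) (la_s : (size la <= s)%N).
Local Notation gact := Defs.gact.
Local Notation t := (part_size la).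
Local Notation chi1 := (neg_rev (part_weight r (nseq t 1%N))).
Local Notation psi1 := (part_weight s la).
Local Notation chi := (neg_rev (part_weight m (transpose_part la))).
Local Notation index := (@tab_index s m la la_s).
Local Notation det_of := (@box_det k r s m la la_r).
Local Notation u := (@uT k r s m la la_r la_s).
Local Notation cidx := (@col_index m la la_partition la_m).
Local Notation SST := {T : tableau la m | row_semistandard T}.
Local Notation M := (hwv_module k m chi1 psi1).
Local Notation D := #|{: box la}|.+1.
Local Notation expo := {ffun 'I_m * 'I_m -> 'I_D}.

(* [u_T] for this [T] is a vector of lowest weight. *)
Definition lowest_tableau : tableau la m := [ffun b => cidx b].

(** Its columns are constant, so its orbit is a single tableau. Its rows decrease, so in general it
    is not row semi-standard. *)
Lemma uT_lowest (A : mats k r s m) : u lowest_tableau A = det_of (index lowest_tableau) A.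
Proof.
rewrite uTE (big_pred1 lowest_tableau) // => S; apply/idP/eqP => [/col_orbitP[p p_col SE]|->].
  apply/ffunP => b; rewrite SE !ffunE; apply/eqP.
  by rewrite col_index_eq p_col.
exact: col_orbit_id.
Qed.

Lemma uT_lowest_act (g : GL k m) (A : mats k r s m) :
  u lowest_tableau (mats_act_m g^-1%g A) =
  \sum_(S : tableau la m) (\prod_b GL_mx g (S b) (cidx b)) * det_of (index S) A.
Proof.
rewrite uT_lowest box_det_mats_act; apply: eq_bigr => S _; congr (_ * _).
by apply: eq_bigr => b _; rewrite ffunE.
Qed.

(** The exponent of the monomial in [g] with which [S] occurs in [g v]. Counts are at most the
    number of boxes, so [inord] is exact. *)
Definition content (S : tableau la m) : expo :=
  [ffun e => inord #|[pred b | (S b, cidx b) == e]|].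

Lemma contentE (S : tableau la m) e : content S e = #|[pred b | (S b, cidx b) == e]| :> nat.
Proof. by rewrite ffunE inordK // ltnS max_card. Qed.

Lemma prod_content (G : 'I_m * 'I_m -> k) (S : tableau la m) :
  \prod_b G (S b, cidx b) = \prod_e G e ^+ content S e.
Proof.
rewrite (partition_big (fun b => (S b, cidx b)) xpredT) //=; apply: eq_bigr => e _.
by rewrite contentE -prodr_const; apply: eq_big => [b|b /eqP->].
Qed.

(** Equal contents mean equal fibres of the map to pairs of entry and column; [fiber_card_perm]
    turns this into a permutation within columns. *)
Lemma content_orbit (T S : tableau la m) : (S \in col_orbit T) = (content S == content T).
Proof.
apply/col_orbitP/eqP => [[p p_col SE]|ST].
  apply/ffunP => e; apply: val_inj; rewrite /= !contentE.
  rewrite -!sum1_card [RHS](reindex_inj (@perm_inj _ p)); apply: eq_bigl => b.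
  rewrite !inE SE (_ : cidx (p b) = cidx b) //; apply/eqP.
  by rewrite col_index_eq p_col.
have [p pE] : exists p : {perm box la}, forall b, (S b, cidx b) = (T (p b), cidx (p b)).
  apply: (@fiber_card_perm _ _ (fun b => (T b, cidx b)) (fun b => (S b, cidx b))) => e.
  by rewrite -!contentE ST.
exists p => b; last by have [] := pE b.
have [_ /eqP] := pE b; rewrite -[_ == _]/(cidx b == cidx (p b)) col_index_eq.
by move/eqP.
Qed.

(** Indexing by all exponents, with zero sums where no tableau occurs, writes [g v] with distinct
    monomials over one finite type. *)
Definition content_sum (kappa : expo) : mats k r s m -> k^o :=
  fun A => \sum_(S | content S == kappa) det_of (index S) A.

Lemma content_sumE (S : tableau la m) : content_sum (content S) = u S.
Proof.
apply/funext => A; rewrite uTE; apply: eq_bigl => S'.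
by rewrite content_orbit.
Qed.

Lemma content_sum_mem kappa : content_sum kappa \in hwv k m chi1 psi1.
Proof.
have [S /eqP SE|noS] := pickP (fun S => content S == kappa).
  by rewrite -SE content_sumE; apply: uT_mem_hwv.
have -> : content_sum kappa = 0.
  by apply/funext => A; rewrite /content_sum big_pred0.
by have [] := @hwv_submod k r s m chi1 psi1.
Qed.

Lemma uT_lowest_act_content (g : GL k m) (A : mats k r s m) :
  u lowest_tableau (mats_act_m g^-1%g A) =
  \sum_(kappa : expo) (\prod_e GL_mx g e.1 e.2 ^+ kappa e) * content_sum kappa A.
Proof.
rewrite uT_lowest_act (partition_big content xpredT) //=; apply: eq_bigr => kappa _.
rewrite mulr_sumr; apply: eq_bigr => S /eqP <-; congr (_ * _).
exact: (prod_content (fun e => GL_mx g e.1 e.2)).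
Qed.

(** In the leftmost column where [S] differs, its entry is larger than the lowest one and thus
    occurs further left in the same row, which produces two equal columns. *)
Lemma box_det_above_lowest (S : tableau la m) A :
    (forall b, cidx b <= S b)%N -> S != lowest_tableau ->
  det_of (index S) A = 0.
Proof.
move=> S_ge SnT.
have [b0 b0P] : exists b, S b != cidx b.
  apply/existsP; apply: contraNT SnT; rewrite negb_exists => /forallP SE.
  by apply/eqP/ffunP => b; apply/eqP; rewrite ffunE -[_ == _]negbK.
case: (@arg_minnP _ b0 (fun b => S b != cidx b) (@box_col la) b0P) => b bP bmin.
have lt : (rev_ord (S b) < box_col b)%N.
  have := S_ge b; rewrite leq_eqVlt val_eqE eq_sym (negPf bP) /=.
  by have := box_col_lt la_partition la_m b; have := ltn_ord (S b); lia.
have lt_c : (rev_ord (S b) < nth 0%N la (tag b))%N := ltn_trans lt (ltn_ord (tagged b)).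
pose c : box la := Tagged (fun i : 'I_(size la) => 'I_(nth 0%N la i)) (Ordinal lt_c).
have Sc : S c = S b.
  have [/eqP->|/bmin] := boolP (S c == cidx c); last by rewrite leqNgt lt.
  by apply: rev_ord_inj; rewrite /col_index rev_ordK; apply: ord_inj.
have bc : b != c by apply: contraTneq lt => ->; rewrite Sc ltnn.
by apply: (box_det_alt bc); apply/funext => a; rewrite /= Sc.
Qed.

Lemma card_col_index j : #|[pred b | cidx b == j]| = col_height la (rev_ord j).
Proof.
have /choice[h hE] : forall i : 'I_(col_height la (rev_ord j)), exists b : box la,
    box_row b = i /\ box_col b = rev_ord j.
  by move=> i; apply: (box_exists la_partition); apply: ltn_ord.
have h_inj : injective h.
  by move=> i i' hi; apply: ord_inj; have [<- _] := hE i; have [<- _] := hE i'; rewrite hi.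
rewrite -[RHS]card_ord -(card_codom h_inj); apply: eq_card => b; rewrite inE.
have colP : (cidx b == j) = (box_col b == rev_ord j :> nat).
  by rewrite -(inj_eq rev_ord_inj) /col_index rev_ordK -val_eqE.
rewrite colP; apply/eqP/codomP => [bj|[i ->]]; last by have [] := hE i.
have lt : (box_row b < col_height la (rev_ord j))%N.
  by rewrite -bj; apply: box_row_lt_height.
exists (Ordinal lt); have [r1 c1] := hE (Ordinal lt).
by apply: box_eq; rewrite ?r1 ?c1.
Qed.

(** A term is nonzero for lower triangular [b] only if each entry of [S] is at least the lowest one,
    and then [box_det_above_lowest] leaves a single term. *)
Lemma uT_lowest_borel (b : GL k m) (A : mats k r s m) : b \in @lower_borel k m ->
  u lowest_tableau (mats_act_m b^-1%g A) = (weight_char chi b)^-1 * u lowest_tableau A.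
Proof.
move=> bB; rewrite uT_lowest_act (bigD1 lowest_tableau) //= -uT_lowest.
rewrite [X in _ + X]big1 ?addr0 => [|S SnT].
  congr (_ * _); rewrite weight_char_costandard.
  rewrite (partition_big (fun b => cidx b) xpredT) //=; apply: eq_bigr => j _.
  rewrite -card_col_index -prodr_const; apply: eq_big => [x|x /eqP <-] //.
  by rewrite ffunE.
have [Sge|] := boolP [forall x, (cidx x <= S x)%N].
  by rewrite (box_det_above_lowest _ _ SnT) ?mulr0 //; apply/forallP.
rewrite negb_forall => /existsP[x]; rewrite -ltnNge => Sx.
by rewrite (bigD1 x) //= (is_trig_mxP bB _ _ Sx) !mul0r.
Qed.

Definition basis_elt (T : SST) : M :=
  exist _ (u (val T) : mats k r s m -> k^o) (uT_mem_hwv k la_partition la_r la_s (val T)).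

Definition lowest_elt : M :=
  exist _ (u lowest_tableau : mats k r s m -> k^o) (uT_mem_hwv k la_partition la_r la_s lowest_tableau).

Definition content_elt kappa : M := exist _ (content_sum kappa) (content_sum_mem kappa).

Lemma hwv_module_valP (a : k) (v w : M) A :
  (val (a *: v + w) : mats k r s m -> k^o) A =
  a * (val v : mats k r s m -> k^o) A + (val w : mats k r s m -> k^o) A.
Proof. by rewrite /=. Qed.

Lemma hwv_module_val_sum (I : finType) (a : I -> k) (v : I -> M) A :
  (val (\sum_i a i *: v i) : mats k r s m -> k^o) A =
  \sum_i a i * (val (v i) : mats k r s m -> k^o) A.
Proof.
elim/big_rec2: _ => // i x y _ <-.
exact: hwv_module_valP.
Qed.

Lemma gact_lowest (g : GL k m) :
  gact g lowest_elt = \sum_(kappa : expo) (\prod_e GL_mx g e.1 e.2 ^+ kappa e) *: content_elt kappa.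
Proof.
apply: val_inj; apply/funext => A; rewrite hwv_module_val_sum.
exact: uT_lowest_act_content.
Qed.

Lemma gact_lowest_borel (b : GL k m) : b \in @lower_borel k m ->
  gact b lowest_elt = (weight_char chi b)^-1 *: lowest_elt.
Proof.
move=> bB; apply: val_inj; apply/funext => A.
by rewrite /= /fun_gact uT_lowest_borel.
Qed.

Lemma expo_functions_free (a : expo -> k) :
    (forall g : 'M[k]_m, \sum_(kappa : expo) a kappa * \prod_e g e.1 e.2 ^+ kappa e = 0) ->
  forall kappa, a kappa = 0.
Proof.
move=> a0 kappa; have [tau [W tauW]] := interpolation_weights k D.*2.
have := monomial_form_coef (fun=> 1) tauW kappa a; rewrite mul1r => <-.
rewrite /coef_functional big1 // => theta _; set F := (X in _ * X).
suff -> : F = 0 by rewrite mulr0.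
rewrite /F -[RHS](a0 (\matrix_(i, j) tau (theta (i, j)))).
apply: eq_bigr => beta _; rewrite mul1r; congr (_ * _).
by apply: eq_bigr => -[i j] _; rewrite mxE.
Qed.

Lemma hwv_weyl_iso : gmod_iso M (weyl k (part_weight m (transpose_part la))).
Proof.
have [_ u_free u_span] := @uT_basis k r s m la la_partition la_r la_s.
have /choice[c cE] (w : M) : exists c : SST -> k,
    (val w : mats k r s m -> k^o) = \sum_T c T *: (u (val T) : mats k r s m -> k^o).
  exact: u_span (valP w).
have sumE (d : SST -> k) A :
    (\sum_T d T *: (u (val T) : mats k r s m -> k^o)) A = \sum_T d T * u (val T) A.
  by elim/big_rec2: _ => // T x y _ <-.
have c_uniq (w : M) (d : SST -> k) :
    (forall A, (val w : mats k r s m -> k^o) A = \sum_T d T * u (val T) A) -> c w =1 d.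
  move=> dE T; apply/subr0_eq; move: T; apply: u_free; apply/funext => A.
  rewrite sumE; under eq_bigr do rewrite mulrBl.
  by rewrite sumrB -dE cE sumE subrr.
have c_linear T a v w : c (a *: v + w) T = a * c v T + c w T.
  move: T; apply: c_uniq => A; rewrite hwv_module_valP !cE !sumE mulr_sumr -big_split.
  by apply: eq_bigr => T _ /=; rewrite mulrDl mulrA.
have c_basis T T' : c (basis_elt T') T = (T == T')%:R.
  move: T; apply: c_uniq => A; rewrite (bigD1 T') //= eqxx mul1r big1 ?addr0 // => T /negPf->.
  by rewrite mul0r.
have c0 T : c 0 T = 0.
  by have := c_linear T (-1) 0 0; rewrite scaler0 addr0 mulN1r addNr.
have c_sum (I : finType) (a : I -> k) (v : I -> M) T :
    c (\sum_i a i *: v i) T = \sum_i a i * c (v i) T.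
  by elim/big_rec2: _ => // i x y _ <-; rewrite c_linear.
pose mcoef (T : SST) : GL k m -> k^o := fun g => c (gact g lowest_elt) T.
have mcoefE T g : mcoef T g =
    \sum_(kappa : expo) (\prod_e GL_mx g e.1 e.2 ^+ kappa e) * c (content_elt kappa) T.
  by rewrite /mcoef gact_lowest c_sum.
have mcoef_ind T : mcoef T \in @induced k m chi.
  apply/asboolP; split; last first.
    move=> g b bB; rewrite /mcoef Defs.gactM gact_lowest_borel //.
    have act0 : gact g (0 : M) = 0.
      by have := @gact_linear _ _ M g (-1) 0 0; rewrite scaler0 addr0 scaleN1r addNr.
    have := @gact_linear _ _ M g (weight_char chi b)^-1 lowest_elt 0.
    rewrite act0 !addr0 => ->; have := c_linear T (weight_char chi b)^-1 (gact g lowest_elt) 0.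
    by rewrite addr0 => ->; rewrite c0 addr0.
  apply: (regular_ext (fun g => esym (mcoefE T g))).
  apply: regular_bigsum => kappa _; apply: regular_mul; last exact: regular_cst.
  apply: regular_bigprod => -[i j] _; apply: regular_exp.
  exact: (regular_coord (@GL_coord k m) (Some (i, j))).
(* The coefficient of the monomial attached to [content T0] isolates [d T0], because the
   corresponding vector is the basis vector of [T0]. *)
have mcoef_free (d : SST -> k) : (forall g, \sum_T d T * mcoef T g = 0) -> forall T, d T = 0.
  move=> d0 T0; pose a (kappa : expo) := \sum_T d T * c (content_elt kappa) T.
  have a0 : forall kappa, a kappa = 0.
    apply: expo_functions_free; apply: (@regular_mx_dense k m
      (fun g => \sum_(kappa : expo) a kappa * \prod_e g e.1 e.2 ^+ kappa e : k^o)).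
      apply: regular_bigsum => kappa _; apply: regular_mul; first exact: regular_cst.
      apply: regular_bigprod => e _; apply: regular_exp.
      exact: (regular_coord (@entry k m) e).
    move=> g gU; rewrite -[RHS](d0 (GLof gU)).
    under [RHS]eq_bigr do rewrite mcoefE mulr_sumr.
    rewrite [RHS]exchange_big; apply: eq_bigr => kappa _; rewrite mulr_suml.
    by apply: eq_bigr => T _ /=; rewrite -mulrA; congr (_ * _); rewrite mulrC.
  have := a0 (content (val T0)); rewrite /a.
  have -> : content_elt (content (val T0)) = basis_elt T0.
    by apply: val_inj; rewrite /= content_sumE.
  rewrite (bigD1 T0) //= c_basis eqxx mulr1 big1 ?addr0 // => T TT0.
  by rewrite c_basis (negPf TT0) mulr0.
(* Adjoining [f] exceeds the dimension bound; since the [mcoef] are independent, the dependence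
   involves [f]. *)
have mcoef_span f : f \in @induced k m chi ->
    exists d : SST -> k, forall g, f g = \sum_T d T * mcoef T g.
  move=> f_ind; pose F (o : option SST) := if o is Some T then mcoef T else f.
  have [||d [[o do0] dE]] := @costandard_dependent k m la la_partition la_m (option SST) F.
  - by case.
  - by rewrite card_option.
  have {}dE g : d None * f g + \sum_T d (Some T) * mcoef T g = 0.
    rewrite -[RHS](dE g) [RHS](bigD1 None) //=; congr (_ + _).
    rewrite [RHS](reindex_omap Some id) /=; last by case.
    by apply: eq_bigl => T; rewrite eqxx.
  have dN : d None != 0.
    apply: contraNneq do0 => d0; case: o => [T|]; last by rewrite d0.
    apply/eqP; move: T; apply: mcoef_free => g.
    by rewrite -[RHS](dE g) d0 mul0r add0r.
  exists (fun T => - (d None)^-1 * d (Some T)) => g.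
  under eq_bigr do rewrite -mulrA.
  rewrite -mulr_sumr; have /eqP := dE g; rewrite addrC addr_eq0 => /eqP->.
  by rewrite mulrN mulNr opprK mulrA mulVf ?mul1r.
apply: (@dual_costandard_iso k m chi M SST basis_elt (fun T w => c w T) lowest_elt) => //.
move=> w; apply: val_inj; apply/funext => A; rewrite hwv_module_val_sum cE sumE.
by [].
Qed.

End WeylModule.

(** * The second family of functions *)

Section AntiTranspose.
Variables (k : fieldType) (m : nat).

(** Reversing both bases after transposition keeps upper triangular matrices upper triangular, which
    transposition alone does not. *)
Definition anti_tr a b (P : 'M[k]_(a, b)) : 'M[k]_(b, a) :=
  \matrix_(i, j) P (rev_ord j) (rev_ord i).

Lemma anti_tr_mul a b c (P : 'M[k]_(a, b)) (Q : 'M[k]_(b, c)) :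
  anti_tr (P *m Q) = anti_tr Q *m anti_tr P.
Proof.
apply/matrixP => i j; rewrite !mxE (reindex_inj rev_ord_inj).
by apply: eq_bigr => l _; rewrite !mxE mulrC.
Qed.

Lemma anti_tr_unit n (g : GL k n) : anti_tr (GL_mx g) \in unitmx.
Proof.
have : anti_tr (GL_mx g) *m anti_tr (invmx (GL_mx g)) = 1%:M.
  rewrite -anti_tr_mul mulVmx ?GL_mx_unitmx //; apply/matrixP => i j.
  by rewrite !mxE (inj_eq rev_ord_inj) eq_sym.
by case/mulmx1_unit.
Qed.

Definition GL_anti_tr n (g : GL k n) : GL k n := GLof (anti_tr_unit g).

Lemma anti_tr_upper n (g : GL k n) :
  g \in @upper_unitri k n -> GL_anti_tr g \in @upper_unitri k n.
Proof.
case/andP=> gt /forallP g1; apply/andP; split.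
  apply/is_trig_mxP => i j ij; rewrite !mxE.
  have lt : (rev_ord j < rev_ord i)%N by rewrite /=; have := ltn_ord j; lia.
  by have := is_trig_mxP gt _ _ lt; rewrite mxE.
by apply/forallP => i; rewrite mxE; apply: g1.
Qed.

Lemma anti_tr_diag n (g : GL k n) :
  g \in @diag_torus k n -> GL_anti_tr g \in @diag_torus k n.
Proof.
move=> gT; apply/is_diag_mxP => i j ij; rewrite mxE.
apply: (is_diag_mxP gT); move: ij => /=.
by have := ltn_ord i; have := ltn_ord j; lia.
Qed.

Lemma weight_char_anti_tr n (chi chi' : 'I_n -> int) (g : GL k n) :
  (forall i, chi' i = - chi (rev_ord i)) ->
  weight_char chi (GL_anti_tr g) = (weight_char chi' g)^-1.
Proof.
move=> chiE; rewrite /weight_char (reindex_inj rev_ord_inj) -prodfV.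
by apply: eq_bigr => i _; rewrite mxE rev_ordK chiE invr_expz opprK.
Qed.

Definition flip a b (A : mats k a b m) : mats k b a m :=
  [ffun i => anti_tr (A i)].

Lemma flipK a b : cancel (@flip a b) (@flip b a).
Proof.
by move=> A; apply/ffunP => i; apply/matrixP => x j; rewrite !ffunE !mxE !rev_ordK.
Qed.

Lemma flip_lrmul a b P Q (A : mats k a b m) :
  flip (lrmul P Q A) = lrmul (anti_tr Q) (anti_tr P) (flip A).
Proof.
by apply/ffunP => i; rewrite !ffunE !anti_tr_mul mulmxA.
Qed.

Lemma flip_act a b g (A : mats k a b m) : flip (mats_act_m g A) = mats_act_m g (flip A).
Proof.
apply/ffunP => i; rewrite !ffunE; apply/matrixP => x j; rewrite mxE !summxE.
by apply: eq_bigr => l _; rewrite !mxE ffunE mxE.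
Qed.

Lemma flip_hwv a b (chi : 'I_a -> int) (psi : 'I_b -> int) (chi' : 'I_b -> int)
    (psi' : 'I_a -> int) (f : mats k a b m -> k^o) :
    (forall i, chi' i = - psi (rev_ord i)) -> (forall i, psi' i = - chi (rev_ord i)) ->
  f \in hwv k m chi psi -> (fun A => f (flip A)) \in hwv k m chi' psi'.
Proof.
move=> chiE psiE /hwvP[fR fU fT]; apply/hwvP; split.
- apply: regular_pull fR => -[[i x] j].
  apply: (regular_ext _ (regular_coord (@mats_coord k b a m) (i, rev_ord j, rev_ord x))).
  by move=> A; rewrite /mats_coord /= ffunE mxE.
- move=> R S RU SU A; rewrite flip_lrmul.
  exact: (fU _ _ (anti_tr_upper SU) (anti_tr_upper RU)).
- move=> R S RT ST A; rewrite flip_lrmul.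
  have := fT _ _ (anti_tr_diag ST) (anti_tr_diag RT) (flip A).
  rewrite /= (weight_char_anti_tr S psiE) (weight_char_anti_tr R chiE) invrK => ->.
  by rewrite [_^-1 * _]mulrC.
Qed.

Lemma flip_iso a b (chi : 'I_a -> int) (psi : 'I_b -> int) (chi' : 'I_b -> int)
    (psi' : 'I_a -> int) :
    (forall i, chi' i = - psi (rev_ord i)) -> (forall i, psi' i = - chi (rev_ord i)) ->
  gmod_iso (hwv_module k m chi psi) (hwv_module k m chi' psi').
Proof.
move=> chiE psiE.
have chiE' i : chi i = - psi' (rev_ord i) by rewrite psiE opprK rev_ordK.
have psiE' i : psi i = - chi' (rev_ord i) by rewrite chiE opprK rev_ordK.
pose phi (f : hwv_module k m chi psi) : hwv_module k m chi' psi' :=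
  exist (fun v => v \in hwv k m chi' psi') _ (flip_hwv chiE psiE (valP f)).
pose psi0 (f : hwv_module k m chi' psi') : hwv_module k m chi psi :=
  exist (fun v => v \in hwv k m chi psi) _ (flip_hwv chiE' psiE' (valP f)).
have phi_linear : linear phi.
  by move=> c u v; apply: val_inj; apply/funext => A /=.
pose phiL : {linear hwv_module k m chi psi -> hwv_module k m chi' psi'} :=
  HB.pack phi (GRing.isLinear.Build k (hwv_module k m chi psi) (hwv_module k m chi' psi') _ phi phi_linear).
exists phiL; split.
  by exists psi0 => f; apply: val_inj; apply/funext => A /=; rewrite flipK.
by move=> g f; apply: val_inj; apply/funext => A /=; rewrite /fun_gact flip_act.
Qed.
End AntiTranspose.

Lemma gmod_iso_trans (k : fieldType) (G : groupType) (M N Q : gmodule k G) :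
  gmod_iso M N -> gmod_iso N Q -> gmod_iso M Q.
Proof.
move=> [f [f_bij fG]] [g [g_bij gG]].
exists [the {linear M -> Q} of g \o f]; split; first exact: bij_comp.
by move=> x v /=; rewrite fG gG.
Qed.

Section SecondBasis.
Variables (k : closedFieldType) (r s m : nat) (la : seq nat).
Hypothesis la_partition : is_partition la.
Hypotheses (la_r : (part_size la <= r)%N) (la_s : (size la <= s)%N).
Local Notation t := (part_size la).
Local Notation chi1 := (neg_rev (part_weight r (nseq t 1%N))).
Local Notation psi1 := (part_weight s la).
Local Notation chi2 := (neg_rev (part_weight s la)).
Local Notation psi2 := (part_weight r (nseq t 1%N)).
Local Notation SST := {T : tableau la m | row_semistandard T}.

(** Under [flip] the first [t] rows of the transposes become the last [t] rows in reverse order,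
    which costs this sign. *)
Definition rev_sign : k := (-1) ^+ perm (@rev_ord_inj t).

Lemma rev_sign_neq0 : rev_sign != 0.
Proof. by rewrite signr_eq0. Qed.

Lemma vT_flip (T : tableau la m) (A : mats k s r m) :
  vT k la_r la_s T A = rev_sign * uT k la_r la_s T (flip A).
Proof.
rewrite uTE mulr_sumr; apply: eq_bigr => S _.
rewrite /rev_sign -det_perm -det_mulmx -row_permE; congr (\det _).
apply/matrixP => a c; rewrite !mxE -[existT _ _ _]/(Tagged _ _) -tagnat.sigE12.
rewrite (bigD1 (rev_ord (widen_ord la_s (tag (box_unrank c))))) //= big1 ?addr0 => [|j /negPf jc]; last first.
  by rewrite [in X in _ * X]mxE jc mulr0.
rewrite !mxE !eqxx mulr1 ffunE mxE permE.
congr (A _ _ _); apply: ord_inj => /=.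
have := ltn_ord a; lia.
Qed.

Lemma neg_rev_flip n (chi : 'I_n -> int) i : neg_rev chi i = - chi (rev_ord i).
Proof. by []. Qed.

Lemma neg_rev_flipV n (chi : 'I_n -> int) i : chi i = - neg_rev chi (rev_ord i).
Proof. by rewrite /neg_rev rev_ordK opprK. Qed.

Lemma vT_basis :
  is_basis (hwv k m chi2 psi2) (fun T : SST => vT k la_r la_s (val T)).
Proof.
have [u_mem u_free u_span] := @uT_basis k r s m la la_partition la_r la_s.
have [_ hD] := @hwv_submod k s r m chi2 psi2.
have h0 : 0 \in hwv k m chi2 psi2 by have [] := @hwv_submod k s r m chi2 psi2.
have sumE (W : Type) (d : SST -> k) (v : SST -> W -> k^o) x :
    (\sum_T d T *: v T) x = \sum_T d T * v T x.
  by elim/big_rec2: _ => // T y z _ <-.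
split=> [T|d d0|w wH].
- have -> : (vT k la_r la_s (val T) : mats k s r m -> k^o) =
      rev_sign *: (fun A => uT k la_r la_s (val T) (flip A)) + 0.
    by apply/funext => A; rewrite vT_flip addr0.
  apply: hD => //; apply: flip_hwv (u_mem T); first exact: neg_rev_flip.
  exact: neg_rev_flipV.
- have := u_free (fun T => d T * rev_sign); move=> H T.
  apply: (mulIf rev_sign_neq0); rewrite mul0r; apply: H; apply/funext => A.
  have := congr1 (fun f : mats k s r m -> k^o => f (flip A)) d0; rewrite !sumE => e.
  rewrite -[RHS]e; apply: eq_bigr => T' _; rewrite vT_flip flipK mulrA.
  by [].
have w'H : (fun A => w (flip A)) \in hwv k m chi1 psi1.
  by apply: flip_hwv wH => i; rewrite /neg_rev ?rev_ordK ?opprK.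
have [d dE] := u_span _ w'H; exists (fun T => d T * rev_sign^-1).
apply/funext => A; rewrite sumE.
have := congr1 (fun f : mats k r s m -> k^o => f (flip A)) dE.
rewrite /= flipK sumE => ->; apply: eq_bigr => T _.
by rewrite vT_flip -mulrA mulKf ?rev_sign_neq0.
Qed.

End SecondBasis.

Theorem theorem2 (k : closedFieldType) (r s m : nat) (la : seq nat)
    (m_gt0 : (0 < m)%N) (la_partition : is_partition la)
    (la_r : (part_size la <= r)%N) (la_s : (size la <= s)%N)
    (la_m : (head 0%N la <= m)%N) :
  let t := part_size la in
  let chi1 := neg_rev (part_weight r (nseq t 1%N)) in
  let psi1 := part_weight s la in
  let chi2 := neg_rev (part_weight s la) in
  let psi2 := part_weight r (nseq t 1%N) in
  [/\ is_basis (hwv k m chi1 psi1)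
        (fun T : {T : tableau la m | row_semistandard T} =>
           uT k la_r la_s (val T)),
      is_basis (hwv k m chi2 psi2)
        (fun T : {T : tableau la m | row_semistandard T} =>
           vT k la_r la_s (val T)),
      gmod_iso (hwv_module k m chi1 psi1)
        (weyl k (part_weight m (transpose_part la)))
    & gmod_iso (hwv_module k m chi2 psi2)
        (weyl k (part_weight m (transpose_part la)))].
Proof.
split.
- exact: uT_basis.
- exact: vT_basis.
- exact: hwv_weyl_iso.
- apply: gmod_iso_trans (flip_iso _ _ _ _) (hwv_weyl_iso k la_partition la_m la_r la_s).
    exact: neg_rev_flip.
  exact: neg_rev_flipV.
Qed.
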